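(* Let $\tilde{S}_{\pi/2}$ be the restriction of $\hat{S}_{\pi/2}$ to $\operatorname{dom}(S^* )$. For $\gamma\in(0,\pi)$, define $\tilde{S}_\gamma:\operatorname{dom}(S^* )\to\mathcal{B}_{-2}^{(\pi/2)}$ by $$\tilde{S}_\gamma:=\tilde{S}_{\pi/2}-\frac{\cot\gamma}{\pi}\langle s_0,\cdot\rangle_{\mathcal{F}}\,s_0(z).$$ Then $S_\gamma$ is the restriction of $\tilde{S}_\gamma$ to $\operatorname{dom}(S_\gamma)$.
   Context: Inner products are conjugate linear in the left argument. For an entire function $f$, $f^\#(z):=\overline{f(\overline z)}$. A Hilbert space of entire functions is a de Branges (dB) space if it has a reproducing kernel and is isometrically invariant under $f\mapsto f^\#$ and under $f(z)\mapsto \frac{z-\overline w}{z-w}f(z)$ whenever $w$ is a non-real zero of $f$. The Hermite-Biehler class consists of entire $e$ with $|e(z)|>|e(\overline z)|$ for all $z$ with $\operatorname{Im} z>0$; for such $e$, $\mathcal{B}(e)$ is the space of entire $f$ with $f/e,\,f^\#/e\in H^2(\mathbb{C}_+)$ (Hardy space of the upper half plane), with inner product $\langle f,g\rangle=\int_{\mathbb{R}}\frac{\overline{f(x)}g(x)}{|e(x)|^2}dx$. Every nonzero dB space equals some $\mathcal{B}(e)$ isometrically. Fix a nonzero dB space $\mathcal{B}=\mathcal{B}(e)$ with $e$ in the Hermite-Biehler class and without real zeros (standing assumption), with reproducing kernel $k(z,w)$, $f(w)=\langle k(\cdot,w),f\rangle$. The set $\operatorname{assoc}\mathcal{B}$ of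 associated functions is $z\mathcal{B}+\mathcal{B}$. Put $s_\gamma(z)=\frac{i}{2}[e^{i\gamma}e(z)-e^{-i\gamma}e^\#(z)]$, $\gamma\in[0,\pi)$; then $s_\gamma\in\operatorname{assoc}\mathcal{B}$. $S$ is the operator of multiplication by the independent variable on its maximal domain in $\mathcal{B}$; it is assumed throughout that $\operatorname{dom}(S)$ is dense. One has $k(\cdot,w)\in\ker(S^*-\overline wI)$. The canonical selfadjoint extensions of $S$ are $S_\gamma$, $\gamma\in[0,\pi)$: with any $w\in\mathbb{C}\setminus\mathbb{R}$ (the result does not depend on $w$), $$\operatorname{dom}(S_\gamma)=\left\{g(z)=\frac{f(z)-\frac{s_\gamma(z)}{s_\gamma(w)}f(w)}{z-w}: f\in\mathcal{B}\right\},\qquad S_\gamma g(z)=zg(z)+f(w)\frac{s_\gamma(z)}{s_\gamma(w)}.$$ $\mathcal{B}_{+2}^{(\pi/2)}$ is $\operatorname{dom}(S_{\pi/2})$ with inner product $\langle f,g\rangle_{+2}:=\langle S_{\pi/2}f,S_{\pi/2}g\rangle+\langle f,g\rangle$; $\mathcal{B}_{-2}^{(\pi/2)}$ is its dual, realized as the completion of $\mathcal{B}$ under the norm of $\langle f,g\rangle_{-2}:=\langle f,(S_{\pi/2}^2+I)^{-1}g\rangle$ (so $\mathcal{B}\subset\mathcal{B}_{-2}^{(\pi/2)}$), with pairing $\langle\cdot,\cdot\rangle_2:\mathcal{B}_{-2}^{(\pi/2)}\times\mathcal{B}_{+2}^{(\pi/2)}\to\mathbb{C}$ extending the inner product of $\mathcal{B}$.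 Since $\|S_{\pi/2}f\|_{-2}\le\|f\|$ for $f\in\operatorname{dom}(S_{\pi/2})$, $S_{\pi/2}$ has a unique contractive continuation $\hat{S}_{\pi/2}:\mathcal{B}\to\mathcal{B}_{-2}^{(\pi/2)}$. $\mathcal{F}_{+1}$ is $\operatorname{dom}(S^* )$ with the graph inner product $\langle S^*f,S^*g\rangle+\langle f,g\rangle$; its dual $\mathcal{F}_{-1}$ is the completion of $\mathcal{B}$ in the dual norm, and $\langle\cdot,\cdot\rangle_{\mathcal{F}}:\mathcal{F}_{-1}\times\mathcal{F}_{+1}\to\mathbb{C}$ is the continuous extension of the inner product of $\mathcal{B}$, with $\langle f,\phi\rangle_{\mathcal{F}}:=\overline{\langle\phi,f\rangle_{\mathcal{F}}}$ for $f\in\mathcal{F}_{+1},\phi\in\mathcal{F}_{-1}$. The map sending $\psi\in\mathcal{F}_{-1}$ to $f(z)=\langle k(\cdot,z),\psi\rangle_{\mathcal{F}}$ is a bijection onto $\operatorname{assoc}\mathcal{B}$, by which $\mathcal{F}_{-1}$ and $\operatorname{assoc}\mathcal{B}$ are identified; for $f\in\operatorname{assoc}\mathcal{B}$ corresponding to $\psi$, $\langle f,g\rangle_{\mathcal{F}}:=\langle\psi,g\rangle_{\mathcal{F}}$ for $g\in\operatorname{dom}(S^* )$, and $f$ is regarded as the element of $\mathcal{B}_{-2}^{(\pi/2)}$ given by $\langle f,h\rangle_2:=\langle\psi,h\rangle_{\mathcal{F}}$, $h\in\operatorname{dom}(S_{\pi/2})$. This applies in particular to $s_0$. *)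

(* Defs.v *)
From mathcomp Require Import all_boot all_order all_algebra.
From mathcomp Require Import complex.
From mathcomp Require Import all_classical all_reals all_analysis.
Set Implicit Arguments.
Unset Strict Implicit.
Unset Printing Implicit Defensive.
Import Order.TTheory GRing.Theory Num.Theory ComplexField.Normc.
Import numFieldNormedType.Exports.
Local Open Scope classical_set_scope.
Local Open Scope complex_scope.
Local Open Scope ring_scope.

Section EntireFunctions.
Variable R : realType.
Local Notation C := (R[i]).
Implicit Types (f g e : C -> C) (z w : C).

Definition holomorphic_at f z : Prop := derivable (f : C^o -> C^o) z (1 : C^o).

Definition entire f : Prop := forall z, holomorphic_at f z.

Definition sharp f : C -> C := fun z => conjc (f (conjc z)).

Definition hardy2 f : Prop :=
  (forall z, 0 < complex.Im z -> holomorphic_at f z) /\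
  exists M : R, forall y : R, 0 < y ->
    (\int[lebesgue_measure]_x ((normc (f (x +i* y))) ^+ 2)%:E <= M%:E)%E.

Definition hermite_biehler e : Prop :=
  entire e /\ forall z, 0 < complex.Im z -> `|e (conjc z)| < `|e z|.

Definition Cintegral (F : R -> C) : C :=
  (\int[lebesgue_measure]_x complex.Re (F x))
  +i* (\int[lebesgue_measure]_x complex.Im (F x)).

End EntireFunctions.

Section InnerProductSpaces.
Variable R : realType.
Local Notation C := (R[i]).

Record ip_space := IPSpace {
  carrier :> (C -> C) -> Prop;
  ip : (C -> C) -> (C -> C) -> C }.

Implicit Types (B D : ip_space) (f g : C -> C).

Definition ipnorm D f : R := Num.sqrt (complex.Re (ip D f f)).

Definition same_ip_space B D : Prop :=
  carrier B = carrier D /\ forall f g, B f -> B g -> ip B f g = ip D f g.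

Definition is_inner_product_space B : Prop :=
  [/\ B (fun=> 0),
      (forall a f g, B f -> B g -> B (fun z => a * f z + g z)),
      (forall a f g h, B f -> B g -> B h ->
         ip B h (fun z => a * f z + g z) = a * ip B h f + ip B h g),
      (forall f g, B f -> B g -> ip B g f = conjc (ip B f g)) &
      (forall f, B f -> f <> (fun=> 0) -> 0 < ip B f f)].

Definition is_complete B : Prop :=
  forall u : nat -> C -> C, (forall n, B (u n)) ->
    (forall eps : R, 0 < eps -> exists N : nat, forall m n : nat,
       (N <= m)%N -> (N <= n)%N -> ipnorm B (fun z => u m z - u n z) < eps) ->
  exists2 f, B f & forall eps : R, 0 < eps -> exists N : nat, forall n : nat,
       (N <= n)%N -> ipnorm B (fun z => u n z - f z) < eps.

(* [k z w] is the paper's k(z,w), so that [k^~ w] is the function k(.,w). *)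
Definition reproducing_kernel B (k : C -> C -> C) : Prop :=
  forall w, B (k^~ w) /\ forall f, B f -> f w = ip B (k^~ w) f.

(* In the last clause the quotient is described by clearing denominators;
   elements of [B] being entire, this also fixes its value at [w]. *)
Definition dB_space B : Prop :=
  [/\ (forall f, B f -> entire f),
      is_inner_product_space B /\ is_complete B,
      (exists k, reproducing_kernel B k),
      (forall f, B f -> B (sharp f) /\ ipnorm B (sharp f) = ipnorm B f) &
      (forall f w, B f -> complex.Im w != 0 -> f w = 0 ->
         exists g, [/\ B g, (forall z, (z - w) * g z = (z - conjc w) * f z) &
                       ipnorm B g = ipnorm B f])].

Definition dB_of (e : C -> C) : ip_space :=
  IPSpace
    (fun f => [/\ entire f, hardy2 (fun z => f z / e z)
                         & hardy2 (fun z => sharp f z / e z)])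
    (fun f g => Cintegral (fun x =>
       conjc (f x%:C) * g x%:C / `|e x%:C| ^+ 2)).

End InnerProductSpaces.

(* A partially defined operator is represented by its graph. *)
Section Operators.
Variable R : realType.
Local Notation C := (R[i]).
Local Notation F := (C -> C).

Definition opdom (Y : Type) (T : set (F * Y)) : set F :=
  [set f | exists y, T (f, y)].

Definition oprestrict (Y : Type) (T : set (F * Y)) (D : set F) : set (F * Y) :=
  [set p | T p /\ D p.1].

Definition opcomp (Y Z : Type) (j : Y -> Z) (T : set (F * Y)) : set (F * Z) :=
  [set p | exists2 y, T (p.1, y) & p.2 = j y].

(* The value at [f] of an operator whose domain contains [f]. *)
Definition opval (T : set (F * F)) (f : F) : F :=
  xget (fun=> 0) [set g | T (f, g)].

Definition densely_defined (B : ip_space R) (T : set (F * F)) : Prop :=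
  forall f, B f -> forall eps : R, 0 < eps ->
    exists2 g, opdom T g & ipnorm B (fun z => f z - g z) < eps.

Definition adjoint (B : ip_space R) (T : set (F * F)) : set (F * F) :=
  [set p | [/\ B p.1, B p.2 &
    forall f g, T (f, g) -> ip B p.1 g = ip B p.2 f]].

Definition graph_space (B : ip_space R) (T : set (F * F)) : ip_space R :=
  IPSpace (opdom T) (fun f g => ip B (opval T f) (opval T g) + ip B f g).

(* The operator (T^2 + I)^{-1}. *)
Definition sq_resolvent (T : set (F * F)) : set (F * F) :=
  [set p | exists u v, [/\ T (p.2, u), T (u, v) &
                           p.1 = (fun z => v z + p.2 z)]].

Definition minus2_norm (B : ip_space R) (T : set (F * F)) (f : F) : R :=
  Num.sqrt (complex.Re (ip B f (opval (sq_resolvent T) f))).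

Definition dual_norm (B D : ip_space R) (f : F) : R :=
  sup [set normc (ip B f g) | g in [set g | D g /\ ipnorm D g <= 1]].

(* [V], with the embedding [iota], is a completion of [B] under the norm [N]. *)
Definition is_completion (B : ip_space R) (N : F -> R)
    (V : completeNormedModType C) (iota : F -> V) : Prop :=
  [/\ (forall a f g, B f -> B g ->
         iota (fun z => a * f z + g z) = a *: iota f + iota g),
      (forall f, B f -> `|iota f| = (N f)%:C) &
      closure (iota @` (B : set F)) = [set: V]].

(* [pair] extends the inner product of [B] to [V] x [D] by continuity; as [B]
   is dense in [V], this determines [pair] on [V] x [D]. *)
Definition extends_ip (B D : ip_space R) (V : completeNormedModType C)
    (iota : F -> V) (pair : V -> F -> C) : Prop :=
  (forall f h, B f -> D h -> pair (iota f) h = ip B f h) /\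
  (forall h, D h -> continuous (fun phi : V => (pair phi h : C^o))).

Definition contractive_continuation (B : ip_space R) (T : set (F * F))
    (V : completeNormedModType C) (iota : F -> V) (That : F -> V) : Prop :=
  [/\ (forall a f g, B f -> B g ->
         That (fun z => a * f z + g z) = a *: That f + That g),
      (forall f, B f -> `|That f| <= (ipnorm B f)%:C) &
      (forall f g, T (f, g) -> That f = iota g)].

End Operators.

Section DeBrangesOperators.
Variable R : realType.
Local Notation C := (R[i]).
Local Notation F := (C -> C).

Definition cot (x : R) : R := cos x / sin x.

Definition cis (gamma : R) : C := cos gamma +i* sin gamma.

Definition s_fun (e : F) (gamma : R) : F := fun z =>
  (0 +i* 1) / 2 * (cis gamma * e z - cis (- gamma) * sharp e z).

Definition multop (B : ip_space R) : set (F * F) :=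
  [set p | [/\ B p.1, B p.2 & p.2 = (fun z => z * p.1 z)]].

(* Here too the quotient by z - w is written without denominator, [entire]
   removing the singularity at [w]. *)
Definition canonical_ext (B : ip_space R) (e : F) (w : C) (gamma : R) :
    set (F * F) :=
  [set p | exists2 f, B f &
    let s := s_fun e gamma in
    [/\ entire p.1,
        (forall z, (z - w) * p.1 z = f z - s z / s w * f w) &
        p.2 = (fun z => z * p.1 z + f w * (s z / s w))]].

(* [psi] in F_{-1} is identified with the associated function [f]:
   f(z) = <k(.,z), psi>_F, the conjugate of <psi, k(.,z)>_F. *)
Definition represents (W : Type) (k : C -> C -> C) (pairF : W -> F -> C)
    (psi : W) (f : F) : Prop :=
  forall z, f z = conjc (pairF psi (k^~ z)).

(* \tilde S_gamma, given \hat S_{pi/2} as [hatS], dom S^* as [D], and s_0 as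
   [psi0] in F_{-1} and as [sigma0] in B_{-2}^{(pi/2)}. *)
Definition tilde_pi2 (V : completeNormedModType C) (D : set F) (hatS : F -> V) :
    set (F * V) :=
  [set p | D p.1 /\ p.2 = hatS p.1].

Definition tilde_S (V : completeNormedModType C) (W : Type) (D : set F)
    (hatS : F -> V) (pairF : W -> F -> C) (psi0 : W) (sigma0 : V)
    (gamma : R) : set (F * V) :=
  [set p | exists2 v, tilde_pi2 D hatS (p.1, v) &
    p.2 = v - ((cot gamma / pi)%:C * pairF psi0 p.1) *: sigma0].

End DeBrangesOperators.

(* Main.v *)
Require Import Defs.
From mathcomp Require Import all_boot all_order all_algebra.
From mathcomp Require Import complex.
From mathcomp Require Import all_classical all_reals all_analysis.
From mathcomp Require Import measurable_realfun ring lra.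

(** Write [e = a - i b] with [a] and [b] real on the real line, so that
    [s_gamma = cos gamma b - sin gamma a]; in particular [s_0 = b] and
    [s_(pi/2) = - a].  Quotients by a base point [w] are replaced by the following
    description of [S_gamma]: its graph consists of the pairs [(g, u)] of elements
    of [B] with [u z = z g z + c s_gamma z] for some constant [c].  Both the
    operators and the vector [s_0] then reduce to statements about [c].

    For [(g, u)] in the graph of [S_gamma] with constant [c], and [(h, h')] in that of
    [S_(pi/2)] with constant [c'], two identities hold:
      - [<s_0, g>_F = - pi sin gamma c] ([functional_value]);
      - [<u, h> - <g, h'> = - pi cos gamma conj(c) c'] ([green_formula]).
    The first one, applied also to [h], gives [<s_0, h>_2 = - pi c'], so the second
    one says that [u - Shat_(pi/2) g] and [(cos gamma) c s_0] have the same pairing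
    with [h]; and [(cos gamma) c = - (cot gamma / pi) <s_0, g>_F].  As the
    domain of [S_(pi/2)] separates the points of [B_(-2)] ([pairing_separates]),
    this is the claim.

    Both identities rest on the formula
    [pi (z - conj w) k(z,w) = b z conj(a w) - a z conj(b w)] ([kernel_ab]), where the
    factor [pi] comes from.  It expresses Cauchy's formula for the Hardy space
    ([halfplane_cauchy]): for [f] in [B(e)], the integral of [f / e] against
    [1 / (x - w)] is [2 pi i] times the value of [f / e] at [w] when [w] lies in the
    upper half-plane, and zero when it lies in the lower one.  A contour rectangle is pushed to infinity; a function
    that is only bounded in [L^2] on horizontal lines may be large on the vertical
    sides, but not on all of them ([small_vertical_slice]).  Cauchy's formula for
    rectangles is derived from Goursat's theorem and the integral of [1 / (z - u)]
    over a square, and it also removes the zero of the numerator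
    ([removable_zero]), so that the right-hand side yields an element of [B(e)].

    The kernel formula makes [s_gamma] an associated function whose components are
    kernels, and this gives the symmetry of [S_gamma] ([extension_symmetric]).  All
    its resolvents at non-real points are explicit ([extension_resolvent]), and
    symmetry bounds them.  For the first identity, [s_0] is approximated in
    [F_(-1)] by elements of [B], whose resolvents at [conj w] converge in [B] to a
    multiple of [k(.,w)]; for the second, subtracting a multiple of a kernel moves
    [g] into the domain of [S_(pi/2)]. *)

Set Implicit Arguments.
Unset Strict Implicit.
Unset Printing Implicit Defensive.
Import Order.TTheory GRing.Theory Num.Theory ComplexField.Normc.
Import numFieldNormedType.Exports.
Local Open Scope classical_set_scope.
Local Open Scope complex_scope.
Local Open Scope ring_scope.

(** * Norm and differentiability on the complex numbers *)

Section Norm.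
Variable R : realType.
Local Notation C := R[i].
Implicit Types (z w : C) (f g : C -> C).

Lemma normc_normE z : `|z| = (normc z)%:C.
Proof. by []. Qed.

Lemma normc_ge0 z : 0 <= normc z.
Proof. by case: z => a b /=; rewrite sqrtr_ge0. Qed.

Lemma normc_gt0 z : (0 < normc z) = (z != 0).
Proof. by rewrite -ltcR -normc_normE normr_gt0. Qed.

Lemma normc_conj z : normc (conjc z) = normc z.
Proof. by case: z => a b /=; rewrite sqrrN. Qed.

Lemma ReB z w : complex.Re (z - w) = complex.Re z - complex.Re w.
Proof. by case: z w => ? ? []. Qed.

Lemma ImB z w : complex.Im (z - w) = complex.Im z - complex.Im w.
Proof. by case: z w => ? ? []. Qed.

Lemma real_complexD (r s : R) : (r + s)%:C = r%:C + s%:C :> C.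
Proof. by rewrite rmorphD. Qed.

Lemma real_complexM (r s : R) : (r * s)%:C = r%:C * s%:C :> C.
Proof. by rewrite rmorphM. Qed.

Lemma normc_real (x : R) : normc x%:C = `|x|.
Proof. by rewrite /= expr0n addr0 sqrtr_sqr. Qed.

Lemma normc_mulVl z w : z != 0 -> normc (w / z) = normc w / normc z.
Proof. by move=> z0; rewrite normcM normcV. Qed.

Lemma ler_Re_normc z : `|complex.Re z| <= normc z.
Proof. by rewrite -lecR; exact: normc_ge_Re. Qed.

Lemma ler_Im_normc z : `|complex.Im z| <= normc z.
Proof.
case: z => a b /=; rewrite -sqrtr_sqr ler_sqrt ?lerDr ?sqr_ge0 //.
by rewrite addr_ge0 // sqr_ge0.
Qed.

Lemma normc_le_ReIm z : normc z <= `|complex.Re z| + `|complex.Im z|.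
Proof.
have -> : normc z = normc ((complex.Re z)%:C + 'i%C * (complex.Im z)%:C).
  by rewrite -complexE.
apply: le_trans (le_normcD _ _) _.
by rewrite normcM !normc_real /= expr0n add0r expr1n sqrtr1 mul1r.
Qed.

Lemma normc_sqr z : normc z ^+ 2 = complex.Re z ^+ 2 + complex.Im z ^+ 2.
Proof. by case: z => a b /=; rewrite sqr_sqrtr // addr_ge0 // sqr_ge0. Qed.

Lemma normc_distC z w : normc (z - w) = normc (w - z).
Proof. by rewrite -normcN opprB. Qed.

Lemma ler_dist_normc z w : `|normc z - normc w| <= normc (z - w).
Proof.
rewrite ler_norml; apply/andP; split.
  rewrite lerNl opprB lerBlDr normc_distC; apply: le_trans (le_normcD _ _).
  by rewrite subrK.
by rewrite lerBlDr; apply: le_trans (le_normcD _ _); rewrite subrK.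
Qed.

(** Neighbourhoods in [R[i]] come with radii in [R[i]]; this brings them back to
    real radii and the real-valued norm. *)
Lemma near_normcP z (P : C -> Prop) :
  (\forall x \near (z : C^o), P x) <->
  exists2 d : R, 0 < d & forall x, normc (x - z) < d -> P x.
Proof.
split.
  move/nbhs_normP => -[[d d']] /=; rewrite ltcE /= => /andP[/eqP -> d0] H.
  exists d => // x xz; apply: H => /=.
  by rewrite distrC normc_normE ltcR.
case=> d d0 H; apply/nbhs_normP; exists d%:C => /=; first by rewrite ltcR.
by move=> x /=; rewrite distrC normc_normE ltcR; exact: H.
Qed.

Lemma cvg_normcP f z l :
  (f : C^o -> C^o) x @[x --> (z : C^o)] --> (l : C^o) <->
  forall e : R, 0 < e -> exists2 d : R, 0 < d &
    forall x, normc (x - z) < d -> normc (f x - l) < e.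
Proof.
split.
  move/cvgrPdist_lt => H e e0.
  have e0' : 0 < e%:C by rewrite ltcR.
  have /near_normcP[d d0 Hd] := H _ e0'.
  exists d => // x /Hd; rewrite normc_normE ltcR normc_distC; exact.
move=> H; apply/(@cvgrPdist_lt C C^o C^o (nbhs (z : C^o)) _ f l) => -[e e'].
rewrite ltcE /= => /andP[/eqP -> e0].
have [d d0 Hd] := H _ e0.
by apply/near_normcP; exists d => // x /Hd; rewrite normc_normE ltcR normc_distC.
Qed.

(** The form consumed by Goursat's argument: the error of the affine
    approximation is bounded on a whole neighbourhood, centre included. *)
Lemma holomorphic_atP f z : holomorphic_at f z <->
  exists l : C, forall e : R, 0 < e -> exists2 d : R, 0 < d &
    forall x, normc (x - z) < d ->
      normc (f x - f z - l * (x - z)) <= e * normc (x - z).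
Proof.
split.
  move=> /cvg_ex[/= l /cvgrPdist_lt H]; exists l => e e0.
  have e0' : 0 < e%:C by rewrite ltcR.
  have := H _ e0'.
  move=> /nbhs_ballP[[d d']] /=; rewrite ltcE /= => /andP[/eqP -> d0] Hd.
  exists d => // x xz; have [->|xz0] := eqVneq x z.
    by rewrite !subrr mulr0 subr0 normc0 mulr0.
  have := Hd (x - z); rewrite subr_eq0 => /(_ _ xz0).
  rewrite -ball_normE /= sub0r normrN normc_normE ltcR => /(_ xz).
  rewrite scaler1 subrK normc_normE ltcR.
  rewrite -[l - _]opprB normcN => Hl.
  have xz1 : x - z != 0 by rewrite subr_eq0.
  have -> : f x - f z - l * (x - z) =
      ((x - z)^-1 *: (f x - f z) - l) * (x - z).
    by rewrite mulrBl -[_ *: _]/(_ * _) mulrAC mulVf // mul1r.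
  by rewrite normcM ler_wpM2r ?normc_ge0 // ltW.
move=> [l H]; apply/cvg_ex; exists l.
apply/(@cvgrPdist_lt C C^o C^o (dnbhs (0 : C^o)) _) => -[e e'].
rewrite ltcE /= => /andP[/eqP -> e0].
have [d d0 Hd] := H _ (divr_gt0 e0 (ltr0n _ 2)).
apply/nbhs_ballP; exists d%:C => /=; first by rewrite ltcR.
move=> h; rewrite -ball_normE /= sub0r normrN normc_normE ltcR => hd h0.
rewrite scaler1 normc_normE ltcR.
have := Hd (h + z); rewrite addrK => /(_ hd).
have -> : l - h^-1 *: (f (h + z) - f z) =
   - ((f (h + z) - f z - l * h) / h).
  rewrite mulrBl mulfK // opprB; congr (_ - _).
  by rewrite -[_ *: _]/(_ * _) mulrC.
rewrite normcN normc_mulVl // => Hle.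
rewrite ltr_pdivrMr ?normc_gt0 //; apply: le_lt_trans Hle _.
by rewrite ltr_pM2r ?normc_gt0 // ltr_pdivrMr // ltr_pMr // ltr1n.
Qed.

Lemma holomorphic_at_continuous f z : holomorphic_at f z ->
  forall e : R, 0 < e -> exists2 d : R, 0 < d &
    forall x, normc (x - z) < d -> normc (f x - f z) < e.
Proof.
move=> /derivable1_diffP/differentiable_continuous Hf.
by apply/cvg_normcP; exact: Hf.
Qed.

Lemma holomorphic_at_eq f g z (d : R) : 0 < d ->
  (forall x, normc (x - z) < d -> f x = g x) ->
  holomorphic_at f z -> holomorphic_at g z.
Proof.
move=> d0 fg /holomorphic_atP[l Hl]; apply/holomorphic_atP; exists l => e e0.
have [d' d'0 Hd'] := Hl _ e0; exists (Num.min d d'); first by rewrite lt_min d0.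
move=> x; rewrite lt_min => /andP[xd xd'].
by rewrite -fg // -fg ?subrr ?normc0 //; exact: Hd'.
Qed.

Lemma holomorphic_cst (c : C) z : holomorphic_at (fun=> c) z.
Proof. exact: derivable_cst. Qed.
Lemma holomorphic_id z : holomorphic_at id z.
Proof. exact: derivable_id. Qed.
Lemma holomorphicD f g z : holomorphic_at f z -> holomorphic_at g z ->
  holomorphic_at (fun x => f x + g x) z.
Proof. exact: derivableD. Qed.
Lemma holomorphicB f g z : holomorphic_at f z -> holomorphic_at g z ->
  holomorphic_at (fun x => f x - g x) z.
Proof. exact: derivableB. Qed.
Lemma holomorphicM f g z : holomorphic_at f z -> holomorphic_at g z ->
  holomorphic_at (fun x => f x * g x) z.
Proof. exact: derivableM. Qed.
Lemma holomorphicV f z : f z != 0 -> holomorphic_at f z ->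
  holomorphic_at (fun x => (f x)^-1) z.
Proof.
move=> fz0 hf; have [l Hl] := (holomorphic_atP _ _).1 hf.
apply/holomorphic_atP; exists (- l / f z ^+ 2) => e e0.
have m0 : 0 < normc (f z) by rewrite normc_gt0.
set m := normc (f z) in m0.
have l1 : 0 < normc l + 1 by rewrite ltr_wpDl ?normc_ge0.
have e1 : 0 < e * m ^+ 2 / 4 by rewrite divr_gt0 // mulr_gt0 // exprn_gt0.
have e2 : 0 < e * m ^+ 3 / (4 * (normc l + 1)).
  by rewrite divr_gt0 // mulr_gt0 // exprn_gt0.
have [d1 d10 H1] := Hl _ e1.
have [d2 d20 H2] := holomorphic_at_continuous hf e2.
have [d3 d30 H3] := holomorphic_at_continuous hf (divr_gt0 m0 (ltr0n R 2)).
exists (Num.min d1 (Num.min d2 d3)); first by rewrite !lt_min d10 d20 d30.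
move=> x; rewrite !lt_min => /and3P[/H1 E1 /H2 E2 /H3 E3].
have fx : m / 2 <= normc (f x).
  have := ler_dist_normc (f z) (f x); rewrite normc_distC => /le_lt_trans/(_ E3).
  by move=> /ltr_normlP[]; rewrite -/m; lra.
have fx0 : 0 < normc (f x) by apply: lt_le_trans fx; rewrite divr_gt0.
have fxz : f x != 0 by rewrite -normc_gt0.
set h := x - z in E1 *; set E := f x - f z - l * h in E1.
have -> : (f x)^-1 - (f z)^-1 - - l / f z ^+ 2 * h =
    (l * h * (f x - f z) - E * f z) / (f x * f z ^+ 2).
  by rewrite /E; field; rewrite fxz fz0.
rewrite normc_mulVl ?mulf_neq0 ?expf_neq0 // !normcM -/m.
rewrite ler_pdivrMr ?mulr_gt0 //; apply: le_trans (le_normcD _ _) _.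
rewrite normcN !normcM -/m.
have h0 := normc_ge0 h; have l0 := normc_ge0 l.
have A1 : normc l * normc h * normc (f x - f z) <=
    normc h * (e * m ^+ 3 / 4).
  have -> : normc h * (e * m ^+ 3 / 4) =
      (normc l + 1) * normc h * (e * m ^+ 3 / (4 * (normc l + 1))).
    by field; rewrite gt_eqF.
  apply: ler_pM; rewrite ?mulr_ge0 ?normc_ge0 //; last exact: ltW.
  by rewrite ler_wpM2r // lerDl.
have A2 : normc E * m <= e * m ^+ 2 / 4 * normc h * m.
  by rewrite ler_wpM2r // ltW.
have A3 : e * normc h * (m / 2 * (m * m)) <= e * normc h * (normc (f x) * (m * m)).
  by rewrite ler_wpM2l ?mulr_ge0 // ?(ltW e0) // ler_wpM2r // mulr_ge0 // ltW.
apply: le_trans (lerD A1 A2) (le_trans _ A3).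
by rewrite le_eqVlt; apply/orP; left; apply/eqP; field.
Qed.

Local Opaque holomorphic_at.

Lemma holomorphic_div f g z : g z != 0 ->
  holomorphic_at f z -> holomorphic_at g z ->
  holomorphic_at (fun x => f x / g x) z.
Proof.
by move=> g0 hf hg; exact: (holomorphicM hf (holomorphicV g0 hg)).
Qed.

Lemma holomorphic_sharp f z :
  holomorphic_at f (conjc z) -> holomorphic_at (sharp f) z.
Proof.
move=> /holomorphic_atP[l Hl]; apply/holomorphic_atP; exists (conjc l) => e e0.
have [d d0 Hd] := Hl _ e0; exists d => // x xz.
have := Hd (conjc x); rewrite -rmorphB normc_conj => /(_ xz).
by rewrite -normc_conj !(rmorphB, rmorphM) /= !conjcK.
Qed.

End Norm.

Local Opaque holomorphic_at.

(** * Integrals of complex functions of a real variable *)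

Section ComplexIntegral.
Variable R : realType.
Local Notation C := R[i].
Local Notation mu := (@lebesgue_measure R).
Implicit Types (D : set R) (F G : R -> C) (a b c d x y : R).

Definition cintegral D F : C :=
  (\int[mu]_(x in D) complex.Re (F x)) +i* (\int[mu]_(x in D) complex.Im (F x)).

Definition cintegrable D F : Prop :=
  mu.-integrable D (EFin \o (fun x => complex.Re (F x))) /\
  mu.-integrable D (EFin \o (fun x => complex.Im (F x))).

Lemma eq_cintegral D F G : (forall x, D x -> F x = G x) ->
  cintegral D F = cintegral D G.
Proof.
move=> FG; rewrite /cintegral; congr (_ +i* _);
  by apply: eq_Rintegral => x /set_mem /FG ->.
Qed.

Lemma eq_cintegrable D F G : measurable D -> (forall x, D x -> F x = G x) ->
  cintegrable D F -> cintegrable D G.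
Proof.
by move=> mD FG [F1 F2]; split; [apply: eq_integrable F1 | apply: eq_integrable F2];
  rewrite // => x /set_mem /FG /= ->.
Qed.

(** The real and imaginary parts of a complex linear combination are real
    combinations of this shape. *)
Lemma integrable_lin D (f g : R -> R) (r s : R) : measurable D ->
  mu.-integrable D (EFin \o f) -> mu.-integrable D (EFin \o g) ->
  mu.-integrable D (EFin \o (fun x => r * f x + s * g x)).
Proof.
move=> mD hf hg.
have -> : EFin \o (fun x => r * f x + s * g x) =
   ((fun x => r%:E * (EFin \o f) x) \+ (fun x => s%:E * (EFin \o g) x))%E.
  by apply/funext => x.
by apply: integrableD => //; apply: integrableZl.
Qed.

Lemma Rintegral_lin D (f g : R -> R) (r s : R) : measurable D ->
  mu.-integrable D (EFin \o f) -> mu.-integrable D (EFin \o g) ->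
  \int[mu]_(x in D) (r * f x + s * g x) =
  r * \int[mu]_(x in D) f x + s * \int[mu]_(x in D) g x.
Proof.
move=> mD hf hg; rewrite RintegralD // ?RintegralZl //.
  by have := integrable_lin r 0 mD hf hg; congr (integrable _ _ (_ \o _));
     apply/funext => x; rewrite mul0r addr0.
by have := integrable_lin 0 s mD hf hg; congr (integrable _ _ (_ \o _));
   apply/funext => x; rewrite mul0r add0r.
Qed.

Lemma ReM (z w : C) : complex.Re (z * w) =
  complex.Re z * complex.Re w + - complex.Im z * complex.Im w.
Proof. by case: z w => a b [c d] /=; rewrite mulNr. Qed.

Lemma ImM (z w : C) : complex.Im (z * w) =
  complex.Re z * complex.Im w + complex.Im z * complex.Re w.
Proof. by case: z w => a b [c d]. Qed.

Lemma cintegrableZ D (c : C) F : measurable D -> cintegrable D F ->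
  cintegrable D (fun x => c * F x).
Proof.
move=> mD [F1 F2]; split.
  have := integrable_lin (complex.Re c) (- complex.Im c) mD F1 F2.
  by congr (integrable _ _ (_ \o _)); apply/funext => x; rewrite ReM.
have := integrable_lin (complex.Re c) (complex.Im c) mD F2 F1.
by congr (integrable _ _ (_ \o _)); apply/funext => x; rewrite ImM.
Qed.

Lemma cintegralZ D (c : C) F : measurable D -> cintegrable D F ->
  cintegral D (fun x => c * F x) = c * cintegral D F.
Proof.
move=> mD [F1 F2]; rewrite /cintegral.
under eq_Rintegral do rewrite ReM.
under [X in _ +i* X]eq_Rintegral do rewrite ImM.
rewrite !Rintegral_lin //; case: c => a b /=.
by rewrite mulNr.
Qed.

Lemma ReD (z w : C) : complex.Re (z + w) = 1 * complex.Re z + 1 * complex.Re w.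
Proof. by case: z w => a b [c d] /=; rewrite !mul1r. Qed.

Lemma ImD (z w : C) : complex.Im (z + w) = 1 * complex.Im z + 1 * complex.Im w.
Proof. by case: z w => a b [c d] /=; rewrite !mul1r. Qed.

Lemma cintegrableD D F G : measurable D -> cintegrable D F -> cintegrable D G ->
  cintegrable D (fun x => F x + G x).
Proof.
move=> mD [F1 F2] [G1 G2]; split.
  have := integrable_lin 1 1 mD F1 G1.
  by congr (integrable _ _ (_ \o _)); apply/funext => x; rewrite ReD.
have := integrable_lin 1 1 mD F2 G2.
by congr (integrable _ _ (_ \o _)); apply/funext => x; rewrite ImD.
Qed.

Lemma cintegralD D F G : measurable D -> cintegrable D F -> cintegrable D G ->
  cintegral D (fun x => F x + G x) = cintegral D F + cintegral D G.
Proof.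
move=> mD [F1 F2] [G1 G2]; rewrite /cintegral.
under eq_Rintegral do rewrite ReD.
under [X in _ +i* X]eq_Rintegral do rewrite ImD.
by rewrite !Rintegral_lin // !mul1r.
Qed.

Lemma cintegrableN D F : measurable D -> cintegrable D F ->
  cintegrable D (fun x => - F x).
Proof.
move=> mD hF; have := cintegrableZ (-1) mD hF.
by apply: eq_cintegrable => // x _; rewrite mulN1r.
Qed.

Lemma cintegralN D F : measurable D -> cintegrable D F ->
  cintegral D (fun x => - F x) = - cintegral D F.
Proof.
move=> mD hF; rewrite -mulN1r -cintegralZ //.
by apply: eq_cintegral => x _; rewrite mulN1r.
Qed.

Lemma cintegrableB D F G : measurable D -> cintegrable D F -> cintegrable D G ->
  cintegrable D (fun x => F x - G x).
Proof. by move=> mD hF hG; apply: cintegrableD => //; apply: cintegrableN. Qed.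

Lemma cintegralB D F G : measurable D -> cintegrable D F -> cintegrable D G ->
  cintegral D (fun x => F x - G x) = cintegral D F - cintegral D G.
Proof.
by move=> mD hF hG; rewrite cintegralD // ?cintegralN //; apply: cintegrableN.
Qed.

Lemma cintegral_conj D F : measurable D -> cintegrable D F ->
  cintegral D (fun x => conjc (F x)) = conjc (cintegral D F).
Proof.
move=> mD [F1 F2]; rewrite /cintegral /=; congr (_ +i* _).
  by apply: eq_Rintegral => x _; case: (F x).
rewrite -mulN1r -RintegralZl //.
by apply: eq_Rintegral => x _; rewrite mulN1r; case: (F x).
Qed.

Lemma integrable_bound D (f g : R -> R) : measurable D ->
  measurable_fun (D : set (measurableTypeR R)) f ->
  mu.-integrable D (EFin \o g) ->
  (forall x, D x -> `|f x| <= g x) -> mu.-integrable D (EFin \o f).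
Proof.
move=> mD mf ig fg; apply: le_integrable ig => //.
  exact/measurable_EFinP.
move=> x Dx /=; rewrite lee_fin; apply: le_trans (fg _ Dx) _.
exact: ler_norm.
Qed.

(** The constant 2, from adding the real and imaginary parts, spares the rotation
    needed for the sharp bound. *)
Lemma cintegral_bound D F (g : R -> R) : measurable D -> cintegrable D F ->
  mu.-integrable D (EFin \o g) -> (forall x, D x -> normc (F x) <= g x) ->
  normc (cintegral D F) <= 2 * \int[mu]_(x in D) g x.
Proof.
move=> mD [F1 F2] ig Fg; apply: le_trans (normc_le_ReIm _) _ => /=.
have H (f : R -> R) : mu.-integrable D (EFin \o f) ->
    (forall x, D x -> `|f x| <= g x) ->
    `|\int[mu]_(x in D) f x| <= \int[mu]_(x in D) g x.
  move=> jf fg; apply: le_trans (le_normr_Rintegral _ jf) _; first exact: mD.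
  apply: le_Rintegral => //.
  by have := integrable_norm jf.
rewrite mulr_natl mulr2n; apply: lerD; apply: H => // x Dx;
  apply: le_trans (Fg _ Dx).
- exact: ler_Re_normc.
- exact: ler_Im_normc.
Qed.

Lemma integrable_cst_itv a b (r : R) :
  mu.-integrable `[a, b] (EFin \o (fun=> r)).
Proof.
apply: continuous_compact_integrable; first exact: segment_compact.
by move=> x; exact: cst_continuous.
Qed.

Lemma Rintegral_cst_itv a b (r : R) : a <= b ->
  \int[mu]_(x in `[a, b]) r = r * (b - a).
Proof.
move=> ab; rewrite Rintegral_cst //= lebesgue_measure_itv /= lte_fin.
by case: ltgtP ab => //= -> _; rewrite subrr.
Qed.

Lemma cintegral_cst a b (c : C) : a <= b ->
  cintegral `[a, b] (fun=> c) = c * (b - a)%:C.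
Proof.
move=> ab; rewrite /cintegral !Rintegral_cst_itv //.
by case: c => u v /=; simpc.
Qed.

Lemma cintegral_bound_itv a b F (M : R) : a <= b ->
  cintegrable `[a, b] F -> (forall x, a <= x <= b -> normc (F x) <= M) ->
  normc (cintegral `[a, b] F) <= 2 * M * (b - a).
Proof.
move=> ab hF FM; rewrite -mulrA -Rintegral_cst_itv //.
apply: cintegral_bound => //.
exact: integrable_cst_itv.
Qed.

Lemma Rintegral_chasles a b c (f : R -> R) : a <= c -> c <= b ->
  mu.-integrable `[a, b] (EFin \o f) ->
  \int[mu]_(x in `[a, b]) f x =
  \int[mu]_(x in `[a, c]) f x + \int[mu]_(x in `[c, b]) f x.
Proof.
move=> ac cb hf; apply/eqP; rewrite addrC -subr_eq; apply/eqP.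
rewrite Rintegral_itvB ?bnd_simp //.
rewrite Rintegral_itv_obnd_cbnd //.
by apply: integrableS hf => //; apply: subset_itv; rewrite bnd_simp.
Qed.

Lemma cintegral_chasles a b c F : a <= c -> c <= b -> cintegrable `[a, b] F ->
  cintegral `[a, b] F = cintegral `[a, c] F + cintegral `[c, b] F.
Proof.
by move=> ac cb [F1 F2]; rewrite /cintegral !(Rintegral_chasles ac cb).
Qed.

Lemma cintegrable_continuous a b F :
  (forall x, a <= x <= b -> forall e : R, 0 < e -> exists2 d : R, 0 < d &
     forall y, `|y - x| < d -> normc (F y - F x) < e) ->
  cintegrable `[a, b] F.
Proof.
move=> H.
suff K (p : C -> R) : (forall z w, p (z - w) = p z - p w) ->
    (forall z, `|p z| <= normc z) ->
    mu.-integrable `[a, b] (EFin \o (fun x => p (F x))).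
  split; apply: K; [by case=> ? ? [? ?]|exact: ler_Re_normc|
                    by case=> ? ? [? ?]|exact: ler_Im_normc].
move=> pB pn; apply: continuous_compact_integrable; first exact: segment_compact.
apply: continuous_in_subspaceT => x; rewrite inE /= in_itv /= => /H Hx.
apply/(@cvgrPdist_lt R R^o R^o) => e e0; have [d d0 Hd] := Hx _ e0.
apply/nbhs_ballP; exists d => //= y; rewrite /ball /= distrC => yd.
by rewrite distrC -pB; apply: le_lt_trans (pn _) (Hd _ yd).
Qed.

End ComplexIntegral.

(** * Contour integrals over rectangles *)

Section RectangleIntegral.
Variable R : realType.
Local Notation C := R[i].
Local Notation mu := (@lebesgue_measure R).
Implicit Types (H : C -> C) (a b c d m x y M : R) (z : C).

Definition ccontinuous_at H z : Prop := forall e : R, 0 < e ->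
  exists2 d : R, 0 < d & forall u, normc (u - z) < d -> normc (H u - H z) < e.

(** Opposite sides are subtracted under the integral sign, which makes the
    integrands of affine functions constant. *)
Definition rectint H a b c d : C :=
  cintegral `[a, b] (fun x => H (x +i* c) - H (x +i* d)) +
  'i%C * cintegral `[c, d] (fun y => H (b +i* y) - H (a +i* y)).

Definition inrect a b c d z : Prop :=
  a <= complex.Re z <= b /\ c <= complex.Im z <= d.

Lemma subc_hline x y c : (y +i* c) - (x +i* c) = (y - x)%:C :> C.
Proof. by apply/eqP; rewrite eq_complex /= subrr !eqxx. Qed.

Lemma subc_vline a x y : (a +i* y) - (a +i* x) = 0 +i* (y - x) :> C.
Proof. by apply/eqP; rewrite eq_complex /= subrr !eqxx. Qed.

Definition rect_boundary a b c d z : Prop := inrect a b c d z /\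
  [\/ complex.Re z = a, complex.Re z = b, complex.Im z = c | complex.Im z = d].

Lemma cintegrable_hedge H a b c :
  (forall x, a <= x <= b -> ccontinuous_at H (x +i* c)) ->
  cintegrable `[a, b] (fun x => H (x +i* c)).
Proof.
move=> cH; apply: cintegrable_continuous => x /cH Hx e /Hx[d d0 Hd].
by exists d => // y yx; apply: Hd; rewrite subc_hline normc_real.
Qed.

Lemma cintegrable_vedge H a c d :
  (forall y, c <= y <= d -> ccontinuous_at H (a +i* y)) ->
  cintegrable `[c, d] (fun y => H (a +i* y)).
Proof.
move=> cH; apply: cintegrable_continuous => x /cH Hx e /Hx[r r0 Hd].
exists r => // y yx; apply: Hd; rewrite subc_vline.
by rewrite /= expr0n add0r sqrtr_sqr.
Qed.

Lemma rectint_splitx H a m b c d : a <= m -> m <= b ->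
  (forall x, a <= x <= b -> ccontinuous_at H (x +i* c)) ->
  (forall x, a <= x <= b -> ccontinuous_at H (x +i* d)) ->
  (forall y, c <= y <= d -> ccontinuous_at H (a +i* y)) ->
  (forall y, c <= y <= d -> ccontinuous_at H (m +i* y)) ->
  (forall y, c <= y <= d -> ccontinuous_at H (b +i* y)) ->
  rectint H a b c d = rectint H a m c d + rectint H m b c d.
Proof.
move=> am mb /cintegrable_hedge Hc /cintegrable_hedge Hd
  /cintegrable_vedge Ha /cintegrable_vedge Hm /cintegrable_vedge Hb.
rewrite /rectint (cintegral_chasles am mb); last exact: cintegrableB.
by rewrite (cintegralB _ Hb Ha) // (cintegralB _ Hb Hm) // (cintegralB _ Hm Ha) //; ring.
Qed.

Lemma rectint_splity H a b c m d : c <= m -> m <= d ->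
  (forall x, a <= x <= b -> ccontinuous_at H (x +i* c)) ->
  (forall x, a <= x <= b -> ccontinuous_at H (x +i* m)) ->
  (forall x, a <= x <= b -> ccontinuous_at H (x +i* d)) ->
  (forall y, c <= y <= d -> ccontinuous_at H (a +i* y)) ->
  (forall y, c <= y <= d -> ccontinuous_at H (b +i* y)) ->
  rectint H a b c d = rectint H a b c m + rectint H a b m d.
Proof.
move=> cm md /cintegrable_hedge Hc /cintegrable_hedge Hm /cintegrable_hedge Hd
  /cintegrable_vedge Ha /cintegrable_vedge Hb.
rewrite /rectint (cintegral_chasles cm md); last exact: cintegrableB.
by rewrite (cintegralB _ Hc Hd) // (cintegralB _ Hc Hm) // (cintegralB _ Hm Hd) //; ring.
Qed.

Definition boundary_continuous H a b c d : Prop :=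
  [/\ (forall x, a <= x <= b -> ccontinuous_at H (x +i* c)),
      (forall x, a <= x <= b -> ccontinuous_at H (x +i* d)),
      (forall y, c <= y <= d -> ccontinuous_at H (a +i* y)) &
      (forall y, c <= y <= d -> ccontinuous_at H (b +i* y))].

Lemma rectintD H G a b c d :
  boundary_continuous H a b c d -> boundary_continuous G a b c d ->
  rectint (fun z => H z + G z) a b c d = rectint H a b c d + rectint G a b c d.
Proof.
move=> [/cintegrable_hedge H1 /cintegrable_hedge H2 /cintegrable_vedge H3
 /cintegrable_vedge H4] [/cintegrable_hedge G1 /cintegrable_hedge G2
 /cintegrable_vedge G3 /cintegrable_vedge G4].
rewrite /rectint !cintegralB ?cintegralD //; try exact: cintegrableD.
by ring.
Qed.

Lemma rectintZ (r : C) H a b c d : boundary_continuous H a b c d ->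
  rectint (fun z => r * H z) a b c d = r * rectint H a b c d.
Proof.
move=> [/cintegrable_hedge H1 /cintegrable_hedge H2 /cintegrable_vedge H3
 /cintegrable_vedge H4].
rewrite /rectint !cintegralB ?cintegralZ //; try exact: cintegrableZ.
by ring.
Qed.

Lemma eq_rectint H G a b c d : 
  (forall x, a <= x <= b -> H (x +i* c) = G (x +i* c)) ->
  (forall x, a <= x <= b -> H (x +i* d) = G (x +i* d)) ->
  (forall y, c <= y <= d -> H (a +i* y) = G (a +i* y)) ->
  (forall y, c <= y <= d -> H (b +i* y) = G (b +i* y)) ->
  rectint H a b c d = rectint G a b c d.
Proof.
move=> H1 H2 H3 H4; rewrite /rectint; congr (_ + _ * _);
  apply: eq_cintegral => x /=; rewrite in_itv /= => Hx.
  by rewrite H1 ?H2.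
by rewrite H3 ?H4.
Qed.

Lemma eq_rectint_boundary H G a b c d : a <= b -> c <= d ->
  (forall z, rect_boundary a b c d z -> H z = G z) ->
  rectint H a b c d = rectint G a b c d.
Proof.
move=> ab cd HG; apply: eq_rectint => x hx; apply: HG;
  (split; first by split; rewrite //= ?lexx ?ab ?cd).
- exact: Or43.
- exact: Or44.
- exact: Or41.
- exact: Or42.
Qed.

Lemma rectint_bound H a b c d M : a <= b -> c <= d ->
  boundary_continuous H a b c d ->
  (forall z, rect_boundary a b c d z -> normc (H z) <= M) ->
  normc (rectint H a b c d) <= 4 * M * (b - a + (d - c)).
Proof.
move=> ab cd [/cintegrable_hedge H1 /cintegrable_hedge H2 /cintegrable_vedge H3
 /cintegrable_vedge H4] HM.
have HM2 z w : rect_boundary a b c d z -> rect_boundary a b c d w ->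
    normc (H z - H w) <= 2 * M.
  move=> /HM Hz /HM Hw; apply: le_trans (le_normcD _ _) _.
  by rewrite normcN mulr_natl mulr2n lerD.
apply: le_trans (le_normcD _ _) _; rewrite normcM.
have -> : normc 'i%C = 1 :> R by rewrite /= expr0n expr1n add0r sqrtr1.
have -> : 4 * M * (b - a + (d - c)) =
  2 * (2 * M) * (b - a) + 1 * (2 * (2 * M) * (d - c)) by ring.
rewrite !mul1r; apply: lerD; apply: cintegral_bound_itv => //.
- exact: cintegrableB.
- move=> x xab; apply: HM2; (split; first by split; rewrite //= ?lexx ?cd).
    exact: Or43.
  exact: Or44.
- exact: cintegrableB.
- move=> y ycd; apply: HM2; (split; first by split; rewrite //= ?lexx ?ab).
    exact: Or42.
  exact: Or41.
Qed.

(** The two pairs of opposite sides contribute opposite multiples of the area. *)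
Lemma rectint_affine (r s : C) a b c d : a <= b -> c <= d ->
  rectint (fun z => r + s * z) a b c d = 0.
Proof.
move=> ab cd; rewrite /rectint.
rewrite (@eq_cintegral _ _ _ (fun=> s * (0 +i* (c - d)))); last first.
  move=> x _; have -> : 0 +i* (c - d) = (x +i* c) - (x +i* d) :> C.
    by rewrite subc_vline.
  by ring.
rewrite (@eq_cintegral _ `[c, d] _ (fun=> s * ((b - a)%:C))); last first.
  move=> y _; have -> : (b - a)%:C = (b +i* y) - (a +i* y) :> C.
    by rewrite subc_hline.
  by ring.
rewrite !cintegral_cst //.
have -> : 0 +i* (c - d) = - ('i%C * (d - c)%:C) :> C.
  by apply/eqP; rewrite eq_complex /= ; apply/andP; split; apply/eqP; ring.
by ring.
Qed.

Lemma holomorphic_boundary_continuous H a b c d : a <= b -> c <= d ->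
  (forall z, rect_boundary a b c d z -> holomorphic_at H z) ->
  boundary_continuous H a b c d.
Proof.
move=> ab cd hH; split => u hu; apply: holomorphic_at_continuous; apply: hH;
  (split; first by split; rewrite //= ?lexx ?ab ?cd).
- exact: Or43.
- exact: Or44.
- exact: Or41.
- exact: Or42.
Qed.

(** The common point is the supremum of the left endpoints. *)
Lemma nested_intervals (a b : nat -> R) :
  (forall n, a n <= a n.+1) -> (forall n, b n.+1 <= b n) ->
  (forall n, a n <= b n) -> exists x, forall n, a n <= x <= b n.
Proof.
move=> ai bi ab.
have a_mon n k : a n <= a (n + k)%N.
  by elim: k => [|k IH]; rewrite ?addn0 // addnS (le_trans IH).
have b_mon n k : b (n + k)%N <= b n.
  by elim: k => [|k IH]; rewrite ?addn0 // addnS (le_trans _ IH).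
have a_b n k : a n <= b k.
  apply: le_trans (a_mon n k) _; apply: le_trans (ab _) _.
  by rewrite addnC; exact: b_mon.
have ub k : ubound (range a) (b k) by move=> _ [n _ <-].
exists (sup (range a)) => n; apply/andP; split.
  by apply: ub_le_sup; [exists (b 0%N) | exists n].
by apply: ge_sup => //; exists (a 0%N); exists 0%N.
Qed.

End RectangleIntegral.

(** * Goursat's theorem *)

Section Goursat.
Variable R : realType.
Local Notation C := R[i].
Implicit Types (H : C -> C) (a b c d m x y M : R) (z : C).

(** One of the two halves carries at least half of the integral. *)
Lemma goursat_halfx H a b c d : a <= b -> c <= d ->
  (forall z, inrect a b c d z -> holomorphic_at H z) ->
  exists a' b', [/\ a <= a', a' <= b', b' <= b, b' - a' = (b - a) / 2 &
    normc (rectint H a b c d) <= 2 * normc (rectint H a' b' c d)].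
Proof.
move=> ab cd hH; set m := (a + b) / 2.
have am : a <= m by rewrite /m; lra.
have mb : m <= b by rewrite /m; lra.
have [h1 h2 h3 h4] := holomorphic_boundary_continuous ab cd (fun z hz => hH z hz.1).
have hm y : c <= y <= d -> ccontinuous_at H (m +i* y).
  move=> hy; apply: holomorphic_at_continuous; apply: hH.
  by split => //=; rewrite am mb.
have E := rectint_splitx am mb h1 h2 h3 hm h4.
have [le|gt] := leP (normc (rectint H a b c d)) (2 * normc (rectint H a m c d)).
  by exists a, m; split => //; rewrite /m; lra.
exists m, b; split => //; first by rewrite /m; lra.
have := le_normcD (rectint H a m c d) (rectint H m b c d).
rewrite -E; move: gt.
by move: (normc _) (normc _) (normc _) => p q r; clear; lra.
Qed.

Lemma goursat_halfy H a b c d : a <= b -> c <= d ->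
  (forall z, inrect a b c d z -> holomorphic_at H z) ->
  exists c' d', [/\ c <= c', c' <= d', d' <= d, d' - c' = (d - c) / 2 &
    normc (rectint H a b c d) <= 2 * normc (rectint H a b c' d')].
Proof.
move=> ab cd hH; set m := (c + d) / 2.
have cm : c <= m by rewrite /m; lra.
have md : m <= d by rewrite /m; lra.
have [h1 h2 h3 h4] := holomorphic_boundary_continuous ab cd (fun z hz => hH z hz.1).
have hm x : a <= x <= b -> ccontinuous_at H (x +i* m).
  move=> hx; apply: holomorphic_at_continuous; apply: hH.
  by split => //=; rewrite cm md.
have E := rectint_splity cm md h1 hm h2 h3 h4.
have [le|gt] := leP (normc (rectint H a b c d)) (2 * normc (rectint H a b c m)).
  by exists c, m; split => //; rewrite /m; lra.
exists m, d; split => //; first by rewrite /m; lra.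
have := le_normcD (rectint H a b c m) (rectint H a b m d).
rewrite -E; move: gt.
by move: (normc _) (normc _) (normc _) => p q r; clear; lra.
Qed.

Lemma inrect_sub a b c d a' b' c' d' z : a <= a' -> b' <= b -> c <= c' -> d' <= d ->
  inrect a' b' c' d' z -> inrect a b c d z.
Proof.
move=> aa bb cc dd [/andP[h1 h2] /andP[h3 h4]]; split; apply/andP; split.
- exact: le_trans h1.
- exact: le_trans bb.
- exact: le_trans h3.
- exact: le_trans dd.
Qed.

(** Bisecting a rectangle repeatedly keeps a quarter of the integral, while the
    affine approximation at the limit point makes it smaller than any multiple
    of the area. *)
Lemma goursat H a b c d : a <= b -> c <= d ->
  (forall z, inrect a b c d z -> holomorphic_at H z) ->
  rectint H a b c d = 0.
Proof.
move=> ab cd hH.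
pose good (q : (R * R) * (R * R)) :=
  [/\ a <= q.1.1, q.1.1 <= q.1.2, q.1.2 <= b &
   [/\ c <= q.2.1, q.2.1 <= q.2.2 & q.2.2 <= d]].
pose Phi (q : (R * R) * (R * R)) := normc (rectint H q.1.1 q.1.2 q.2.1 q.2.2).
pose next (q r : (R * R) * (R * R)) := good r /\
  [/\ q.1.1 <= r.1.1, r.1.2 <= q.1.2, q.2.1 <= r.2.1 & r.2.2 <= q.2.2] /\
  [/\ r.1.2 - r.1.1 = (q.1.2 - q.1.1) / 2,
      r.2.2 - r.2.1 = (q.2.2 - q.2.1) / 2 & Phi q <= 4 * Phi r].
have /choice[step Hstep] : forall q, exists r, good q -> next q r.
  move=> [[a1 b1] [c1 d1]].
  have [[/= aa1 ab1 bb1 [cc1 cd1 dd1]]|ng] := pselect (good ((a1, b1), (c1, d1)));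
    last by exists ((a1, b1), (c1, d1)).
  have h1 z : inrect a1 b1 c1 d1 z -> holomorphic_at H z.
    by move=> hz; apply: hH; apply: inrect_sub hz.
  have [a2 [b2 [a12 ab2 b21 w2 P2]]] := goursat_halfx ab1 cd1 h1.
  have h2 z : inrect a2 b2 c1 d1 z -> holomorphic_at H z.
    by move=> hz; apply: h1; apply: inrect_sub hz.
  have [c2 [d2 [c12 cd2 d21 v2 Q2]]] := goursat_halfy ab2 cd1 h2.
  exists ((a2, b2), (c2, d2)) => _; split; last split => //.
    split => //=; [exact: le_trans a12|exact: le_trans bb1|].
    by split => //; [exact: le_trans c12|exact: le_trans dd1].
  split => //; rewrite /Phi /=; apply: le_trans P2 _.
  by rewrite (_ : 4 = 2 * 2) -?mulrA ?ler_pM2l // -natrM.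
pose Q n := iter n step ((a, b), (c, d)).
have gQ n : good (Q n).
  elim: n => [|n IH]; first by split => //=; split.
  by have [] := Hstep _ IH.
have nQ n : next (Q n) (Q n.+1) := Hstep _ (gQ n).
have [x0 Hx0] : exists x, forall n, (Q n).1.1 <= x <= (Q n).1.2.
  by apply: nested_intervals => n; have [? [[? ? ? ?] _]] := nQ n;
    have [] := gQ n.
have [y0 Hy0] : exists y, forall n, (Q n).2.1 <= y <= (Q n).2.2.
  by apply: nested_intervals => n; have [? [[? ? ? ?] _]] := nQ n;
    have [? ? ? []] := gQ n.
have two0 n : 0 < (2 : R) ^+ n by rewrite exprn_gt0.
have wQ n : (Q n).1.2 - (Q n).1.1 = (b - a) / 2 ^+ n /\
            (Q n).2.2 - (Q n).2.1 = (d - c) / 2 ^+ n.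
  elim: n => [|n [IH1 IH2]]; first by rewrite expr0 !divr1.
  have [_ [_ [-> -> _]]] := nQ n; rewrite IH1 IH2 exprSr.
  by split; rewrite invfM mulrA.
have PQ n : Phi ((a, b), (c, d)) <= 4 ^+ n * Phi (Q n).
  elim: n => [|n IH]; first by rewrite expr0 mul1r.
  have [_ [_ [_ _ H4]]] := nQ n; apply: le_trans IH _.
  by rewrite exprSr -mulrA ler_pM2l // exprn_gt0.
have z0in n : inrect (Q n).1.1 (Q n).1.2 (Q n).2.1 (Q n).2.2 (x0 +i* y0).
  by split => /=.
have hz0 : holomorphic_at H (x0 +i* y0) by apply: hH; exact: (z0in 0%N).
set L := b - a + (d - c).
have L0 : 0 <= L by rewrite /L; move: ab cd; clear; lra.
have [l Hl] := (holomorphic_atP _ _).1 hz0.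
set z0 := x0 +i* y0 in z0in hz0 Hl.
pose E z := H z - H z0 - l * (z - z0).
have key e : 0 < e -> Phi ((a, b), (c, d)) <= e * (4 * L ^+ 2).
  move=> e0; have [r r0 Hr] := Hl _ e0.
  (* Deep enough for the rectangle to lie in the disc of the affine approximation. *)
  pose n := Num.bound (L / r).
  have Ln : L / 2 ^+ n < r.
    rewrite ltr_pdivrMr // mulrC -ltr_pdivrMr //.
    exact: upper_nthrootP.
  have [aq abq bq [cq cdq dq]] := gQ n.
  have [wx wy] := wQ n.
  have near z : inrect (Q n).1.1 (Q n).1.2 (Q n).2.1 (Q n).2.2 z ->
      normc (z - z0) <= L / 2 ^+ n.
    move=> [/andP[h1 h2] /andP[h3 h4]]; have /andP[k1 k2] := Hx0 n.
    have /andP[k3 k4] := Hy0 n.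
    apply: le_trans (normc_le_ReIm _) _; rewrite /L mulrDl -wx -wy.
    case: z h1 h2 h3 h4 => x y /= h1 h2 h3 h4.
    apply: lerD; rewrite ler_norml; move: h1 h2 h3 h4 k1 k2 k3 k4 => /=;
      clear; lra.
  have hq z : inrect (Q n).1.1 (Q n).1.2 (Q n).2.1 (Q n).2.2 z ->
      holomorphic_at H z.
    by move=> hz; apply: hH; apply: inrect_sub hz.
  have haff z : holomorphic_at (fun u => (H z0 - l * z0) + l * u) z.
    apply: holomorphicD; first exact: holomorphic_cst.
    by apply: holomorphicM; [exact: holomorphic_cst|exact: holomorphic_id].
  have hE z : inrect (Q n).1.1 (Q n).1.2 (Q n).2.1 (Q n).2.2 z ->
      holomorphic_at E z.
    move=> hz; have := holomorphicB (hq _ hz) (haff z).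
    apply: (@holomorphic_at_eq _ _ _ _ 1) => // u _.
    by rewrite /E; ring.
  have EQ : rectint H (Q n).1.1 (Q n).1.2 (Q n).2.1 (Q n).2.2 =
            rectint E (Q n).1.1 (Q n).1.2 (Q n).2.1 (Q n).2.2.
    rewrite -[RHS]addr0 -(@rectint_affine _ (H z0 - l * z0) l _ _ _ _ abq cdq).
    rewrite -rectintD; first by apply: eq_rectint => u _; rewrite /E; ring.
      exact: (holomorphic_boundary_continuous abq cdq (fun z hz => hE z hz.1)).
    exact: (holomorphic_boundary_continuous abq cdq (fun z _ => haff z)).
  have bE : normc (rectint E (Q n).1.1 (Q n).1.2 (Q n).2.1 (Q n).2.2) <=
      4 * (e * (L / 2 ^+ n)) * (L / 2 ^+ n).
    rewrite [X in _ * X](_ : _ = (Q n).1.2 - (Q n).1.1 + ((Q n).2.2 - (Q n).2.1));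
      last by rewrite wx wy /L mulrDl.
    apply: rectint_bound => //; first
      exact: (holomorphic_boundary_continuous abq cdq (fun z hz => hE z hz.1)).
    move=> z [/near nz _]; apply: le_trans (Hr _ (le_lt_trans nz Ln)) _.
    by rewrite ler_pM2l.
  apply: le_trans (PQ n) _; rewrite /Phi EQ.
  have -> : e * (4 * L ^+ 2) = 4 ^+ n * (4 * (e * (L / 2 ^+ n)) * (L / 2 ^+ n)).
    have -> : (4 : R) ^+ n = 2 ^+ n * 2 ^+ n by rewrite -exprMn -natrM.
    by field; rewrite gt_eqF.
  by rewrite ler_pM2l // exprn_gt0.
have : Phi ((a, b), (c, d)) <= 0.
  have L1 : 0 < 4 * L ^+ 2 + 1 by rewrite ltr_wpDl // mulr_ge0 // sqr_ge0.
  apply/ler_addgt0Pr => e e0; rewrite add0r.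
  apply: le_trans (key _ (divr_gt0 e0 L1)) _.
  rewrite mulrAC ler_pdivrMr // ler_pM2l // lerDl ler01 //.
rewrite /Phi /= => Phi0; apply: eq0_normc; apply/eqP.
by rewrite eq_le Phi0 normc_ge0.
Qed.

End Goursat.

(** * Cauchy's formula and removable zeros *)

Section CauchyFormula.
Variable R : realType.
Local Notation C := R[i].
Local Notation mu := (@lebesgue_measure R).
Implicit Types (H : C -> C) (a b c d m x y M : R) (z : C).

(** The four rectangles surrounding the inner one contribute nothing, by Goursat's
    theorem. *)
Lemma rectint_annulus H a x1 x2 b c y1 y2 d :
  a <= x1 -> x1 <= x2 -> x2 <= b -> c <= y1 -> y1 <= y2 -> y2 <= d ->
  (forall z, inrect a b c d z ->
    [\/ complex.Re z <= x1, x2 <= complex.Re z,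
        complex.Im z <= y1 | y2 <= complex.Im z] -> holomorphic_at H z) ->
  rectint H a b c d = rectint H x1 x2 y1 y2.
Proof.
move=> ax1 x12 x2b cy1 y12 y2d hH.
have cH z : inrect a b c d z ->
    [\/ complex.Re z <= x1, x2 <= complex.Re z,
        complex.Im z <= y1 | y2 <= complex.Im z] -> ccontinuous_at H z.
  by move=> h1 h2; apply: holomorphic_at_continuous; apply: hH.
have [x1b ax2 y1d cy2] : [/\ x1 <= b, a <= x2, y1 <= d & c <= y2].
  by split; [exact: le_trans x2b|exact: le_trans x12|
             exact: le_trans y2d|exact: le_trans y12].
have cd : c <= d by exact: le_trans y2d.
have hc x : a <= x <= b -> ccontinuous_at H (x +i* c).
  by move=> hx; apply: cH; [split; rewrite /= ?lexx|apply: Or43].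
have hd x : a <= x <= b -> ccontinuous_at H (x +i* d).
  by move=> hx; apply: cH; [split; rewrite /= ?lexx ?andbT|apply: Or44].
have va x y : a <= x <= x1 -> c <= y <= d -> ccontinuous_at H (x +i* y).
  move=> /andP[h1 h2] hy; apply: cH; last exact: Or41.
  by split => //=; rewrite h1 (le_trans h2).
have vb x y : x2 <= x <= b -> c <= y <= d -> ccontinuous_at H (x +i* y).
  move=> /andP[h1 h2] hy; apply: cH; last exact: Or42.
  by split => //=; rewrite h2 (le_trans _ h1).
have sub l r x : a <= l -> r <= b -> l <= x <= r -> a <= x <= b.
  by move=> al rb /andP[h1 h2]; rewrite (le_trans al) ?(le_trans h2).
have hy1 x : x1 <= x <= x2 -> ccontinuous_at H (x +i* y1).
  move=> /(sub _ _ _ ax1 x2b) hx; apply: cH; last exact: Or43.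
  by split => //=; rewrite cy1.
have hy2 x : x1 <= x <= x2 -> ccontinuous_at H (x +i* y2).
  move=> /(sub _ _ _ ax1 x2b) hx; apply: cH; last exact: Or44.
  by split => //=; rewrite y2d andbT.
have suby l r y : c <= l -> r <= d -> l <= y <= r -> c <= y <= d.
  by move=> al rb /andP[h1 h2]; rewrite (le_trans al) ?(le_trans h2).
have va1 y : c <= y <= d -> ccontinuous_at H (x1 +i* y).
  by apply: va; rewrite ax1 lexx.
have vb2 y : c <= y <= d -> ccontinuous_at H (x2 +i* y).
  by apply: vb; rewrite x2b lexx.
rewrite (@rectint_splitx _ H a x1 b) //; first last.
- by move=> y; apply: vb; rewrite x2b lexx.
- by move=> y; apply: va; rewrite ax1 lexx.
rewrite (@rectint_splitx _ H x1 x2 b) //; first last.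
- by move=> y; apply: vb; rewrite x2b lexx.
- by move=> x /(sub _ _ _ ax1 (lexx b)); exact: hd.
- by move=> x /(sub _ _ _ ax1 (lexx b)); exact: hc.
rewrite (@rectint_splity _ H x1 x2 c y1 d) //; first last.
- by move=> x /(sub _ _ _ ax1 x2b); exact: hd.
- by move=> x /(sub _ _ _ ax1 x2b); exact: hc.
rewrite (@rectint_splity _ H x1 x2 y1 y2 d) //; first last.
- by move=> y /(suby _ _ _ cy1 (lexx d)); exact: vb2.
- by move=> y /(suby _ _ _ cy1 (lexx d)); exact: va1.
- by move=> x /(sub _ _ _ ax1 x2b); exact: hd.
have g1 : rectint H a x1 c d = 0.
  apply: goursat => // z [/andP[h1 h2] h3]; apply: hH; last exact: Or41.
  by split => //; rewrite h1 (le_trans h2).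
have g2 : rectint H x2 b c d = 0.
  apply: goursat => // z [/andP[h1 h2] h3]; apply: hH; last exact: Or42.
  by split => //; rewrite h2 (le_trans _ h1).
have g3 : rectint H x1 x2 c y1 = 0.
  apply: goursat => // z [h3 /andP[h1 h2]]; apply: hH; last exact: Or43.
  by split; [exact: sub h3|rewrite h1 (le_trans h2)].
have g4 : rectint H x1 x2 y2 d = 0.
  apply: goursat => // z [h3 /andP[h1 h2]]; apply: hH; last exact: Or44.
  by split; [exact: sub h3|rewrite h2 (le_trans _ h1)].
by rewrite g1 g2 g3 g4 !add0r !addr0.
Qed.

Definition square H (u : C) (s : R) : C :=
  rectint H (complex.Re u - s) (complex.Re u + s)
            (complex.Im u - s) (complex.Im u + s).

Lemma square_boundary_dist (u : C) (s : R) z : 0 <= s ->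
  rect_boundary (complex.Re u - s) (complex.Re u + s)
                (complex.Im u - s) (complex.Im u + s) z ->
  s <= normc (z - u) <= 2 * s.
Proof.
move=> s0 [[/andP[h1 h2] /andP[h3 h4]] h].
apply/andP; split; last first.
  apply: le_trans (normc_le_ReIm _) _; rewrite ReB ImB.
  have k1 : `|complex.Re z - complex.Re u| <= s.
    by rewrite ler_norml; move: h1 h2; clear; lra.
  have k2 : `|complex.Im z - complex.Im u| <= s.
    by rewrite ler_norml; move: h3 h4; clear; lra.
  by rewrite mulr_natl mulr2n lerD.
have kx := ler_Re_normc (z - u); have ky := ler_Im_normc (z - u).
move: kx ky; rewrite ReB ImB; case: h => -> kx ky.
- by apply: le_trans kx; rewrite addrC addKr normrN ger0_norm.
- by apply: le_trans kx; rewrite addrC addKr ger0_norm.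
- by apply: le_trans ky; rewrite addrC addKr normrN ger0_norm.
- by apply: le_trans ky; rewrite addrC addKr ger0_norm.
Qed.

Lemma rectint_shrink H (u : C) (s : R) a b c d : 0 < s ->
  a <= complex.Re u - s -> complex.Re u + s <= b ->
  c <= complex.Im u - s -> complex.Im u + s <= d ->
  (forall z, inrect a b c d z -> z <> u -> holomorphic_at H z) ->
  rectint H a b c d = square H u s.
Proof.
move=> s0 h1 h2 h3 h4 hH; apply: rectint_annulus => //.
- by move: s0; clear; lra.
- by move: s0; clear; lra.
move=> z hz hor; apply: hH => // zu; move: hor; rewrite zu.
by case; move: s0; clear; lra.
Qed.

Lemma square_boundary_continuous H (u : C) (s : R) : 0 <= s ->
  (forall z, rect_boundary (complex.Re u - s) (complex.Re u + s)
     (complex.Im u - s) (complex.Im u + s) z -> holomorphic_at H z) ->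
  boundary_continuous H (complex.Re u - s) (complex.Re u + s)
            (complex.Im u - s) (complex.Im u + s).
Proof.
by move=> s0; apply: holomorphic_boundary_continuous; move: s0; clear; lra.
Qed.

Lemma eq_square H G (u : C) (s : R) : 0 <= s ->
  (forall z, rect_boundary (complex.Re u - s) (complex.Re u + s)
     (complex.Im u - s) (complex.Im u + s) z -> H z = G z) ->
  square H u s = square G u s.
Proof.
by move=> s0; apply: eq_rectint_boundary; move: s0; clear; lra.
Qed.

Lemma square_bound H (u : C) (s M : R) : 0 <= s ->
  (forall z, rect_boundary (complex.Re u - s) (complex.Re u + s)
     (complex.Im u - s) (complex.Im u + s) z -> holomorphic_at H z) ->
  (forall z, rect_boundary (complex.Re u - s) (complex.Re u + s)
     (complex.Im u - s) (complex.Im u + s) z -> normc (H z) <= M) ->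
  normc (square H u s) <= 16 * s * M.
Proof.
move=> s0 hH hM.
have -> : 16 * s * M = 4 * M * (complex.Re u + s - (complex.Re u - s) +
                      (complex.Im u + s - (complex.Im u - s))) by ring.
apply: rectint_bound => //; try by move: s0; clear; lra.
exact: square_boundary_continuous.
Qed.

(** A bounded isolated singularity is invisible to the contour integral, since
    the contour can be shrunk to it. *)
Lemma goursat_bounded_singularity H (u : C) (M r : R) a b c d :
  a < complex.Re u < b -> c < complex.Im u < d -> 0 < r ->
  (forall z, inrect a b c d z -> z <> u -> holomorphic_at H z) ->
  (forall z, normc (z - u) < r -> normc (H z) <= M) ->
  rectint H a b c d = 0.
Proof.
move=> /andP[au ub] /andP[cu ud] r0 hH hM.
pose s0 := Num.min (Num.min (complex.Re u - a) (b - complex.Re u))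
  (Num.min (Num.min (complex.Im u - c) (d - complex.Im u)) (r / 3)).
have s00 : 0 < s0 by rewrite !lt_min !subr_gt0 au ub cu ud divr_gt0.
have [S1 S2 S3 [S4 S5]] : [/\ s0 <= complex.Re u - a, s0 <= b - complex.Re u,
    s0 <= complex.Im u - c & s0 <= d - complex.Im u /\ s0 <= r / 3].
  by do ?split; rewrite !ge_min lexx ?orbT.
have M0 : 0 <= M.
  by apply: le_trans (normc_ge0 (H u)) (hM _ _); rewrite subrr normc0.
have key s : 0 < s -> s <= s0 -> normc (rectint H a b c d) <= 16 * s * M.
  move=> s1 ss.
  have s2 := ltW s1.
  rewrite (@rectint_shrink H u s) //; try
    by move: ss S1 S2 S3 S4; clear; lra.
  have bd z : rect_boundary (complex.Re u - s) (complex.Re u + s)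
     (complex.Im u - s) (complex.Im u + s) z ->
     [/\ inrect a b c d z, z <> u & normc (z - u) < r].
    move=> hz; have /andP[d1 d2] := square_boundary_dist s2 hz; split.
    - case: hz => hz _; apply: inrect_sub hz;
        by move: ss S1 S2 S3 S4; clear; lra.
    - by move=> zu; move: d1; rewrite zu subrr normc0 leNgt s1.
    - by apply: le_lt_trans d2 _; move: ss S5 r0; clear; lra.
  by apply: square_bound => // z /bd[h1 h2 h3]; [exact: hH|exact: hM].
apply: eq0_normc; apply/eqP; rewrite eq_le normc_ge0 andbT.
apply/ler_addgt0Pr => e e0; rewrite add0r.
have M1 : 0 < 16 * M + 1 by move: M0; clear; lra.
pose s := Num.min s0 (e / (16 * M + 1)).
have s1 : 0 < s by rewrite lt_min s00 divr_gt0.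
apply: le_trans (key s s1 _) _; first by rewrite ge_min lexx.
have : s <= e / (16 * M + 1) by rewrite ge_min lexx orbT.
by rewrite ler_pdivlMr // => h; move: h s1; rewrite -mulrA; clear; lra.
Qed.

End CauchyFormula.

Section InverseOnSquare.
Variable R : realType.
Local Notation C := R[i].
Local Notation mu := (@lebesgue_measure R).
Implicit Types (H : C -> C) (a b c d m x y M : R) (z : C).

Lemma Rintegral_FTC (f F : R -> R) a b : a < b ->
  (forall x, {for x, continuous f}) -> (forall x, is_derive x 1 F (f x)) ->
  \int[mu]_(x in `[a, b]) f x = F b - F a.
Proof.
move=> ab cf dF; rewrite /Rintegral (@continuous_FTC2 _ f F) //.
- by apply: continuous_subspaceT => x; exact: cf.
- have cF x : {for x, continuous F}.
    by apply: differentiable_continuous; apply/derivable1_diffP.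
  split; first by move=> x _; have [] := dF x.
    by apply: cvg_at_right_filter; exact: cF.
  by apply: cvg_at_left_filter; exact: cF.
- by move=> x _; rewrite derive1E; have [] := dF x.
Qed.

Lemma is_derive_poisson (p s x : R) : 0 < s ->
  is_derive x 1 (fun t => atan ((t - p) / s)) (s / ((x - p) ^+ 2 + s ^+ 2)).
Proof.
move=> s0.
have h : is_derive x 1 (s^-1 \*: (id - cst p) : R -> R) (s^-1 *: (1 - 0)).
  by apply: is_deriveZ; apply: is_deriveB.
have := is_derive1_comp (is_derive1_atan ((s^-1 \*: (id - cst p) : R -> R) x)) h.
have -> : atan \o (s^-1 \*: (id - cst p)) = (fun t => atan ((t - p) / s)).
  by apply/funext => t /=; rewrite mulrC.
rewrite /= => k; apply: is_derive_eq k _.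
transitivity ((1 + (s^-1 * (x - p)) ^+ 2)^-1 * (s^-1 * (1 - 0))); first by [].
field; rewrite (gt_eqF s0) andbT.
by apply: lt0r_neq0; rewrite ltr_wpDl ?sqr_ge0 // exprn_gt0.
Qed.

Lemma continuous_poisson (p s x : R) : 0 < s ->
  {for x, continuous (fun t => s / ((t - p) ^+ 2 + s ^+ 2))}.
Proof.
move=> s0; apply: cvgM; first exact: cvg_cst.
apply: cvgV; first by apply: lt0r_neq0; rewrite ltr_wpDl ?sqr_ge0 // exprn_gt0.
apply: cvgD; last exact: cvg_cst.
apply: cvgM; apply: cvgB; try exact: cvg_id; exact: cvg_cst.
Qed.

Lemma Rintegral_poisson (p s a b : R) : 0 < s -> a < b ->
  \int[mu]_(x in `[a, b]) (s / ((x - p) ^+ 2 + s ^+ 2)) =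
  atan ((b - p) / s) - atan ((a - p) / s).
Proof.
move=> s0 ab.
apply: (@Rintegral_FTC _ (fun t => atan ((t - p) / s)) _ _ ab) => x.
  exact: continuous_poisson.
exact: is_derive_poisson.
Qed.

Lemma Rintegral_poisson_sym (p s : R) : 0 < s ->
  \int[mu]_(x in `[p - s, p + s]) (s / ((x - p) ^+ 2 + s ^+ 2)) = pi / 2.
Proof.
move=> s0; rewrite Rintegral_poisson //; last by move: s0; clear; lra.
rewrite [p + s]addrC addrK addrAC subrr add0r mulNr divff ?gt_eqF //.
by rewrite atanN opprK atan1; field.
Qed.

Lemma invc_diff (x s : R) : 0 < s ->
  (x +i* (- s))^-1 - (x +i* s)^-1 = 2 * 'i%C * (s / (x ^+ 2 + s ^+ 2))%:C :> C.
Proof.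
move=> s0.
have d0 : x ^+ 2 + s ^+ 2 != 0.
  by apply: lt0r_neq0; rewrite ltr_wpDl ?sqr_ge0 // exprn_gt0.
have AB : (x +i* (- s)) * (x +i* s) = (x ^+ 2 + s ^+ 2)%:C :> C.
  by apply/eqP; rewrite eq_complex /=; apply/andP; split; apply/eqP; ring.
have nz (t : R) : t != 0 -> x +i* t != 0 :> C.
  by move=> t0; rewrite eq_complex /= negb_and t0 orbT.
have A0 : x +i* (- s) != 0 :> C by rewrite nz // oppr_eq0 gt_eqF.
have B0 : x +i* s != 0 :> C by rewrite nz // gt_eqF.
have -> : (x +i* (- s))^-1 - (x +i* s)^-1 =
    ((x +i* s) - (x +i* (- s))) / ((x +i* (- s)) * (x +i* s)) :> C.
  by field; rewrite A0 B0.
rewrite AB rmorphM fmorphV /= mulrA; congr (_ / _).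
by apply/eqP; rewrite eq_complex /=; apply/andP; split; apply/eqP; ring.
Qed.

Lemma cintegral_realZ (D : set R) (c : C) (f : R -> R) : measurable D ->
  mu.-integrable D (EFin \o f) ->
  cintegral D (fun x => c * (f x)%:C) = c * (\int[mu]_(x in D) f x)%:C.
Proof.
move=> mD hf; rewrite cintegralZ //; last first.
  split => //=; have := integrable_lin 0 0 mD hf hf.
  by congr (integrable _ _ (_ \o _)); apply/funext => x; rewrite !mul0r addr0.
congr (_ * _); rewrite /cintegral /=; congr (_ +i* _).
by rewrite /Rintegral integral0.
Qed.

Lemma integrable_poisson_itv (p s a b : R) : 0 < s ->
  mu.-integrable `[a, b] (EFin \o (fun x => s / ((x - p) ^+ 2 + s ^+ 2))).
Proof.
move=> s0; apply: continuous_compact_integrable; first exact: segment_compact.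
by apply: continuous_subspaceT => x; exact: continuous_poisson.
Qed.

(** Opposite sides combine into Poisson kernels, whose primitives are
    arctangents. *)
Lemma square_inv (u : C) (s : R) : 0 < s ->
  square (fun z => (z - u)^-1) u s = 2 * 'i%C * (pi : R)%:C.
Proof.
move=> s0; case: u => p q; rewrite /square /rectint.
rewrite [cintegral `[complex.Re _ - _, _] _](@eq_cintegral _ _ _
  (fun x => 2 * 'i%C * (s / ((x - p) ^+ 2 + s ^+ 2))%:C)); last first.
  move=> x _; rewrite -invc_diff //; congr (_^-1 - _^-1);
    by apply/eqP; rewrite eq_complex /= eqxx; apply/eqP; ring.
rewrite [cintegral `[complex.Im _ - _, _] _](@eq_cintegral _ _ _
  (fun x => 2 * (s / ((x - q) ^+ 2 + s ^+ 2))%:C)); last first.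
  move=> y _; have i0 : 'i%C != 0 :> C by rewrite eq_complex /= oner_eq0 andbF.
  have rot (t r : R) : 'i%C * (r +i* t)^-1 = (t +i* (- r))^-1 :> C.
    rewrite (_ : r +i* t = 'i%C * (t +i* (- r))) ?invfM ?mulVKf //.
    by apply/eqP; rewrite eq_complex /=; apply/andP; split; apply/eqP; ring.
  apply: (mulfI i0); rewrite mulrCA mulrA -invc_diff // mulrBr.
  have -> : ((complex.Re (p +i* q) + s) +i* y) - (p +i* q) = s +i* (y - q) :> C.
    by apply/eqP; rewrite eq_complex /= eqxx andbT; apply/eqP; ring.
  have -> : ((complex.Re (p +i* q) - s) +i* y) - (p +i* q) = (- s) +i* (y - q) :> C.
    by apply/eqP; rewrite eq_complex /= eqxx andbT; apply/eqP; ring.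
  by rewrite !rot opprK.
rewrite !cintegral_realZ ?integrable_poisson_itv //=.
rewrite !Rintegral_poisson_sym // rmorphM fmorphV /= (natrM _ 1 2) //.
by field.
Qed.

End InverseOnSquare.

Section Removable.
Variable R : realType.
Local Notation C := R[i].
Implicit Types (h F G : C -> C) (a b c d s : R) (u z : C).

Lemma holomorphic_subc u z : holomorphic_at (fun x => x - u) z.
Proof. by apply: holomorphicB; [exact: holomorphic_id|exact: holomorphic_cst]. Qed.

Lemma holomorphic_inv_subc u z : z <> u -> holomorphic_at (fun x => (x - u)^-1) z.
Proof.
move=> /eqP zu; apply: holomorphicV; first by rewrite subr_eq0.
exact: holomorphic_subc.
Qed.

Lemma holomorphic_div_subc h u z : z <> u -> holomorphic_at h z ->
  holomorphic_at (fun x => h x / (x - u)) z.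
Proof. by move=> zu hh; exact: (holomorphicM hh (holomorphic_inv_subc zu)). Qed.

Lemma rect_boundary_neq u z a b c d :
  a < complex.Re u < b -> c < complex.Im u < d ->
  rect_boundary a b c d z -> z <> u.
Proof.
move=> /andP[h1 h2] /andP[h3 h4] [_ h] e; move: h; rewrite e.
by case=> k; move: h1 h2 h3 h4; rewrite k ltxx.
Qed.

Lemma pi_complex_neq0 : 2 * 'i%C * (pi : R)%:C != 0 :> C.
Proof.
rewrite !mulf_neq0 ?pnatr_eq0 //; first by rewrite eq_complex /= oner_eq0 andbF.
by rewrite eq_complex /= gt_eqF ?pi_gt0.
Qed.

(** In [h z = (h z - h u) + h u] the first summand leaves a bounded singularity,
    the second a multiple of the integral of [1 / (z - u)]. *)
Lemma cauchy_formula h u a b c d :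
  a < complex.Re u < b -> c < complex.Im u < d ->
  (forall z, inrect a b c d z -> holomorphic_at h z) ->
  rectint (fun z => h z / (z - u)) a b c d = 2 * 'i%C * (pi : R)%:C * h u.
Proof.
move=> hu1 hu2 hh; have /andP[au ub] := hu1; have /andP[cu ud] := hu2.
have ab : a <= b by apply: ltW; exact: lt_trans ub.
have cd : c <= d by apply: ltW; exact: lt_trans ud.
have ne z := @rect_boundary_neq u z a b c d hu1 hu2.
have H2 z : z <> u -> holomorphic_at (fun z => h u * (z - u)^-1) z.
  move=> zu; apply: holomorphicM; first exact: holomorphic_cst.
  exact: holomorphic_inv_subc.
have H1 z : inrect a b c d z -> z <> u ->
    holomorphic_at (fun z => (h z - h u) / (z - u)) z.
  move=> hz zu; apply: (@holomorphic_div_subc (fun z => h z - h u)) => //.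
  by apply: holomorphicB; [exact: hh|exact: holomorphic_cst].
have -> : rectint (fun z => h z / (z - u)) a b c d =
  rectint (fun z => (h z - h u) / (z - u) + h u * (z - u)^-1) a b c d.
  by apply: eq_rectint => v _; rewrite mulrBl subrK.
rewrite rectintD; first last.
- by apply: holomorphic_boundary_continuous => // z hz; apply: H2; exact: ne hz.
- apply: holomorphic_boundary_continuous => // z hz.
  by apply: H1; [case: hz|exact: ne hz].
have -> : rectint (fun z => (h z - h u) / (z - u)) a b c d = 0.
  have uin : inrect a b c d u by split; rewrite !ltW.
  have [l Hl] := (holomorphic_atP _ _).1 (hh _ uin).
  have [r r0 Hr] := Hl 1 ltr01.
  apply: (@goursat_bounded_singularity _ _ u (normc l + 1) r) => // z /Hr hz.
  have [->|zu] := eqVneq z u.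
    by rewrite !subrr mul0r normc0 addr_ge0 ?normc_ge0.
  have zu0 : z - u != 0 by rewrite subr_eq0.
  rewrite normc_mulVl // ler_pdivrMr ?normc_gt0 //.
  have -> : h z - h u = (h z - h u - l * (z - u)) + l * (z - u) by rewrite subrK.
  apply: le_trans (le_normcD _ _) _.
  by rewrite mulrDl addrC normcM lerD2l.
rewrite add0r rectintZ; last first.
  apply: holomorphic_boundary_continuous => // z hz.
  by apply: holomorphic_inv_subc; exact: ne hz.
rewrite mulrC; congr (_ * _).
pose s := Num.min (Num.min (complex.Re u - a) (b - complex.Re u))
  (Num.min (complex.Im u - c) (d - complex.Im u)).
have s0 : 0 < s by rewrite !lt_min !subr_gt0 au ub cu ud.
have [S1 S2 S3 S4] : [/\ s <= complex.Re u - a, s <= b - complex.Re u,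
    s <= complex.Im u - c & s <= d - complex.Im u].
  by split; rewrite !ge_min lexx ?orbT.
rewrite -(square_inv u s0).
have Hinv z : inrect a b c d z -> z <> u -> holomorphic_at (fun x => (x - u)^-1) z.
  by move=> _ zu; exact: holomorphic_inv_subc.
apply: (rectint_shrink s0 _ _ _ _ Hinv);
  by move: S1 S2 S3 S4; clear; lra.
Qed.

(** Near a zero [u] of [F], Cauchy's formula writes [F z / (z - u)] as a
    contour integral that depends differentiably on [z], also at [u]. *)
Lemma removable_zero F u : entire F -> F u = 0 ->
  exists2 G, entire G & forall z, (z - u) * G z = F z.
Proof.
move=> eF Fu.
have [r r0 Hr] := holomorphic_at_continuous (eF u) (@ltr01 R).
pose s := r / 3.
have s0 : 0 < s by rewrite divr_gt0.
have s0' := ltW s0.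
pose k : C := 2 * 'i%C * (pi : R)%:C.
have k0 : k != 0 := pi_complex_neq0.
pose K v z := F z / (z - u) / (z - v).
pose G z := if z == u then k^-1 * square (K u) u s else F z / (z - u).
exists G; last first.
  move=> z; rewrite /G; case: eqVneq => [->|zu]; first by rewrite subrr mul0r.
  by rewrite mulrC divfK // subr_eq0.
move=> z; have [->|/eqP zu] := eqVneq z u; last first.
  apply: (@holomorphic_at_eq _ (fun z => F z / (z - u)) _ _ (normc (z - u)) _ _
     (holomorphic_div_subc zu (eF z))).
    by rewrite normc_gt0 subr_eq0; apply/eqP.
  move=> x xz; rewrite /G; case: eqP => // xu; move: xz.
  by rewrite xu normc_distC ltxx.
(* The radius makes F bounded by 1 on the contour, since F vanishes at u. *)
pose bd := rect_boundary (complex.Re u - s) (complex.Re u + s)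
                (complex.Im u - s) (complex.Im u + s).
have bdP z' : bd z' -> [/\ s <= normc (z' - u), normc (F z') <= 1 & z' <> u].
  move=> /(square_boundary_dist s0') /andP[h1 h2]; split => //.
    apply: ltW; rewrite -[F z']subr0 -Fu; apply: Hr.
    by apply: le_lt_trans h2 _; rewrite /s; move: r0; clear; lra.
  by move=> e; move: h1; rewrite e subrr normc0 leNgt s0.
have bdv v z' : normc (v - u) < s / 2 -> bd z' -> s / 2 <= normc (z' - v) /\ z' <> v.
  move=> vu /bdP[h1 _ _]; have h : s / 2 <= normc (z' - v).
    have := le_normcD (z' - v) (v - u).
    rewrite addrA subrK => h2; move: (le_trans h1 h2) vu; clear; lra.
  by split => // e; move: h; rewrite e subrr normc0 leNgt divr_gt0.
(* Off u, the quotient is a combination of two Cauchy integrals, the one at u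
   being zero. *)
have repr v : normc (v - u) < s / 2 -> G v = k^-1 * square (K v) u s.
  move=> vu; rewrite /G; case: eqVneq => [->//|vu0].
  have [vin1 vin2] : (complex.Re u - s < complex.Re v < complex.Re u + s) /\
      (complex.Im u - s < complex.Im v < complex.Im u + s).
    have h1 := le_lt_trans (ler_Re_normc _) vu.
    have h2 := le_lt_trans (ler_Im_normc _) vu.
    move: h1 h2; case: (u) (v) => p q [x y] /=.
    by move=> /ltr_normlP[h1 h2] /ltr_normlP[h3 h4]; move: s0 h1 h2 h3 h4; clear; lra.
  have [uin1 uin2] : (complex.Re u - s < complex.Re u < complex.Re u + s) /\
      (complex.Im u - s < complex.Im u < complex.Im u + s).
    by move: s0; clear; lra.
  have F1 := cauchy_formula vin1 vin2 (fun z _ => eF z).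
  have F2 := cauchy_formula uin1 uin2 (fun z _ => eF z).
  have vu1 : v - u != 0 by rewrite subr_eq0.
  apply: (mulfI k0); rewrite mulVKf // mulrA -F1.
  rewrite [LHS]mulrC -[LHS]subr0 -(mulr0 (v - u)^-1) -(mulr0 k) -Fu -F2.
  have b1 z' : bd z' -> holomorphic_at (fun z => F z / (z - v)) z'.
    by move=> hz; apply: holomorphic_div_subc => //; case: (bdv _ _ vu hz).
  have b2 z' : bd z' -> holomorphic_at (fun z => F z / (z - u)) z'.
    by move=> hz; apply: holomorphic_div_subc => //; case: (bdP _ hz).
  have b3 z' : bd z' -> holomorphic_at (fun z => (v - u) * K v z) z'.
    move=> hz; apply: holomorphicM; first exact: holomorphic_cst.
    by apply: (@holomorphic_div_subc (fun z => F z / (z - u)));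
      [case: (bdv _ _ vu hz)|exact: b2].
  rewrite -mulrBr; apply: (mulfI vu1); rewrite mulVKf // -rectintZ; last first.
    apply: (square_boundary_continuous s0') => z' hz.
    by apply: (@holomorphic_div_subc (fun z => F z / (z - u)));
      [case: (bdv _ _ vu hz)|exact: b2].
  apply/eqP; rewrite subr_eq -rectintD.
  - apply/eqP; apply: (eq_square s0') => z' hz.
    have [_ _ /eqP] := bdP _ hz; rewrite -subr_eq0 => n1.
    have [_ /eqP] := bdv _ _ vu hz; rewrite -subr_eq0 => n2.
    by rewrite /K; field; rewrite n1 n2.
  - exact: (square_boundary_continuous s0' b3).
  - exact: (square_boundary_continuous s0' b2).
apply: (@holomorphic_at_eq _ (fun v => k^-1 * square (K v) u s) _ _ (s / 2)).
- by rewrite divr_gt0.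
- by move=> v /repr ->.
pose K' z' := F z' / (z' - u) / (z' - u) / (z' - u).
have hK v z' : normc (v - u) < s / 2 -> bd z' -> holomorphic_at (K v) z'.
  move=> vu hz; apply: (@holomorphic_div_subc (fun z => F z / (z - u))).
    by case: (bdv _ _ vu hz).
  by apply: holomorphic_div_subc; [case: (bdP _ hz)|exact: eF].
have uu : normc (u - u) < s / 2 by rewrite subrr normc0 divr_gt0.
apply/holomorphic_atP; exists (k^-1 * square (fun z' => K u z' / (z' - u)) u s).
move=> e e0.
(* A bound on the contour for F z' / (z' - u)^3 / (z' - v), where z' - v has
   modulus at least s / 2. *)
pose M := 2 / s ^+ 4.
have M0 : 0 < M by rewrite divr_gt0 // exprn_gt0.
have k1 : 0 < normc k by rewrite normc_gt0.
pose d := Num.min (s / 2) (e * normc k / (16 * s * M)).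
exists d.
  rewrite lt_min; apply/andP; split; first exact: divr_gt0.
  by apply: divr_gt0; apply: mulr_gt0 => //; apply: mulr_gt0.
move=> v; rewrite lt_min => /andP[vu vd].
have hL z' : bd z' -> holomorphic_at (fun z' => K u z' / (z' - u)) z'.
  move=> hz; apply: holomorphic_div_subc; last exact: (hK u).
  by case: (bdP _ hz).
pose Q z' := K u z' / (z' - u) / (z' - v).
have hQ z' : bd z' -> holomorphic_at Q z'.
  move=> hz; apply: (@holomorphic_div_subc (fun z' => K u z' / (z' - u)));
    [by case: (bdv _ _ vu hz)|exact: hL].
have cK v' : normc (v' - u) < s / 2 -> _ :=
  fun vu' => square_boundary_continuous s0' (fun z' => hK v' z' vu').
have cL := square_boundary_continuous s0' hL.
have cQ := square_boundary_continuous s0' hQ.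
(* The expansion of 1 / (z' - v) to second order in v - u. *)
have E : square (K v) u s - square (K u) u s -
    (v - u) * square (fun z' => K u z' / (z' - u)) u s =
    (v - u) ^+ 2 * square Q u s.
  have hZ (c : C) (H : C -> C) :
      (forall z', bd z' -> holomorphic_at H z') ->
      (forall z', bd z' -> holomorphic_at (fun x => c * H x) z').
    by move=> hH z' hz; apply: holomorphicM; [exact: holomorphic_cst|exact: hH].
  have E1 : square (K v) u s = square (fun z' => K u z' +
      ((v - u) * (K u z' / (z' - u)) + (v - u) ^+ 2 * Q z')) u s.
    apply: (eq_square s0') => z' hz.
    have [_ _ /eqP] := bdP _ hz; rewrite -subr_eq0 => n1.
    have [_ /eqP] := bdv _ _ vu hz; rewrite -subr_eq0 => n2.
    by rewrite /Q /K; field; rewrite n1 n2.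
  have c1 := square_boundary_continuous s0' (hZ (v - u) _ hL).
  have c2 := square_boundary_continuous s0' (hZ ((v - u) ^+ 2) _ hQ).
  have c3 := square_boundary_continuous s0' (fun z' hz =>
    holomorphicD (hZ (v - u) _ hL z' hz) (hZ ((v - u) ^+ 2) _ hQ z' hz)).
  rewrite E1 /square (rectintD (cK _ uu) c3) (rectintD c1 c2).
  by rewrite (rectintZ _ cL) (rectintZ _ cQ); ring.
have -> : k^-1 * square (K v) u s - k^-1 * square (K u) u s -
   k^-1 * square (fun z' => K u z' / (z' - u)) u s * (v - u) =
   k^-1 * ((v - u) * ((v - u) * square Q u s)).
  by rewrite mulrA -expr2 -E; ring.
have bQ : normc (square Q u s) <= 16 * s * M.
  apply: (square_bound s0' hQ) => z' hz.
  have [q1 q2 q3] := bdP _ hz; have [q4 q5] := bdv _ _ vu hz.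
  rewrite /Q /K !normcM !normcV.
  have -> : M = 1 * s^-1 * s^-1 * s^-1 * (s / 2)^-1.
    by rewrite /M; field; rewrite gt_eqF.
  have i0 (t : C) : 0 <= (normc t)^-1 by rewrite invr_ge0 normc_ge0.
  have i1 : (normc (z' - u))^-1 <= s^-1.
    by rewrite lef_pV2 ?posrE // (lt_le_trans s0).
  have i2 : (normc (z' - v))^-1 <= (s / 2)^-1.
    by rewrite lef_pV2 ?posrE ?divr_gt0 // (lt_le_trans _ q4) ?divr_gt0.
  by do 4 (apply: ler_pM; rewrite ?mulr_ge0 ?i0 ?normc_ge0 //).
rewrite !normcM normcV; set w := normc (v - u) in vu vd *.
have w0 : 0 <= w := normc_ge0 _.
rewrite ler_pdivrMl // (_ : _ * (e * w) = w * (e * normc k)); last by ring.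
have sM : 0 < 16 * s * M by apply: mulr_gt0 => //; apply: mulr_gt0.
rewrite ler_wpM2l //; move: vd; rewrite (ltr_pdivlMr _ _ sM) => /ltW.
by apply: le_trans; rewrite ler_wpM2l.
Qed.

End Removable.

(** * Integrals over the line and over strips *)

Section RealIntegrals.
Variable R : realType.
Local Notation mu := (@lebesgue_measure R).
Local Notation RR := (measurableTypeR R).
Implicit Types (f g : R -> R) (D : set R).

Lemma limn_einf_le (u : (\bar R)^nat) (c : \bar R) :
  (forall n, (u n <= c)%E) -> (limn_einf u <= c)%E.
Proof.
move=> uc; rewrite limn_einf_lim; apply: lime_le; first exact: is_cvg_einfs.
by apply: nearW => n; apply: le_trans (uc n); apply: ereal_inf_lbound; exists n => /=.
Qed.

Lemma fatou_le D (u : nat -> R -> R) f (c : \bar R) :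
  measurable (D : set RR) ->
  (forall n, measurable_fun (D : set RR) (u n)) ->
  (forall n x, D x -> 0 <= u n x) ->
  (forall x, D x -> u ^~ x @ \oo --> f x) ->
  (forall n, (\int[mu]_(x in D) (u n x)%:E <= c)%E) ->
  (\int[mu]_(x in D) (f x)%:E <= c)%E.
Proof.
move=> mD mu_ u0 uf uc.
have -> : (\int[mu]_(x in D) (f x)%:E =
           \int[mu]_(x in D) limn_einf (fun n => (u n x)%:E))%E.
  apply: eq_integral => x /set_mem Dx.
  have cu : (fun n => (u n x)%:E) @ \oo --> (f x)%:E.
    by apply: cvg_EFin; [exact: nearW | exact: uf].
  by rewrite (cvg_limn_einf_sup cu).1.
apply: le_trans (limn_einf_le uc).
apply: (@fatou _ _ _ mu D mD (fun n x => (u n x)%:E)) => n.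
  exact/measurable_EFinP.
by move=> x Dx; rewrite lee_fin u0.
Qed.

(** Fatou's lemma for the truncations of [f]. *)
Lemma integral_exhaust f (c : \bar R) :
  measurable_fun (setT : set RR) f -> (forall x, 0 <= f x) ->
  (forall n : nat, (\int[mu]_(x in `[(- n%:R)%R, n%:R%R]) (f x)%:E <= c)%E) ->
  (\int[mu]_x (f x)%:E <= c)%E.
Proof.
move=> mf f0 fc.
pose u (n : nat) x := f x * \1_(`[- n%:R, n%:R] : set R) x.
apply: (@fatou_le setT u) => //.
- move=> n; apply: measurable_funM => //.
- by move=> n x _; rewrite mulr_ge0 // indicE.
- move=> x _; apply: (@cvg_near_cst _ R^o); exists (Num.bound `|x|).+1 => // n /= hn.
  rewrite /u indicE mem_set ?mulr1 //= in_itv /=.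
  have : `|x| < n%:R.
    apply: lt_le_trans (_ : (Num.bound `|x|)%:R <= _); last by rewrite ler_nat ltnW.
    exact: archi_boundP.
  by move=> /ltr_normlP[h1 h2]; rewrite lerNl !ltW.
move=> n; apply: le_trans (fc n); rewrite [leRHS]integral_mkcond.
rewrite le_eqVlt; apply/orP; left; apply/eqP; apply: eq_integral => x _.
rewrite /u patchE indicE; case: (x \in _); by rewrite ?mulr1 ?mulr0.
Qed.

(** Otherwise exhaustion would bound the integral of [f] by itself minus [e]. *)
Lemma integral_tail f (e : R) : measurable_fun (setT : set RR) f ->
  (forall x, 0 <= f x) -> mu.-integrable setT (EFin \o f) -> 0 < e ->
  exists n : nat, \int[mu]_x f x - e < \int[mu]_(x in `[- n%:R, n%:R]) f x.
Proof.
move=> mf f0 jf e0; apply: contrapT => H.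
have fin : (\int[mu]_x (f x)%:E)%E \is a fin_num by apply: integrable_fin_num.
have : (\int[mu]_x (f x)%:E <= (\int[mu]_x f x - e)%:E)%E.
  apply: integral_exhaust => // n.
  have jn : mu.-integrable `[- n%:R, n%:R] (EFin \o f).
    exact: integrableS jf.
  have finn := integrable_fin_num _ jn.
  rewrite -[leLHS]fineK; last by apply: finn.
  rewrite lee_fin leNgt; apply/negP => h; apply: H; exists n; exact: h.
rewrite -[leLHS]fineK // lee_fin -/(Rintegral _ _ _).
by rewrite lerBrDr gerDl leNgt e0.
Qed.

Lemma poisson_ge0 (p s x : R) : 0 < s -> 0 <= s / ((x - p) ^+ 2 + s ^+ 2).
Proof. by move=> s0; apply: divr_ge0; [exact: ltW|rewrite addr_ge0 ?sqr_ge0]. Qed.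

Lemma measurable_poisson (p s : R) : 0 < s ->
  measurable_fun (setT : set RR) (fun x => s / ((x - p) ^+ 2 + s ^+ 2)).
Proof.
move=> s0; apply: continuous_measurable_fun => x; exact: continuous_poisson.
Qed.

Lemma integral_poisson_le (p s : R) : 0 < s ->
  (\int[mu]_x (s / ((x - p) ^+ 2 + s ^+ 2))%:E <= pi%:E)%E.
Proof.
move=> s0; apply: integral_exhaust.
- exact: measurable_poisson.
- by move=> x; exact: poisson_ge0.
move=> [|n].
  rewrite oppr0 set_itv1 integral_set1 lee_fin; exact: pi_ge0.
have jn := integrable_poisson_itv p (- n.+1%:R) n.+1%:R s0.
rewrite -[leLHS]fineK; last by apply: integrable_fin_num.
rewrite lee_fin -/(Rintegral _ _ _) Rintegral_poisson //; last first.
  by rewrite gtrN.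
have := atan_ltpi2 ((n.+1%:R - p) / s).
have := atan_gtNpi2 ((- n.+1%:R - p) / s).
by move: (atan _) (atan _) => t1 t2; lra.
Qed.

Lemma ge0_integrable D f (c : R) : measurable (D : set RR) ->
  measurable_fun (D : set RR) f ->
  (forall x, D x -> 0 <= f x) -> (\int[mu]_(x in D) (f x)%:E <= c%:E)%E ->
  mu.-integrable D (EFin \o f).
Proof.
move=> mD mf f0 fc; apply/integrableP; split; first exact/measurable_EFinP.
apply: le_lt_trans (ltry c); apply: le_trans fc.
rewrite le_eqVlt; apply/orP; left; apply/eqP; apply: eq_integral => x /set_mem Dx.
by rewrite /= ger0_norm // f0.
Qed.

End RealIntegrals.

Section Slices.
Variable R : realType.
Local Notation mu := (@lebesgue_measure R).
Local Notation RR := (measurableTypeR R).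
Implicit Types (phi : R -> R -> R) (psi : R -> R) (Y M T : R).

Lemma le_limn_einf (u v : (\bar R)^nat) :
  (forall n, (u n <= v n)%E) -> (limn_einf u <= limn_einf v)%E.
Proof.
move=> uv; rewrite !limn_einf_lim; apply: lee_lim; [exact: is_cvg_einfs..|].
apply: nearW => n; apply: le_ereal_inf_tmp => _ [m /= nm <-].
by apply: le_trans (uv m); apply: ereal_inf_lbound; exists m.
Qed.

Definition grid Y (n k : nat) : R := k%:R * (Y / n.+1%:R).

Definition grid_itv Y (n k : nat) : set R := `]grid Y n k, grid Y n k.+1].

(** Each cell of the grid is sampled at its right endpoint, so that [psi] is only
    evaluated at positive heights, where the integrals over horizontal lines are
    bounded. *)
Definition upper_step psi Y (n : nat) (y : R) : R :=
  \sum_(k < n.+1) psi (grid Y n k.+1) * \1_(grid_itv Y n k) y.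

Lemma gridS Y n k : grid Y n k.+1 = grid Y n k + Y / n.+1%:R.
Proof. by rewrite /grid -natr1 mulrDl mul1r. Qed.

Lemma grid_gt0 Y n k : 0 < Y -> 0 < grid Y n k.+1.
Proof. by move=> Y0; rewrite mulr_gt0 // divr_gt0. Qed.

Lemma grid_cover Y n y : 0 < Y -> 0 < y <= Y ->
  exists k : 'I_n.+1, grid_itv Y n k y.
Proof.
move=> Y0 /andP[y0 yY].
have ex : exists k, y <= grid Y n k.+1.
  by exists n; rewrite /grid mulrCA divff ?mulr1.
have [k yk kmin] := ex_minnP ex.
have kn : (k < n.+1)%N.
  by rewrite ltnS; apply: kmin; rewrite /grid mulrCA divff ?mulr1.
exists (Ordinal kn) => //=; rewrite /grid_itv /= in_itv /= yk andbT.
case: k yk kmin {kn} => [|k] _ kmin; first by rewrite /grid mul0r.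
by rewrite ltNge; apply/negP => /kmin; rewrite ltnn.
Qed.

Lemma upper_stepE psi Y n (k : 'I_n.+1) y : 0 < Y -> grid_itv Y n k y ->
  upper_step psi Y n y = psi (grid Y n k.+1).
Proof.
move=> Y0 yk; rewrite /upper_step (bigD1 k) //= indicE mem_set // mulr1.
rewrite big1 ?addr0 // => i ik; rewrite indicE memNset ?mulr0 //.
have d0 : 0 < Y / n.+1%:R by rewrite divr_gt0.
move: yk; rewrite /grid_itv /= !in_itv /= => /andP[h1 h2] /andP[h3 h4].
have : (k < i.+1)%N.
  by rewrite -(ltr_nat R) -(ltr_pM2r d0); exact: lt_le_trans h4.
have : (i < k.+1)%N.
  by rewrite -(ltr_nat R) -(ltr_pM2r d0); exact: lt_le_trans h2.
rewrite !ltnS => ik1 ik2; move: ik; rewrite -val_eqE /= => /eqP; apply.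
by apply/eqP; rewrite eqn_leq ik1 ik2.
Qed.

Lemma cvg_upper_step psi Y y : 0 < Y -> 0 < y <= Y -> {for y, continuous psi} ->
  upper_step psi Y n y @[n --> \oo] --> psi y.
Proof.
move=> Y0 hy cpsi; apply/(@cvgrPdist_lt R R^o) => e e0.
have /(@cvgrPdist_lt R R^o) /(_ _ e0) /nbhs_ballP[d /= d0 Hd] := cpsi.
exists (Num.bound (Y / d)) => // n /= hn.
have [k yk] := grid_cover n Y0 hy.
rewrite (upper_stepE _ Y0 yk); apply: Hd; rewrite /ball /=.
move: yk; rewrite /grid_itv /= in_itv /= gridS => /andP[h1 h2].
have h : Y / n.+1%:R < d.
  rewrite ltr_pdivrMr // mulrC -ltr_pdivrMr //.
  apply: lt_le_trans (archi_boundP (ltW (divr_gt0 Y0 d0))) _.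
  by rewrite ler_nat leqW.
apply/ltr_normlP; split; move: h1 h2 h; set q := Y / _; clear; lra.
Qed.

Lemma integral_upper_step psi Y n : 0 < Y -> (forall y, 0 < y -> 0 <= psi y) ->
  (\int[mu]_(y in `]0%R, Y]) (upper_step psi Y n y)%:E <=
   (\sum_(k < n.+1) Y / n.+1%:R * psi (grid Y n k.+1))%R%:E)%E.
Proof.
move=> Y0 p0; rewrite /upper_step.
under eq_integral do rewrite -sumEFin.
have mg k : measurable (grid_itv Y n k : set RR) by exact: measurable_itv.
rewrite ge0_integral_sum //=; last 2 first.
- by move=> k; apply/measurable_EFinP; apply: measurable_funM.
- by move=> k y _; rewrite lee_fin mulr_ge0 // p0 // grid_gt0.
rewrite -sumEFin; apply: lee_sum => k _.
under eq_integral do rewrite EFinM.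
rewrite ge0_integralZl //=; last 2 first.
- by apply/measurable_EFinP.
- by rewrite lee_fin p0 // grid_gt0.
rewrite integral_indic // mulrC EFinM; apply: lee_pmul => //.
  by rewrite lee_fin p0 // grid_gt0.
apply: le_trans (_ : mu (grid_itv Y n k) <= _)%E.
  by apply: le_measure; rewrite ?inE //; apply: measurableI.
rewrite lebesgue_measure_itv /= lte_fin gridS.
case: ifP => _; last by rewrite lee_fin divr_ge0 // ltW.
by rewrite -EFinD lee_fin addrAC subrr add0r.
Qed.

(** A function of two variables whose integrals over all horizontal lines of a
    strip are bounded has small integrals over some vertical segments far out:
    Fatou's lemma in [y] bounds the vertical integrals by their Riemann sums,
    and Fatou's lemma in [x] integrates these. *)
Lemma small_vertical_slice phi Y M T (eta : R) : 0 < Y ->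
  (forall x y, 0 <= phi x y) ->
  (forall x y, 0 < y -> {for y, continuous (phi x)}) ->
  (forall y, 0 < y -> measurable_fun (setT : set RR) (phi ^~ y)) ->
  (forall y, 0 < y -> (\int[mu]_x (phi x y)%:E <= M%:E)%E) ->
  0 < eta ->
  exists2 X, T <= X & (\int[mu]_(y in `]0%R, Y]) (phi X y)%:E <= eta%:E)%E.
Proof.
move=> Y0 p0 pc pm pM eta0; apply: contrapT => H.
have {}H X : T <= X -> (eta%:E <= \int[mu]_(y in `]0%R, Y]) (phi X y)%:E)%E.
  by move=> TX; rewrite leNgt; apply/negP => h; apply: H; exists X => //; exact: ltW.
pose S n x := \sum_(k < n.+1) Y / n.+1%:R * phi x (grid Y n k.+1).
have S0 n x : 0 <= S n x.
  by apply: sumr_ge0 => k _; rewrite mulr_ge0 // divr_ge0 // ltW.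
have mS n : measurable_fun (setT : set RR) (S n).
  apply: measurable_sum => k; apply: measurable_funM => //.
  by apply: pm; exact: grid_gt0.
have inner X : T <= X -> (eta%:E <= limn_einf (fun n => (S n X)%:E))%E.
  move=> /H h; apply: le_trans h _.
  have mI : measurable (`]0%R, Y] : set RR) by exact: measurable_itv.
  have -> : (\int[mu]_(y in `]0%R, Y]) (phi X y)%:E =
     \int[mu]_(y in `]0%R, Y]) limn_einf (fun n => (upper_step (phi X) Y n y)%:E))%E.
    apply: eq_integral => y; rewrite inE /= in_itv /= => hy.
    have cu : (fun n => (upper_step (phi X) Y n y)%:E) @ \oo --> (phi X y)%:E.
      apply: cvg_EFin; first exact: nearW.
      by apply: cvg_upper_step => //; apply: pc; case/andP: hy.
    by rewrite (cvg_limn_einf_sup cu).1.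
  apply: le_trans (@fatou _ _ _ mu _ mI
    (fun n y => (upper_step (phi X) Y n y)%:E) _ _) _.
  - move=> n; apply/measurable_EFinP; apply: measurable_sum => k.
    by apply: measurable_funM => //; apply: measurable_indic; exact: measurable_itv.
  - by move=> n y _; rewrite lee_fin sumr_ge0 // => k _; rewrite mulr_ge0 // indicE.
  by apply: le_limn_einf => n; apply: integral_upper_step.
(* If all slices beyond T had integrals at least eta, an interval of length L
   beyond T would carry more than the M * Y available in the strip. *)
pose L := M * Y / eta + 1.
have L0 : M * Y < eta * L by rewrite /L mulrDr mulr1 [eta * _]mulrC divfK ?gt_eqF // ltrDl.
have M0 : 0 <= M.
  have := pM 1 ltr01; rewrite -lee_fin; apply: le_trans.
  by apply: integral_ge0 => x _; rewrite lee_fin.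
have L1 : 0 < L.
  by rewrite /L ltr_wpDl // divr_ge0 ?(ltW eta0) // mulr_ge0 ?(ltW Y0).
have SM n : (\int[mu]_(x in `[T, (T + L)%R]) (S n x)%:E <= (M * Y)%R%:E)%E.
  apply: le_trans (_ : \int[mu]_x (S n x)%:E <= _)%E.
    apply: ge0_subset_integral => //; first exact/measurable_EFinP.
    by move=> x _; rewrite lee_fin.
  rewrite /S; under eq_integral do rewrite -sumEFin.
  rewrite ge0_integral_sum //; last 2 first.
  - move=> k; apply/measurable_EFinP; apply: measurable_funM => //.
    by apply: pm; exact: grid_gt0.
  - by move=> k x _; rewrite lee_fin mulr_ge0 // divr_ge0 // ltW.
  have -> : (M * Y)%R%:E = (\sum_(k < n.+1) (Y / n.+1%:R * M)%:E)%E.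
    rewrite sumEFin sumr_const card_ord; congr (_%:E).
    rewrite -[RHS]mulr_natl; have : n.+1%:R != 0 :> R by rewrite pnatr_eq0.
    by move: (n.+1%:R : R) => q q0; field.
  apply: lee_sum => k _.
  under eq_integral do rewrite EFinM.
  have mk : measurable_fun (setT : set RR) (phi ^~ (grid Y n k.+1)).
    by apply: pm; exact: grid_gt0.
  rewrite ge0_integralZl //; last 3 first.
  - exact/measurable_EFinP.
  - by move=> x _; rewrite lee_fin.
  - by rewrite lee_fin divr_ge0 // ltW.
  rewrite [leRHS]EFinM; apply: lee_pmul => //.
  - by rewrite lee_fin divr_ge0 // ltW.
  - by apply: integral_ge0 => x _; rewrite lee_fin.
  - by apply: pM; exact: grid_gt0.
have mT : measurable (`[T, (T + L)%R] : set RR) by exact: measurable_itv.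
have : (eta%:E * L%:E <= (M * Y)%:E)%E.
  apply: le_trans (limn_einf_le SM).
  apply: le_trans (@fatou _ _ _ mu _ mT (fun n x => (S n x)%:E) _ _); last 2 first.
  - move=> n; apply/measurable_EFinP; apply: measurable_funS (mS n) => //.
  - by move=> n x _; rewrite lee_fin.
  have -> : (eta%:E * L%:E = \int[mu]_(x in `[T, (T + L)%R]) eta%:E)%E.
    rewrite integral_cst //= lebesgue_measure_itv /= lte_fin ltrDl L1 -EFinD.
    by rewrite addrAC subrr add0r.
  apply: ge0_le_integral => //.
  - by move=> x _; rewrite lee_fin ltW.
  - apply: (emeasurable_fun_cvg (fun n x => einfs (fun n => (S n x)%:E) n)).
      move=> n; apply: measurable_fun_einfs => k; apply/measurable_EFinP.
      exact: measurable_funS (mS k).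
    by move=> x _; rewrite limn_einf_lim; exact: is_cvg_einfs.
  - by move=> x /=; rewrite in_itv /= => /andP[/inner].
by rewrite -EFinM lee_fin leNgt L0.
Qed.

End Slices.

(** * Cauchy's formula in the upper half-plane *)

Section HalfPlane.
Variable R : realType.
Local Notation C := R[i].
Local Notation mu := (@lebesgue_measure R).
Local Notation RR := (measurableTypeR R).
Implicit Types (h F : C -> C) (x y X Y M : R) (z m : C).

Lemma continuous_line (F : C -> C) (p : C -> R) (l : R -> C) x :
  (forall z w, p (z - w) = p z - p w) -> (forall z, `|p z| <= normc z) ->
  (forall s t, normc (l s - l t) = `|s - t|) ->
  ccontinuous_at F (l x) -> {for x, continuous (fun t => p (F (l t)))}.
Proof.
move=> pB pn ln cF; apply/(@cvgrPdist_lt R R^o R^o) => e e0.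
have [d d0 Hd] := cF _ e0; apply/nbhs_ballP; exists d => //= t.
rewrite /ball /= distrC -ln => td; rewrite distrC -pB.
by apply: le_lt_trans (pn _) (Hd _ td).
Qed.

Lemma continuous_normc_line (F : C -> C) (l : R -> C) x :
  (forall s t, normc (l s - l t) = `|s - t|) ->
  ccontinuous_at F (l x) -> {for x, continuous (fun t => normc (F (l t)))}.
Proof.
move=> ln cF; apply/(@cvgrPdist_lt R R^o R^o) => e e0.
have [d d0 Hd] := cF _ e0; apply/nbhs_ballP; exists d => //= t.
rewrite /ball /= distrC -ln => td; rewrite distrC.
by apply: le_lt_trans (ler_dist_normc _ _) (Hd _ td).
Qed.

Lemma normc_hline y s t : normc ((s +i* y) - (t +i* y) : C) = `|s - t|.
Proof. by rewrite subc_hline normc_real. Qed.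

Lemma normc_vline x s t : normc ((x +i* s) - (x +i* t) : C) = `|s - t|.
Proof. by rewrite subc_vline /= expr0n add0r sqrtr_sqr. Qed.

Definition L2_lines h M : Prop := forall y, 0 < y ->
  (\int[mu]_x ((normc (h (x +i* y))) ^+ 2)%:E <= M%:E)%E.

Lemma measurable_sqr_line F y : (forall x, ccontinuous_at F (x +i* y)) ->
  measurable_fun (setT : set RR) (fun x => normc (F (x +i* y)) ^+ 2).
Proof.
move=> cF; apply: continuous_measurable_fun => x; apply: cvgM;
  apply: (@continuous_normc_line _ (fun t => t +i* y)) => //; move=> s t;
  exact: normc_hline.
Qed.

(** Fatou's lemma along the heights [1 / n]. *)
Lemma L2_boundary h M : (forall z, 0 <= complex.Im z -> ccontinuous_at h z) ->
  L2_lines h M ->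
  forall y, 0 <= y -> (\int[mu]_x ((normc (h (x +i* y))) ^+ 2)%:E <= M%:E)%E.
Proof.
move=> ch hM y; rewrite le_eqVlt => /predU1P[<-|]; last exact: hM.
apply: (@fatou_le _ _ (fun n x => normc (h (x +i* (n.+1%:R^-1))) ^+ 2)) => //.
- move=> n; apply: measurable_sqr_line => x; apply: ch => /=.
  by rewrite invr_ge0.
- by move=> n x _; exact: sqr_ge0.
- move=> x _.
  have c1 : {for 0, continuous (fun t => normc (h (x +i* t)))}.
    apply: (@continuous_normc_line _ (fun t => x +i* t)); first exact: normc_vline.
    by apply: ch => /=.
  have cx : {for 0, continuous (fun t => normc (h (x +i* t)) ^+ 2)}.
    by apply: cvgM.
  exact: (cvg_comp _ _ (@cvg_harmonic R) cx).
- by move=> n; apply: hM; rewrite invr_gt0.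
Qed.

Lemma normc_AMGM (z m : C) (d : R) : 0 < d ->
  normc (z / m) <= (d * normc z ^+ 2 + d^-1 * (normc m ^+ 2)^-1) / 2.
Proof.
move=> d0; rewrite normcM normcV -exprVn; set u := normc z; set v := _^-1.
have d0' : d != 0 by rewrite gt_eqF.
have : 0 <= d * (u - d^-1 * v) ^+ 2 by rewrite mulr_ge0 ?sqr_ge0 // ltW.
have -> : d * (u - d^-1 * v) ^+ 2 = d * u ^+ 2 + d^-1 * v ^+ 2 - 2 * (u * v).
  by field.
lra.
Qed.

Lemma inv_sqr_poisson m x y : y != complex.Im m ->
  (normc ((x +i* y) - m) ^+ 2)^-1 = `|y - complex.Im m|^-1 *
    (`|y - complex.Im m| / ((x - complex.Re m) ^+ 2 + `|y - complex.Im m| ^+ 2)).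
Proof.
move=> ym; rewrite normc_sqr ReB ImB /= real_normK ?num_real //.
have d0 : `|y - complex.Im m| != 0 by rewrite normr_eq0 subr_eq0.
by rewrite mulKf.
Qed.

Lemma integral_sub_le (D : set R) (f : R -> R) (c : R) : measurable (D : set RR) ->
  measurable_fun (setT : set RR) f -> (forall x, 0 <= f x) ->
  (\int[mu]_x (f x)%:E <= c%:E)%E ->
  mu.-integrable D (EFin \o f) /\ \int[mu]_(x in D) f x <= c.
Proof.
move=> mD mf f0 fc.
have fD : (\int[mu]_(x in D) (f x)%:E <= c%:E)%E.
  apply: le_trans fc; apply: ge0_subset_integral => //; first exact/measurable_EFinP.
  by move=> x _; rewrite lee_fin.
have jf : mu.-integrable D (EFin \o f).
  by apply: (ge0_integrable mD _ _ fD) => //; exact: measurable_funS mf.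
split => //; rewrite -lee_fin; apply: le_trans fD.
by rewrite /Rintegral fineK //; apply: integrable_fin_num.
Qed.

Lemma integralT_opp (f : R -> \bar R) :
  measurable_fun (setT : set RR) f -> (forall x, (0 <= f x)%E) ->
  (\int[mu]_x f (- x)%R = \int[mu]_x f x)%E.
Proof.
move=> mf f0.
have -> : (\int[mu]_x f (- x)%R =
    \int[mu]_(x in (-%R : _ -> RR) @^-1` setT) (f \o (-%R : RR -> RR)) x)%E by [].
rewrite -ge0_integral_pushforward //=.
by apply: eq_measure_integral => //= A mA AS; exact: lebesgue_measureN.
Qed.

Section Kernel.
Variables (h : C -> C) (M : R) (m : C).
Hypothesis hh : forall z, 0 <= complex.Im z -> holomorphic_at h z.
Hypothesis hM : L2_lines h M.

Let H z := h z / (z - m).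

Let ch z : 0 <= complex.Im z -> ccontinuous_at h z.
Proof. by move=> hz; apply: holomorphic_at_continuous; exact: hh. Qed.

Let hH z : 0 <= complex.Im z -> z <> m -> holomorphic_at H z.
Proof. by move=> hz zm; apply: holomorphic_div_subc => //; exact: hh. Qed.

Let M0 : 0 <= M.
Proof.
have := hM ltr01; rewrite -lee_fin; apply: le_trans.
by apply: integral_ge0 => x _; rewrite lee_fin sqr_ge0.
Qed.

(** The pointwise arithmetic-geometric mean inequality replaces
    Cauchy-Schwarz; the parameter [d] balances the two terms. *)
Let maj y (d : R) x := (d * normc (h (x +i* y)) ^+ 2 +
  (d * `|y - complex.Im m|)^-1 *
   (`|y - complex.Im m| / ((x - complex.Re m) ^+ 2 + `|y - complex.Im m| ^+ 2))) / 2.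

Let majP y d x : y != complex.Im m -> 0 < d -> normc (H (x +i* y)) <= maj y d x.
Proof.
move=> ym d0; apply: le_trans (normc_AMGM _ _ d0) _.
by rewrite inv_sqr_poisson // [d^-1 * (_ * _)]mulrA -invfM.
Qed.

Let maj_ge0 y d x : y != complex.Im m -> 0 < d -> 0 <= maj y d x.
Proof. by move=> ym d0; apply: le_trans (majP x ym d0); exact: normc_ge0. Qed.

Let measurable_maj y d : 0 <= y -> y != complex.Im m -> 
  measurable_fun (setT : set RR) (maj y d).
Proof.
move=> y0 ym; apply: measurable_funM => //; apply: measurable_funD.
  apply: measurable_funM => //; apply: measurable_sqr_line => x; exact: ch.
apply: measurable_funM => //; apply: measurable_poisson.
by rewrite normr_gt0 subr_eq0.
Qed.

Let integral_maj y d : 0 <= y -> y != complex.Im m -> 0 < d ->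
  (\int[mu]_x (maj y d x)%:E <=
   ((d * M + (d * `|y - complex.Im m|)^-1 * pi) / 2)%:E)%E.
Proof.
move=> y0 ym d0; rewrite /maj.
have r0 : 0 < `|y - complex.Im m| by rewrite normr_gt0 subr_eq0.
have m1 : measurable_fun (setT : set RR) (fun x => normc (h (x +i* y)) ^+ 2).
  by apply: measurable_sqr_line => x; exact: ch.
have m2 := measurable_poisson (complex.Re m) r0.
have dr0 : 0 <= (d * `|y - complex.Im m|)^-1 by rewrite invr_ge0 mulr_ge0 // ltW.
have d0' := ltW d0.
have -> : (\int[mu]_x ((d * normc (h (x +i* y)) ^+ 2 +
    (d * `|y - complex.Im m|)^-1 *
   (`|y - complex.Im m| / ((x - complex.Re m) ^+ 2 + `|y - complex.Im m| ^+ 2))) / 2)%:E =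
  \int[mu]_x ((d / 2)%:E * (normc (h (x +i* y)) ^+ 2)%:E +
    ((d * `|y - complex.Im m|)^-1 / 2)%:E *
   (`|y - complex.Im m| / ((x - complex.Re m) ^+ 2 + `|y - complex.Im m| ^+ 2))%:E))%E.
  by apply: eq_integral => x _; rewrite -!EFinM -EFinD; congr (_%:E); ring.
have me1 : measurable_fun (setT : set RR) (fun x => (normc (h (x +i* y)) ^+ 2)%:E).
  exact/measurable_EFinP.
have me2 : measurable_fun (setT : set RR) (fun x => (`|y - complex.Im m| /
    ((x - complex.Re m) ^+ 2 + `|y - complex.Im m| ^+ 2))%:E).
  exact/measurable_EFinP.
have p2 x := poisson_ge0 (complex.Re m) x r0.
have h2 : 0 <= d / 2 by rewrite divr_ge0.
have h3 : 0 <= (d * `|y - complex.Im m|)^-1 / 2 by rewrite divr_ge0.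
rewrite ge0_integralD //=; last 4 first.
- by move=> x _; rewrite -EFinM lee_fin mulr_ge0 ?sqr_ge0.
- exact: measurable_funeM.
- by move=> x _; rewrite -EFinM lee_fin mulr_ge0.
- exact: measurable_funeM.
rewrite !ge0_integralZl //=; try by move=> x _; rewrite lee_fin ?sqr_ge0.
have -> : (d * M + (d * `|y - complex.Im m|)^-1 * pi) / 2 =
  d / 2 * M + (d * `|y - complex.Im m|)^-1 / 2 * pi by ring.
rewrite EFinD [((d / 2 * M)%:E)]EFinM [(((d * _)^-1 / 2 * pi)%:E)]EFinM.
apply: leeD; apply: lee_pmul => //.
- by apply: integral_ge0 => x _; rewrite lee_fin sqr_ge0.
- exact: (L2_boundary ch hM).
- by apply: integral_ge0 => x _; rewrite lee_fin.
- exact: integral_poisson_le.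
Qed.

Let cintegrable_H (D : set R) y : measurable (D : set RR) ->
  0 <= y -> y != complex.Im m -> cintegrable D (fun x => H (x +i* y)).
Proof.
move=> mD y0 ym.
have cH x : ccontinuous_at H (x +i* y).
  apply: holomorphic_at_continuous; apply: hH => // e.
  by move/eqP: ym; rewrite -e.
have jm : mu.-integrable D (EFin \o maj y 1).
  have [] // := integral_sub_le mD (measurable_maj 1 y0 ym) _ (integral_maj y0 ym ltr01).
  by move=> x; exact: maj_ge0.
suff K (p : C -> R) : (forall z w, p (z - w) = p z - p w) ->
    (forall z, `|p z| <= normc z) ->
    mu.-integrable D (EFin \o (fun x => p (H (x +i* y)))).
  by split; apply: K; [exact: ReB|exact: ler_Re_normc|exact: ImB|exact: ler_Im_normc].
move=> pB pn; apply: (integrable_bound mD _ jm).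
  apply: (@measurable_funS _ _ _ _ setT) => //.
  apply: continuous_measurable_fun => x.
  by apply: (@continuous_line _ p (fun t => t +i* y)) => // s t; exact: normc_hline.
by move=> x _; apply: le_trans (pn _) _; exact: majP.
Qed.

Let line_bound (D : set R) y d : measurable (D : set RR) ->
  0 <= y -> y != complex.Im m -> 0 < d ->
  normc (cintegral D (fun x => H (x +i* y))) <=
  d * M + (d * `|y - complex.Im m|)^-1 * pi.
Proof.
move=> mD y0 ym d0.
have [jm hm] := integral_sub_le mD (measurable_maj d y0 ym)
  (fun x => maj_ge0 x ym d0) (integral_maj y0 ym d0).
apply: le_trans (cintegral_bound mD (cintegrable_H mD y0 ym) jm _) _.
  by move=> x _; exact: majP.
by move: hm; rewrite -ler_pdivlMl // mulrC.
Qed.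

Lemma Rintegral_setC (A : set R) (f : R -> R) : measurable (A : set RR) ->
  mu.-integrable setT (EFin \o f) ->
  \int[mu]_x f x = \int[mu]_(x in A) f x + \int[mu]_(x in ~` A) f x.
Proof.
move=> mA jf; rewrite -Rintegral_setU ?setUv //; first exact: measurableC.
by apply/disj_set2P; rewrite setICr.
Qed.

Let tail (e : R) : 0 < e -> 0 != complex.Im m -> exists n : nat, forall X, n%:R <= X ->
  normc (cintegral setT (fun x => H (x +i* 0)) -
         cintegral `[(- X)%R, X] (fun x => H (x +i* 0))) <= e.
Proof.
move=> e0 m0.
have mm := measurable_maj 1 (lexx 0) m0.
have p0 x := maj_ge0 x m0 ltr01.
have [jm _] := integral_sub_le (@measurableT _ RR) mm p0 (integral_maj (lexx 0) m0 ltr01).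
have [n Hn] := integral_tail mm p0 jm (divr_gt0 e0 (ltr0n R 2)).
exists n => X nX.
have mI : measurable (`[(- X)%R, X] : set RR) by exact: measurable_itv.
have mC : measurable (~` `[(- X)%R, X] : set RR) by exact: measurableC.
have [jH1 jH2] := cintegrable_H (@measurableT _ RR) (lexx 0) m0.
have -> : cintegral setT (fun x => H (x +i* 0)) -
         cintegral `[(- X)%R, X] (fun x => H (x +i* 0)) =
   cintegral (~` `[(- X)%R, X]) (fun x => H (x +i* 0)).
  rewrite /cintegral (Rintegral_setC mI jH1) (Rintegral_setC mI jH2).
  by apply/eqP; rewrite eq_complex /=; apply/andP; split; apply/eqP; ring.
have jmC : mu.-integrable (~` `[(- X)%R, X]) (EFin \o maj 0 1).
  exact: integrableS jm.
apply: le_trans (cintegral_bound mC (cintegrable_H mC (lexx 0) m0) jmC _) _.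
  by move=> x _; exact: majP.
have E := Rintegral_setC mI jm.
have mono : \int[mu]_(x in `[- n%:R, n%:R]) maj 0 1 x <=
            \int[mu]_(x in `[(- X)%R, X]) maj 0 1 x.
  have j1 : mu.-integrable `[- n%:R, n%:R] (EFin \o maj 0 1) by exact: integrableS jm.
  have j2 : mu.-integrable `[(- X)%R, X] (EFin \o maj 0 1) by exact: integrableS jm.
  rewrite -lee_fin /Rintegral !fineK; try exact: integrable_fin_num.
  apply: ge0_subset_integral => //.
  - by apply/measurable_EFinP; exact: measurable_funS mm.
  - by move=> x _; rewrite lee_fin.
  - by apply: subset_itv; rewrite bnd_simp // lerN2.
by move: E Hn mono; lra.
Qed.

Let vline_bound X K y : 0 < K -> K <= `|X - complex.Re m| ->
  normc (H (X +i* y)) <= (normc (h (X +i* y)) ^+ 2 + (K ^+ 2)^-1) / 2.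
Proof.
move=> K0 KX; apply: le_trans (normc_AMGM _ _ ltr01) _.
rewrite invr1 !mul1r ler_pM2r ?invr_gt0 // lerD2l.
have h1 : K <= normc ((X +i* y) - m).
  by apply: le_trans KX _; have := ler_Re_normc ((X +i* y) - m); rewrite ReB.
have h0 : 0 < normc ((X +i* y) - m) by apply: lt_le_trans h1.
by rewrite lef_pV2 ?posrE ?exprn_gt0 // lerXn2r // nnegrE ltW.
Qed.

Let continuous_vline_sqr X y : 0 <= y ->
  {for y, continuous (fun t => normc (h (X +i* t)) ^+ 2)}.
Proof.
move=> y0.
have c1 : {for y, continuous (fun t => normc (h (X +i* t)))}.
  apply: (@continuous_normc_line _ (fun t => X +i* t)); first exact: normc_vline.
  by apply: ch => /=.
by apply: cvgM.
Qed.

(** Nothing bounds [h] pointwise on the vertical sides, but their contribution is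
    small for suitable arbitrarily large [X]. *)
Let sides Y T (e : R) : 0 < Y -> 0 < e -> exists2 X, T <= X &
  normc (cintegral `[0, Y] (fun y => H (X +i* y) - H (- X +i* y))) <= e.
Proof.
move=> Y0 e0; pose phi x y := normc (h (x +i* y)) ^+ 2 + normc (h (- x +i* y)) ^+ 2.
(* K is a distance from m to the vertical sides at which the kernel contributes
   at most e / 4. *)
pose K := Num.max 1 (4 * Y / e).
have K1 : 1 <= K by rewrite le_max lexx.
have K0 : 0 < K by apply: lt_le_trans K1.
have KY : Y / K <= e / 4.
  have : 4 * Y / e <= K by rewrite le_max lexx orbT.
  by rewrite !ler_pdivrMr //; lra.
have phi0 x y : 0 <= phi x y by rewrite addr_ge0 ?sqr_ge0.
have cphi x y : 0 <= y -> {for y, continuous (phi x)}.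
  by move=> y0; apply: cvgD; exact: continuous_vline_sqr.
have mphi1 y : 0 < y -> measurable_fun (setT : set RR) (fun x => normc (h (x +i* y)) ^+ 2).
  by move=> y0; apply: measurable_sqr_line => x; apply: ch => /=; exact: ltW.
have mphi2 y : 0 < y -> measurable_fun (setT : set RR) (fun x => normc (h (- x +i* y)) ^+ 2).
  move=> y0; apply: continuous_measurable_fun => x.
  have c1 : {for x, continuous (fun t => normc (h (- t +i* y)))}.
    apply: (@continuous_normc_line _ (fun t => - t +i* y)).
      by move=> s t; rewrite normc_hline opprK addrC distrC.
    by apply: ch => /=; exact: ltW.
  by apply: cvgM.
have Mphi y : 0 < y -> (\int[mu]_x (phi x y)%:E <= (2 * M)%:E)%E.
  move=> y0; rewrite /phi; under eq_integral do rewrite EFinD.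
  rewrite ge0_integralD //=; last 4 first.
  - by move=> x _; rewrite lee_fin sqr_ge0.
  - by apply/measurable_EFinP; exact: mphi1.
  - by move=> x _; rewrite lee_fin sqr_ge0.
  - by apply/measurable_EFinP; exact: mphi2.
  rewrite mulr_natl mulr2n EFinD; apply: leeD; first exact: hM.
  have /measurable_EFinP mE := mphi1 _ y0.
  by rewrite (integralT_opp mE) ?hM // => x; rewrite lee_fin sqr_ge0.
have := @small_vertical_slice R phi Y (2 * M)
  (Num.max T (`|complex.Re m| + K)) (e / 4) Y0 phi0 _ _ Mphi (divr_gt0 e0 (ltr0n R 4)).
move=> /(_ _ _)[|y y0|X].
- by move=> x y y0; apply: cphi; exact: ltW.
- by apply: measurable_funD; [exact: mphi1|exact: mphi2].
rewrite ge_max => /andP[TX KX] hX; exists X => //.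
have KX1 : K <= `|X - complex.Re m|.
  apply: le_trans (ler_norm _); rewrite lerBrDl; apply: le_trans KX.
  by rewrite lerD2r ler_norm.
have KX2 : K <= `|- X - complex.Re m|.
  rewrite -normrN opprB opprK addrC; apply: le_trans (ler_norm _).
  rewrite -lerBlDr; apply: le_trans (_ : `|complex.Re m| + K <= _) => //.
  by rewrite addrC lerD2r -normrN ler_norm.
have cH x : K <= `|x - complex.Re m| -> cintegrable `[0, Y] (fun y => H (x +i* y)).
  move=> Kx; apply: cintegrable_vedge => y /andP[y0 _].
  apply: holomorphic_at_continuous; apply: hH => // e1; move: Kx.
  by rewrite -e1 /= subrr normr0 leNgt K0.
pose g y := phi X y + (K ^+ 2)^-1.
have jg0 : mu.-integrable `[0, Y] (EFin \o phi X).
  apply: continuous_compact_integrable; first exact: segment_compact.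
  apply: continuous_in_subspaceT => y; rewrite inE /= in_itv /= => /andP[y0 _].
  exact: cphi.
have jg : mu.-integrable `[0, Y] (EFin \o g).
  have := integrable_lin 1 1 _ jg0 (integrable_cst_itv 0 Y ((K ^+ 2)^-1)).
  move=> /(_ (measurable_itv _)).
  by congr (integrable _ _ (_ \o _)); apply/funext => y; rewrite !mul1r.
apply: le_trans (cintegral_bound _ _ jg _) _ => //.
- by apply: cintegrableB => //; exact: cH.
- move=> y _; apply: le_trans (le_normcD _ _) _; rewrite normcN.
  apply: le_trans (lerD (vline_bound y K0 KX1) (vline_bound y K0 KX2)) _.
  rewrite /g /phi; have := sqr_ge0 (normc (h (X +i* y))).
  have := sqr_ge0 (normc (h (- X +i* y))).
  by move: (normc _ ^+ 2) (normc _ ^+ 2) ((K ^+ 2)^-1) => a b c; lra.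
rewrite RintegralD //; last exact: integrable_cst_itv.
rewrite (Rintegral_cst_itv _ (ltW Y0)) subr0.
have h1 : \int[mu]_(y in `[0, Y]) phi X y <= e / 4.
  rewrite -lee_fin /Rintegral fineK; last exact: integrable_fin_num.
  rewrite -integral_itv_obnd_cbnd //.
  have [mp _] := integrableP _ _ _ jg0.
  have {}mp : measurable_fun (`[0, Y] : set RR) (phi X) by exact/measurable_EFinP.
  apply/measurable_EFinP.
  by apply: measurable_funS mp => //; apply: subset_itv; rewrite bnd_simp.
have h2 : (K ^+ 2)^-1 * Y <= e / 4.
  apply: le_trans KY; rewrite mulrC ler_pM2l // lef_pV2 ?posrE ?exprn_gt0 //.
  by rewrite expr2 ler_peMl // ltW.
by move: h1 h2; lra.
Qed.

Let corner X Y : `|complex.Re m| < X -> 0 < Y -> complex.Im m < Y ->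
  complex.Im m != 0 ->
  cintegral `[(- X)%R, X] (fun x => H (x +i* 0) - H (x +i* Y)) +
  'i%C * cintegral `[0, Y] (fun y => H (X +i* y) - H (- X +i* y)) =
  if 0 < complex.Im m then 2 * 'i%C * (pi : R)%:C * h m else 0.
Proof.
move=> /ltr_normlP[X1 X2] Y0 mY m0; rewrite -/(rectint H (- X) X 0 Y).
have XX : - X <= X by move: X1 X2; lra.
case: ltgtP m0 => // hm _.
  apply: cauchy_formula; first by rewrite ltrNl X1 X2.
    by rewrite hm mY.
  by move=> z [_ /andP[z0 _]]; apply: hh.
apply: (goursat XX (ltW Y0)) => z [_ /andP[z0 _]]; apply: hH => // e.
by move: z0; rewrite e leNgt hm.
Qed.

(** Cauchy's formula for a large rectangle standing on the real line: its height
    [Y] is chosen first, to make the top side small, and then its half-width [X]. *)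
Lemma halfplane_cauchy : complex.Im m != 0 ->
  cintegrable setT (fun x => H x%:C) /\
  cintegral setT (fun x => H x%:C) =
    if 0 < complex.Im m then 2 * 'i%C * (pi : R)%:C * h m else 0.
Proof.
move=> m0; have m0' : 0 != complex.Im m by rewrite eq_sym.
split; first exact: (@cintegrable_H setT 0).
set V := (if _ then _ else _).
suff small (e : R) : 0 < e ->
    normc (cintegral setT (fun x => H (x +i* 0)) - V) <= e.
  apply/eqP; rewrite -subr_eq0; apply/eqP; apply: eq0_normc; apply/eqP.
  rewrite eq_le normc_ge0 andbT; apply/ler_addgt0Pr => e e0; rewrite add0r.
  exact: small.
move=> e0.
(* d makes the first term of the bound for the top side at most e / 4, and r is
   then the height at which the second term is so too. *)
pose d := e / (4 * (M + 1)).
have M1 : 0 < 4 * (M + 1) by rewrite mulr_gt0 // ltr_wpDl.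
have d0 : 0 < d by rewrite divr_gt0.
have dM : d * M <= e / 4.
  rewrite /d; have -> : e / (4 * (M + 1)) * M = e / 4 * (M / (M + 1)).
    by field; rewrite gt_eqF // ltr_wpDl.
  apply: ler_piMr; first by rewrite divr_ge0 // ltW.
  by rewrite ler_pdivrMr ?ltr_wpDl // mul1r lerDl.
pose r := 4 * pi / (d * e).
have pi0 : 0 < (pi : R) := pi_gt0 R.
have r0 : 0 < r by apply: divr_gt0; exact: mulr_gt0.
pose Y := `|complex.Im m| + r.
have Y0 : 0 < Y by rewrite ltr_wpDl.
have mY : complex.Im m < Y.
  by apply: le_lt_trans (ler_norm _) _; rewrite ltrDl.
have rY : r <= `|Y - complex.Im m|.
  apply: le_trans (ler_norm _); rewrite /Y addrAC lerDr subr_ge0.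
  exact: ler_norm.
have [n Hn] := tail (divr_gt0 e0 (ltr0n R 4)) m0'.
have [X TX HX] := sides (Num.max n%:R (`|complex.Re m| + 1)) Y0 (divr_gt0 e0 (ltr0n R 4)).
move: TX; rewrite ge_max => /andP[nX mX].
have mX1 : `|complex.Re m| < X by apply: lt_le_trans mX; rewrite ltrDl.
have mI : measurable (`[(- X)%R, X] : set RR) by exact: measurable_itv.
have Ym : Y != complex.Im m by rewrite gt_eqF.
have E := corner mX1 Y0 mY m0.
rewrite cintegralB // in E; last 2 first.
- exact: cintegrable_H.
- by apply: cintegrable_H => //; exact: ltW.
have -> : cintegral setT (fun x => H (x +i* 0)) - V =
  (cintegral setT (fun x => H (x +i* 0)) - cintegral `[(- X)%R, X] (fun x => H (x +i* 0)))
  + (cintegral `[(- X)%R, X] (fun x => H (x +i* Y)) -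
  'i%C * cintegral `[0, Y] (fun y => H (X +i* y) - H (- X +i* y))).
  by rewrite /V -E; ring.
have B1 := Hn X nX.
have B2 := line_bound mI (ltW Y0) Ym d0.
apply: le_trans (le_normcD _ _) _.
have B3 := le_normcD (cintegral `[(- X)%R, X] (fun x => H (x +i* Y)))
   (- ('i%C * cintegral `[0, Y] (fun y => H (X +i* y) - H (- X +i* y)))).
rewrite normcN normcM in B3.
have i1 : normc 'i%C = 1 :> R by rewrite /= expr0n expr1n add0r sqrtr1.
rewrite i1 mul1r in B3.
have e4 : 0 < e / 4 by rewrite divr_gt0.
have Yr0 : 0 < `|Y - complex.Im m| by exact: lt_le_trans rY.
have B4 : (d * `|Y - complex.Im m|)^-1 * pi <= e / 4.
  rewrite mulrC ler_pdivrMr; last exact: mulr_gt0.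
  apply: le_trans (_ : e / 4 * (d * r) <= _).
    have -> : e / 4 * (d * r) = pi.
      rewrite /r; move: (d) d0 => d1 d10.
      by field; rewrite !gt_eqF.
    exact: lexx.
  by rewrite (ler_pM2l e4) (ler_pM2l d0).
by move: B1 B2 B3 HX B4 dM; move: (normc _) (normc _) (normc _) (normc _) => t1 t2 t3 t4; lra.
Qed.

End Kernel.
End HalfPlane.

(** * The reproducing kernel of B(e) *)

Section DeBrangesKernel.
Variable R : realType.
Local Notation C := R[i].
Local Notation mu := (@lebesgue_measure R).
Local Notation RR := (measurableTypeR R).
Implicit Types (f g q : C -> C) (x y : R) (z l : C).

Lemma conjcM z l : conjc (z * l) = conjc z * conjc l. Proof. exact: rmorphM. Qed.
Lemma conjcB z l : conjc (z - l) = conjc z - conjc l. Proof. exact: rmorphB. Qed.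
Lemma conjcD z l : conjc (z + l) = conjc z + conjc l. Proof. exact: rmorphD. Qed.
Lemma conjcN z : conjc (- z) = - conjc z. Proof. exact: rmorphN. Qed.
Lemma conjcV z : conjc z^-1 = (conjc z)^-1. Proof. exact: fmorphV. Qed.

Lemma conj_real x : conjc (x%:C) = x%:C :> C.
Proof. exact: conjc_real. Qed.

Lemma Im_conjc z : complex.Im (conjc z) = - complex.Im z.
Proof. by case: z. Qed.

(** On each horizontal line [1 / |z - conjc l|^2] is a multiple of a Poisson
    kernel, of integral at most [pi]. *)
Lemma hardy2_decay q l (c : R) : 0 < complex.Im l ->
  (forall z, 0 < complex.Im z -> holomorphic_at q z) ->
  (forall z, 0 < complex.Im z -> normc (q z) <= c / normc (z - conjc l)) ->
  hardy2 q.
Proof.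
move=> l0 hq qc; split => //; exists (c ^+ 2 / complex.Im l * pi) => y y0.
have im : complex.Im (conjc l) = - complex.Im l := Im_conjc l.
have r1 : 0 < y + complex.Im l by rewrite addr_gt0.
have yl : y != complex.Im (conjc l).
  by rewrite im -subr_eq0 opprK gt_eqF.
have r0 : 0 < `|y - complex.Im (conjc l)| by rewrite normr_gt0 subr_eq0.
have mP := measurable_poisson (complex.Re (conjc l)) r0.
have key x : normc (q (x +i* y)) ^+ 2 <= c ^+ 2 / complex.Im l *
    (`|y - complex.Im (conjc l)| / ((x - complex.Re (conjc l)) ^+ 2 +
       `|y - complex.Im (conjc l)| ^+ 2)).
  have h := qc (x +i* y) y0.
  have h2 : normc (q (x +i* y)) ^+ 2 <= (c / normc ((x +i* y) - conjc l)) ^+ 2.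
    by rewrite lerXn2r ?nnegrE ?normc_ge0 // (le_trans _ h) ?normc_ge0.
  apply: le_trans h2 _; rewrite expr_div_n inv_sqr_poisson // -mulrA.
  rewrite ler_wpM2l ?sqr_ge0 // ler_wpM2r ?poisson_ge0 //.
  rewrite lef_pV2 ?posrE // im opprK gtr0_norm // lerDr; exact: ltW.
have c0 : 0 <= c ^+ 2 / complex.Im l by rewrite divr_ge0 ?sqr_ge0 // ltW.
apply: (@le_trans _ _ (\int[mu]_x ((c ^+ 2 / complex.Im l)%:E *
    (`|y - complex.Im (conjc l)| / ((x - complex.Re (conjc l)) ^+ 2 +
       `|y - complex.Im (conjc l)| ^+ 2))%:E))%E).
  apply: ge0_le_integral => //.
  - by move=> x _; rewrite lee_fin sqr_ge0.
  - apply/measurable_EFinP; apply: measurable_sqr_line => x.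
    by apply: holomorphic_at_continuous; exact: hq.
  - by apply: measurable_funeM; apply/measurable_EFinP.
  - by move=> x _; rewrite -EFinM lee_fin.
rewrite ge0_integralZl //=; last 2 first.
- by apply/measurable_EFinP.
- by move=> x _; rewrite lee_fin poisson_ge0.
rewrite [leRHS]EFinM; apply: lee_pmul => //.
  by apply: integral_ge0 => x _; rewrite lee_fin poisson_ge0.
exact: integral_poisson_le.
Qed.

Lemma cintegrable_conj (D : set R) (F : R -> C) : measurable (D : set RR) ->
  cintegrable D F -> cintegrable D (fun x => conjc (F x)).
Proof.
move=> mD [F1 F2]; split.
  by move: F1; congr (integrable _ _ (_ \o _)); apply/funext => x; case: (F x).
have := integrable_lin (-1) 0 mD F2 F2.
congr (integrable _ _ (_ \o _)); apply/funext => x.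
by rewrite mul0r addr0 mulN1r; case: (F x).
Qed.

Section HermiteBiehler.
Variable e : C -> C.
Hypothesis he : hermite_biehler e.
Hypothesis he0 : forall x : R, e x%:C <> 0.

Let ee : entire e := he.1.

Let lt_e z : 0 < complex.Im z -> normc (e (conjc z)) < normc (e z).
Proof. by move=> /he.2; rewrite !normc_normE ltcR. Qed.

Lemma hermite_biehler_neq0 z : 0 <= complex.Im z -> e z != 0.
Proof.
rewrite le_eqVlt => /predU1P[|/lt_e h]; last first.
  by rewrite -normc_gt0; apply: le_lt_trans h; exact: normc_ge0.
by case: z => x y /= <-; apply/eqP; exact: he0.
Qed.

Lemma entire_sharp f : entire f -> entire (sharp f).
Proof. by move=> ef z; apply: holomorphic_sharp; exact: ef. Qed.

Lemma holomorphic_div_e f z : entire f -> 0 <= complex.Im z ->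
  holomorphic_at (fun z => f z / e z) z.
Proof.
move=> ef z0; exact: (holomorphic_div (hermite_biehler_neq0 z0) (ef z) (@ee z)).
Qed.

(** The quotient of this function by [z - conjc l] turns out to be the reproducing
    kernel at [l]. *)
Definition kernel_num l z : C :=
  (conjc (e l) * e z - conjc (sharp e l) * sharp e z) / (- (2 * 'i%C * (pi : R)%:C)).

Lemma entire_kernel_num l : entire (kernel_num l).
Proof.
move=> z.
have h1 := holomorphicM (@holomorphic_cst R (conjc (e l)) z) (@ee z).
have h2 := holomorphicM (@holomorphic_cst R (conjc (sharp e l)) z) (@entire_sharp e ee z).
exact: (holomorphicM (holomorphicB h1 h2) (@holomorphic_cst R _ z)).
Qed.

Lemma kernel_num_conj l : kernel_num l (conjc l) = 0.
Proof. by rewrite /kernel_num /sharp !conjcK [conjc (e l) * _]mulrC subrr mul0r. Qed.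

Lemma kernel_num_bound l : exists2 c : R, 0 <= c & forall z, 0 < complex.Im z ->
  normc (kernel_num l z) <= c * normc (e z) /\
  normc (sharp (kernel_num l) z) <= c * normc (e z).
Proof.
pose k : C := - (2 * 'i%C * (pi : R)%:C).
exists ((normc (e l) + normc (sharp e l)) / normc k).
  by rewrite divr_ge0 ?addr_ge0 ?normc_ge0.
have H z z0 :
    normc (e z0) <= normc (e z) -> normc (sharp e z0) <= normc (e z) ->
    normc (kernel_num l z0) <= (normc (e l) + normc (sharp e l)) / normc k * normc (e z).
  move=> h1 h2; rewrite /kernel_num -/k normcM normcV mulrAC.
  rewrite ler_wpM2r ?invr_ge0 ?normc_ge0 //; apply: le_trans (le_normcD _ _) _.
  rewrite normcN !normcM (normc_conj (e l)) (normc_conj (sharp e l)) mulrDl.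
  by apply: lerD; rewrite ler_wpM2l ?normc_ge0.
move=> z z0; have h := ltW (lt_e z0); split.
  by apply: H => //; rewrite /sharp normc_conj.
rewrite /sharp normc_conj; apply: H => //.
by rewrite /sharp conjcK normc_conj.
Qed.

Lemma sharp_real f x : sharp f x%:C = conjc (f x%:C).
Proof. by rewrite /sharp conj_real. Qed.

(** In the upper half-plane [e] dominates both [e] and [sharp e], so that [K / e]
    decays like [1 / (z - conjc l)]; so does [sharp K / e], which is bounded near
    the apparent pole [l] by continuity. *)
Lemma kernel_mem l K : 0 < complex.Im l -> entire K ->
  (forall z, (z - conjc l) * K z = kernel_num l z) -> dB_of e K.
Proof.
move=> l0 eK hK; have [c c0 hc] := kernel_num_bound l.
have z1 z : 0 < complex.Im z -> z - conjc l != 0.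
  move=> z0; rewrite subr_eq0; apply/eqP => zl; move: z0.
  by rewrite zl Im_conjc oppr_gt0 ltNge ltW.
split => //.
  apply: (hardy2_decay l0 (c := c)) => z z0.
    by apply: holomorphic_div_e => //; exact: ltW.
  have e0 := hermite_biehler_neq0 (ltW z0).
  rewrite normc_mulVl // ler_pdivrMr ?normc_gt0 //.
  rewrite mulrAC ler_pdivlMr ?normc_gt0 ?z1 // mulrC -normcM hK.
  by have [] := hc _ z0.
have hq z : 0 < complex.Im z -> holomorphic_at (fun z => sharp K z / e z) z.
  by move=> z0; apply: holomorphic_div_e; [exact: entire_sharp|exact: ltW].
have [d d0 Hd] := holomorphic_at_continuous (hq _ l0) (@ltr01 R).
pose b := normc (sharp K l / e l) + 1.
have b0 : 0 <= b by rewrite addr_ge0 ?normc_ge0.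
pose D := d + 2 * complex.Im l.
have D0 : 0 < D by rewrite addr_gt0 // mulr_gt0.
have dl z : normc (z - conjc l) <= normc (z - l) + 2 * complex.Im l.
  have -> : z - conjc l = (z - l) + (l - conjc l) by rewrite addrA subrK.
  apply: le_trans (le_normcD _ _) _; rewrite lerD2l.
  rewrite le_eqVlt; apply/orP; left; apply/eqP.
  case: (l) l0 => p r /= r0; rewrite subrr opprK expr0n add0r sqrtr_sqr.
  by rewrite ger0_norm ?addr_ge0 ?ltW // mulr_natl mulr2n.
apply: (hardy2_decay l0 (c := b * D + c * (D / d))) => z z0; first exact: hq.
have zl0 : 0 < normc (z - conjc l) by rewrite normc_gt0 z1.
rewrite ler_pdivlMr //.
have cD : 0 <= c * (D / d) by rewrite mulr_ge0 // divr_ge0 // ltW.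
have bD : 0 <= b * D by rewrite mulr_ge0 // ltW.
have [zl|zl] := ltP (normc (z - l)) d.
  apply: le_trans (_ : b * D <= _); last by rewrite lerDl.
  apply: ler_pM; rewrite ?normc_ge0 //.
    rewrite /b -lerBlDl; apply: le_trans (ltW (Hd _ zl)).
    by apply: le_trans (ler_dist_normc _ _); exact: ler_norm.
  by apply: le_trans (dl z) _; rewrite /D lerD2r ltW.
apply: le_trans (_ : c * (D / d) <= _); last by rewrite lerDr.
have e0 := hermite_biehler_neq0 (ltW z0).
have e1 : 0 < normc (e z) by rewrite normc_gt0.
have hK2 : (z - l) * sharp K z = sharp (kernel_num l) z.
  by rewrite /sharp -hK rmorphM rmorphB /= !conjcK.
have zl1 : 0 < normc (z - l) by exact: lt_le_trans zl.
have h1 : normc (sharp K z / e z) * normc (z - l) <= c.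
  rewrite normc_mulVl // mulrAC ler_pdivrMr // mulrC -normcM mulrC mulrC hK2.
  by have [] := hc _ z0.
have h2 : normc (z - conjc l) <= normc (z - l) * (D / d).
  apply: le_trans (dl z) _; rewrite mulrA ler_pdivlMr // /D mulrDr mulrDl lerD2l.
  rewrite [leLHS]mulrC; apply: ler_wpM2r => //.
  by rewrite mulr_ge0 // ltW.
apply: le_trans (ler_wpM2l (normc_ge0 _) h2) _; rewrite [leLHS]mulrA.
by rewrite ler_wpM2r // divr_ge0 // ltW.
Qed.

Lemma ip_dB_ofE f g : ip (dB_of e) f g =
  cintegral setT (fun x => conjc (f x%:C) * g x%:C / `|e x%:C| ^+ 2).
Proof. by []. Qed.

(** On the real line the conjugate of the kernel splits into a Cauchy kernel at
    [l] against [f / e] and one at [conjc l] against [sharp f / e]. *)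
Lemma kernel_reproduces l K f : 0 < complex.Im l ->
  (forall z, (z - conjc l) * K z = kernel_num l z) -> dB_of e f ->
  cintegrable setT (fun x => conjc (K x%:C) * f x%:C / `|e x%:C| ^+ 2) /\
  ip (dB_of e) K f = f l.
Proof.
move=> l0 hK [ef [_ [M1 hM1]] [_ [M2 hM2]]].
pose k : C := 2 * 'i%C * (pi : R)%:C.
have k0 : k != 0 := pi_complex_neq0 R.
have l1 : complex.Im l != 0 by rewrite gt_eqF.
have l2 : complex.Im (conjc l) != 0 by rewrite Im_conjc oppr_eq0.
have hf1 z : 0 <= complex.Im z -> holomorphic_at (fun z => f z / e z) z.
  by move=> z0; apply: holomorphic_div_e.
have hf2 z : 0 <= complex.Im z -> holomorphic_at (fun z => sharp f z / e z) z.
  by move=> z0; apply: holomorphic_div_e; [exact: entire_sharp|exact: z0].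
have [j1 v1] := @halfplane_cauchy R _ M1 l hf1 hM1 l1.
have [j2 v2] := @halfplane_cauchy R _ M2 (conjc l) hf2 hM2 l2.
rewrite l0 in v1; rewrite Im_conjc oppr_gt0 ltNge (ltW l0) /= in v2.
pose F1 x := f x%:C / e x%:C / (x%:C - l).
pose F2 x := conjc (sharp f x%:C / e x%:C / (x%:C - conjc l)).
have j2' : cintegrable setT F2 by exact: cintegrable_conj.
have E x : conjc (K x%:C) * f x%:C / `|e x%:C| ^+ 2 =
   e l / k * F1 x - sharp e l / k * F2 x.
  have xl : x%:C - l != 0.
    by rewrite subr_eq0; apply: contra_neqN l1 => // /eqP <-; rewrite /=.
  have ex : e x%:C != 0 by apply/eqP; exact: he0.
  have cex : conjc (e x%:C) != 0 by rewrite conjc_eq0.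
  have cK : conjc (K x%:C) = conjc (kernel_num l x%:C) / (x%:C - l).
    by rewrite -hK conjcM conjcB conjcK conj_real mulrC mulKf.
  have ck : conjc k = - k.
    by apply/eqP; rewrite eq_complex /=; apply/andP; split; apply/eqP; ring.
  rewrite cK sqr_normc /F1 /F2 /kernel_num -/k !sharp_real.
  clearbody k.
  rewrite !(conjcM, conjcV, conjcB, conjcN, conjcK) ck conj_real opprK.
  by field; rewrite !(ex, cex, k0, xl).
have mT : measurable (setT : set RR) by [].
have jZ1 := cintegrableZ (e l / k) mT j1.
have jZ2 := cintegrableZ (sharp e l / k) mT j2'.
split.
  by apply: eq_cintegrable (cintegrableB mT jZ1 jZ2) => // x _; rewrite E.
rewrite ip_dB_ofE.
rewrite (eq_cintegral (fun x _ => E x)) cintegralB // !cintegralZ //.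
rewrite v1 /F2 cintegral_conj // v2 conjc0 mulr0 subr0.
have el := hermite_biehler_neq0 (ltW l0).
by rewrite -/k; field; rewrite el k0.
Qed.

Variables (B : ip_space R) (k : C -> C -> C).
Hypothesis hB : dB_space B.
Hypothesis hBe : same_ip_space B (dB_of e).
Hypothesis hk : reproducing_kernel B k.

Lemma reproducing_kernel_unique l K : B K ->
  (forall f, B f -> ip B K f = f l) -> k^~ l = K.
Proof.
move=> BK hK; have [_ [[B0 Blin ipl ipc ipp] _] _ _ _] := hB.
have [Bk rk] := hk l.
pose d z := (-1) * K z + k z l.
have Bd : B d by exact: Blin.
have ipd f : B f -> ip B d f = 0.
  move=> Bf; rewrite -[LHS]conjcK -ipc // ipl // mulN1r conjcD conjcN.
  by rewrite -!ipc // hK // -rk // addNr.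
have d0 : d = fun=> 0.
  by apply: contrapT => /(ipp _ Bd); rewrite ipd // ltxx.
apply/funext => z; have := congr1 (fun f => f z) d0; rewrite /d /= mulN1r.
by move=> /eqP; rewrite addrC subr_eq0 => /eqP.
Qed.

(** The function with numerator [kernel_num l] is entire because the numerator
    vanishes at [conjc l]; the isometry [sharp] transports the formula to the lower
    half-plane. *)
Lemma kernel_formula l : 0 < complex.Im l ->
  (forall z, (z - conjc l) * k z l = kernel_num l z) /\
  (forall z, (z - l) * k z (conjc l) = sharp (kernel_num l) z).
Proof.
move=> l0; have [cB iB] := hBe; have [_ _ _ hsharp _] := hB.
have [K eK hK] := removable_zero (@entire_kernel_num l) (kernel_num_conj l).
have BK : B K by rewrite cB; exact: kernel_mem l0 eK hK.
have BsK : B (sharp K) by have [] := hsharp _ BK.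
have k1 : k^~ l = K.
  apply: reproducing_kernel_unique => // f Bf.
  rewrite iB //; have Bf' : dB_of e f by rewrite -cB.
  by have [] := kernel_reproduces l0 hK Bf'.
have k2 : k^~ (conjc l) = sharp K.
  apply: reproducing_kernel_unique => // f Bf.
  have [Bsf _] := hsharp _ Bf.
  have Bf' : dB_of e (sharp f) by rewrite -cB.
  have [jK rK] := kernel_reproduces l0 hK Bf'.
  rewrite iB //; have -> : f (conjc l) = conjc (sharp f l) by rewrite /sharp conjcK.
  rewrite -rK.
  rewrite !ip_dB_ofE -cintegral_conj //.
  apply: eq_cintegral => x _; rewrite !sharp_real sqr_normc.
  by rewrite !(conjcM, conjcV, conjcK) [conjc (e _) * _]mulrC.
split=> z; first by rewrite -hK -[k z l]/(k^~ l z) k1.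
rewrite -[k z _]/(k^~ (conjc l) z) k2 /sharp -hK conjcM conjcB !conjcK.
by [].
Qed.

(** The weight is carried by the real line, where [z] is real. *)
Lemma multiplication_symmetric f g :
  B f -> B (fun z => z * f z) -> B g -> B (fun z => z * g z) ->
  ip B (fun z => z * f z) g = ip B f (fun z => z * g z).
Proof.
move=> Bf Bzf Bg Bzg; have [_ iB] := hBe; rewrite !iB // !ip_dB_ofE.
apply: eq_cintegral => x _; rewrite conjcM conj_real; congr (_ / _).
by rewrite mulrCA mulrA.
Qed.

End HermiteBiehler.
End DeBrangesKernel.

(** * Inner products and complex limits *)

Section InnerProduct.
Variable R : realType.
Local Notation C := R[i].
Variable B : ip_space R.
Hypothesis hip : is_inner_product_space B.
Implicit Types (f g h : C -> C) (c : C).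

Let lin : forall a f g, B f -> B g -> B (fun z => a * f z + g z).
Proof. by have [] := hip. Qed.

Lemma mem_add f g : B f -> B g -> B (fun z => f z + g z).
Proof.
move=> Bf Bg; have := lin 1 Bf Bg; congr (carrier B _).
by apply/funext => z; rewrite mul1r.
Qed.

Lemma mem_scale c f : B f -> B (fun z => c * f z).
Proof.
move=> Bf; have [B0 _ _ _ _] := hip; have := lin c Bf B0; congr (carrier B _).
by apply/funext => z; rewrite addr0.
Qed.

Lemma mem_sub f g : B f -> B g -> B (fun z => f z - g z).
Proof.
move=> Bf Bg; have := lin (-1) Bg Bf; congr (carrier B _).
by apply/funext => z; rewrite mulN1r addrC.
Qed.

Lemma ip_linr c f g h : B f -> B g -> B h ->
  ip B h (fun z => c * f z + g z) = c * ip B h f + ip B h g.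
Proof. by move=> *; have [_ _ ->] := hip. Qed.

Lemma ip_conj f g : B f -> B g -> ip B g f = conjc (ip B f g).
Proof. by move=> *; have [_ _ _ ->] := hip. Qed.

Lemma ip_linl c f g h : B f -> B g -> B h ->
  ip B (fun z => c * f z + g z) h = conjc c * ip B f h + ip B g h.
Proof.
have Bl : B f -> B g -> B (fun z => c * f z + g z) := @lin c f g.
move=> Bf Bg Bh; rewrite (ip_conj Bh (Bl Bf Bg)) ip_linr // conjcD conjcM.
by rewrite -!ip_conj.
Qed.

Lemma ip_addr f g h : B f -> B g -> B h ->
  ip B h (fun z => f z + g z) = ip B h f + ip B h g.
Proof.
move=> Bf Bg Bh; rewrite -[ip B h f]mul1r -ip_linr //.
by congr (ip B _ _); apply/funext => z; rewrite mul1r.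
Qed.

Lemma ip_zeror h : B h -> ip B h (fun=> 0) = 0.
Proof.
move=> Bh; have [B0 _ _ _ _] := hip.
have := ip_linr 1 B0 B0 Bh.
have -> : (fun z : C => 1 * 0 + 0) = (fun=> 0) :> (C -> C).
  by apply/funext => z; rewrite mulr0 addr0.
by rewrite mul1r => /eqP; rewrite -[X in X == _]addr0 (inj_eq (addrI _)) eq_sym => /eqP.
Qed.

Lemma ip_scaler c f h : B f -> B h -> ip B h (fun z => c * f z) = c * ip B h f.
Proof.
move=> Bf Bh; have [B0 _ _ _ _] := hip.
have := ip_linr c Bf B0 Bh; rewrite ip_zeror // addr0 => <-.
by congr (ip B _ _); apply/funext => z; rewrite addr0.
Qed.

Lemma ip_subr f g h : B f -> B g -> B h ->
  ip B h (fun z => f z - g z) = ip B h f - ip B h g.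
Proof.
move=> Bf Bg Bh; rewrite -mulN1r addrC -ip_linr //.
by congr (ip B _ _); apply/funext => z; rewrite mulN1r addrC.
Qed.

Lemma ip_addl f g h : B f -> B g -> B h ->
  ip B (fun z => f z + g z) h = ip B f h + ip B g h.
Proof.
by move=> Bf Bg Bh; rewrite (ip_conj Bh (mem_add Bf Bg)) ip_addr // conjcD -!ip_conj.
Qed.

Lemma ip_scalel c f h : B f -> B h ->
  ip B (fun z => c * f z) h = conjc c * ip B f h.
Proof.
by move=> Bf Bh; rewrite (ip_conj Bh (mem_scale c Bf)) ip_scaler // conjcM -!ip_conj.
Qed.

Lemma ip_subl f g h : B f -> B g -> B h ->
  ip B (fun z => f z - g z) h = ip B f h - ip B g h.
Proof.
by move=> Bf Bg Bh; rewrite (ip_conj Bh (mem_sub Bf Bg)) ip_subr // conjcB -!ip_conj.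
Qed.

Lemma ip_eq0 f : B f -> ip B f f = 0 -> f = fun=> 0.
Proof.
move=> Bf f0; have [_ _ _ _ pos] := hip.
by apply: contrapT => /(pos _ Bf); rewrite f0 ltxx.
Qed.

Lemma ip_ge0 f : B f -> 0 <= ip B f f.
Proof.
move=> Bf; have [B0 _ _ _ pos] := hip.
have [->|/eqP fn0] := eqVneq f (fun=> 0).
  by rewrite ip_zeror.
exact: ltW (pos _ Bf fn0).
Qed.

Lemma ipnorm_ge0 f : 0 <= ipnorm B f.
Proof. exact: sqrtr_ge0. Qed.

Lemma ip_sqr f : B f -> ip B f f = (ipnorm B f ^+ 2)%:C.
Proof.
move=> /ip_ge0 h; have := h; rewrite lecE /= => /andP[/eqP i0 r0].
rewrite /ipnorm sqr_sqrtr //; apply/eqP; rewrite eq_complex /= eqxx.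
by apply/eqP.
Qed.

Lemma Re_ip f : B f -> complex.Re (ip B f f) = ipnorm B f ^+ 2.
Proof. by move=> /ip_sqr ->. Qed.

Lemma cauchy_schwarz f g : B f -> B g ->
  normc (ip B f g) <= ipnorm B f * ipnorm B g.
Proof.
move=> Bf Bg.
have [g0|gn0] := eqVneq (ipnorm B g) 0.
  have -> : g = (fun=> 0) by apply: ip_eq0 => //; rewrite ip_sqr // g0 expr0n.
  by rewrite ip_zeror // normc0 mulr_ge0 ?ipnorm_ge0.
pose n := ipnorm B g; pose t := ip B g f / (n ^+ 2)%:C.
have n0 : 0 < n by rewrite lt_def gn0 ipnorm_ge0.
have nC : (n ^+ 2)%:C != 0 :> C.
  by rewrite eq_complex /= eqxx andbT expf_eq0 /= gt_eqF.
have Bt := mem_scale t Bg.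
have := ip_ge0 (mem_sub Bf Bt).
have Bd := mem_sub Bf Bt.
rewrite (ip_subr Bf Bt Bd) (ip_scaler t Bg Bd) !(ip_subl Bf Bt) //.
rewrite (ip_scalel t Bg Bf) (ip_scalel t Bg Bg).
rewrite (ip_sqr Bg) (ip_sqr Bf) -/n (ip_conj Bg Bf).
have -> : conjc t = conjc (ip B g f) / (n ^+ 2)%:C by rewrite /t conjcM conjcV conj_real.
rewrite /t; set p := ip B g f.
have -> : (ipnorm B f ^+ 2)%:C - conjc p / (n ^+ 2)%:C * p -
   p / (n ^+ 2)%:C * (conjc p - conjc p / (n ^+ 2)%:C * (n ^+ 2)%:C) =
   (ipnorm B f ^+ 2)%:C - p * conjc p / (n ^+ 2)%:C.
  by move: ((n ^+ 2)%:C) nC => N N0; field.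
rewrite -sqr_normc normc_normE -rmorphXn -fmorphV -rmorphM -rmorphB /= lecR.
rewrite subr_ge0 ler_pdivrMr ?exprn_gt0 // -exprMn => h.
rewrite (_ : normc (conjc p) = normc p); last exact: normc_conj.
by move: h; rewrite ler_sqr // nnegrE ?normc_ge0 // mulr_ge0 ?ipnorm_ge0.
Qed.

Lemma ipnorm_scale c f : B f -> ipnorm B (fun z => c * f z) = normc c * ipnorm B f.
Proof.
move=> Bf; apply/eqP; rewrite -(@eqrXn2 _ 2) ?mulr_ge0 ?normc_ge0 ?ipnorm_ge0 //.
have Bc := mem_scale c Bf.
rewrite -(Re_ip Bc) (ip_scaler c Bf Bc) (ip_scalel c Bf Bf) mulrA.
rewrite -sqr_normc normc_normE ip_sqr // -rmorphXn -rmorphM /=.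
by rewrite exprMn.
Qed.

Lemma ipnorm_add2 f g : B f -> B g ->
  ipnorm B (fun z => f z + g z) ^+ 2 <= 2 * ipnorm B f ^+ 2 + 2 * ipnorm B g ^+ 2.
Proof.
move=> Bf Bg; have h1 := sqr_ge0 (ipnorm B (fun z => f z - g z)).
have h2 : ipnorm B (fun z => f z + g z) ^+ 2 + ipnorm B (fun z => f z - g z) ^+ 2 =
    2 * ipnorm B f ^+ 2 + 2 * ipnorm B g ^+ 2.
  have Ba := mem_add Bf Bg; have Bs := mem_sub Bf Bg.
  have R2 (x : R) : (2 * x)%:C = 2 * x%:C :> C by rewrite rmorphM rmorph_nat.
  apply: (@complexI R); rewrite !real_complexD !R2.
  rewrite -(ip_sqr Bf) -(ip_sqr Bg) -(ip_sqr Ba) -(ip_sqr Bs).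
  rewrite (ip_addr Bf Bg Ba) (ip_subr Bf Bg Bs) !(ip_addl Bf Bg) // !(ip_subl Bf Bg) //.
  by ring.
by move: h1 h2; lra.
Qed.

Lemma ipnorm_subC f g : B f -> B g ->
  ipnorm B (fun z => f z - g z) = ipnorm B (fun z => g z - f z).
Proof.
move=> Bf Bg; rewrite -[RHS]mul1r -(normc1 R) -normcN -(ipnorm_scale _ (mem_sub Bg Bf)).
by congr (ipnorm _ _); apply/funext => z; rewrite mulN1r opprB.
Qed.

End InnerProduct.

Section ComplexSequences.
Variable R : realType.
Local Notation C := R[i].
Implicit Types (u v : nat -> C) (l c : C).

Definition clim u l : Prop := forall e : R, 0 < e ->
  exists N : nat, forall n, (N <= n)%N -> normc (u n - l) < e.

Lemma clim_unique u l1 l2 : clim u l1 -> clim u l2 -> l1 = l2.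
Proof.
move=> h1 h2; apply/eqP; rewrite -subr_eq0; apply/eqP; apply: eq0_normc.
apply/eqP; rewrite eq_le normc_ge0 andbT.
apply/ler_addgt0Pr => e e0; rewrite add0r.
have [N1 H1] := h1 _ (divr_gt0 e0 (ltr0n R 2)).
have [N2 H2] := h2 _ (divr_gt0 e0 (ltr0n R 2)).
have k1 := H1 (maxn N1 N2) (leq_maxl _ _).
have k2 := H2 (maxn N1 N2) (leq_maxr _ _).
have -> : l1 - l2 = - (u (maxn N1 N2) - l1) + (u (maxn N1 N2) - l2) by ring.
apply: le_trans (le_normcD _ _) _; rewrite normcN.
by move: k1 k2; lra.
Qed.

Lemma clim_bound u l (c : R) (a : nat -> R) : 0 <= c ->
  (forall e : R, 0 < e -> exists N : nat, forall n, (N <= n)%N -> a n < e) ->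
  (forall n, normc (u n - l) <= c * a n) -> clim u l.
Proof.
move=> c0 ha hu e e0.
have c1 : 0 < c + 1 by rewrite ltr_wpDl.
have [N HN] := ha _ (divr_gt0 e0 c1); exists N => n /HN an.
apply: le_lt_trans (hu n) _; apply: (@le_lt_trans _ _ (c * (e / (c + 1)))).
  by rewrite ler_wpM2l // ltW.
by rewrite mulrA ltr_pdivrMr // mulrC ltr_pM2l // ltrDl.
Qed.

Lemma climZ c u l : clim u l -> clim (fun n => c * u n) (c * l).
Proof.
move=> hu; apply: (@clim_bound _ _ (normc c) (fun n => normc (u n - l))) => //.
  exact: normc_ge0.
by move=> n; rewrite -mulrBr normcM.
Qed.

Lemma climD u v l1 l2 : clim u l1 -> clim v l2 -> clim (fun n => u n + v n) (l1 + l2).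
Proof.
move=> hu hv e e0.
have [N1 H1] := hu _ (divr_gt0 e0 (ltr0n R 2)).
have [N2 H2] := hv _ (divr_gt0 e0 (ltr0n R 2)).
exists (maxn N1 N2) => n; rewrite geq_max => /andP[/H1 k1 /H2 k2].
have -> : u n + v n - (l1 + l2) = (u n - l1) + (v n - l2) by ring.
apply: le_lt_trans (le_normcD _ _) _.
by move: k1 k2; lra.
Qed.

Lemma clim_conj u l : clim u l -> clim (fun n => conjc (u n)) (conjc l).
Proof.
move=> hu e /hu[N HN]; exists N => n /HN.
by rewrite -conjcB normc_conj.
Qed.

Lemma eq_clim u v l : u =1 v -> clim u l -> clim v l.
Proof. by move=> /funext ->. Qed.

End ComplexSequences.

(** * Selfadjoint extensions of multiplication by z *)

Section RealParts.
Variable R : realType.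
Local Notation C := R[i].
Implicit Types (f g : C -> C) (z v : C) (gamma : R).
Variable e : C -> C.
Hypothesis he : hermite_biehler e.

(** In the decomposition [e = a - i b] into functions that are real on the real
    line, this is [a]; the function [b] is [s_fun e 0]. *)
Definition cofun z : C := (e z + sharp e z) / 2.

Local Notation a := cofun.
Local Notation b := (s_fun e 0).

Lemma sqri : 'i%C * 'i%C = -1 :> C.
Proof. by rewrite -expr2 sqr_i. Qed.

Lemma cisE gamma : cis gamma = (cos gamma)%:C + 'i%C * (sin gamma)%:C :> C.
Proof. by rewrite [LHS]complexE. Qed.

Lemma sine_funE z : b z = 'i%C / 2 * (e z - sharp e z).
Proof.
by rewrite /s_fun oppr0 !cisE cos0 sin0 /= mulr0 addr0 !mul1r.
Qed.

Lemma s_funE gamma z :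
  s_fun e gamma z = (cos gamma)%:C * b z - (sin gamma)%:C * a z.
Proof.
rewrite sine_funE /a /s_fun !cisE cosN sinN -[0 +i* 1]/('i%C : C).
have -> : (- sin gamma)%:C = - (sin gamma)%:C :> C by rewrite rmorphN.
move: (cos gamma)%:C (sin gamma)%:C => c s.
transitivity ('i%C / 2 * c * (e z - sharp e z) +
   ('i%C * 'i%C) / 2 * s * (e z + sharp e z)); first by ring.
by rewrite sqri; ring.
Qed.

Lemma sharp_conj f z : sharp f (conjc z) = conjc (f z).
Proof. by rewrite /sharp conjcK. Qed.

Lemma conj2 : conjc (2^-1) = 2^-1 :> C.
Proof. by rewrite conjcV conjc_nat. Qed.

Lemma cofun_conj z : a (conjc z) = conjc (a z).
Proof. by rewrite /a sharp_conj conjcM conj2 conjcD /sharp conjcK addrC. Qed.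

Lemma sine_fun_conj z : b (conjc z) = conjc (b z).
Proof.
rewrite !sine_funE sharp_conj !conjcM conj2 conjcB /sharp conjcK.
have -> : conjc 'i%C = - 'i%C :> C.
  by apply/eqP; rewrite eq_complex /= oppr0 !eqxx.
by ring.
Qed.

Lemma s_fun_conj gamma z : s_fun e gamma (conjc z) = conjc (s_fun e gamma z).
Proof.
rewrite (s_funE gamma (conjc z)) (s_funE gamma z) conjcB.
rewrite (conjcM (cos gamma)%:C) (conjcM (sin gamma)%:C) !conj_real.
by rewrite cofun_conj sine_fun_conj.
Qed.

Lemma s_fun_pi2 z : s_fun e (pi / 2) z = - a z.
Proof. by rewrite s_funE cos_pihalf sin_pihalf rmorph0 rmorph1 mul0r mul1r sub0r. Qed.

Lemma hermite_biehler_norm_neq v : complex.Im v != 0 -> normc (e v) != normc (sharp e v).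
Proof.
have lt z : 0 < complex.Im z -> normc (e (conjc z)) < normc (e z).
  by move=> /he.2; rewrite !normc_normE ltcR.
move=> v0; rewrite /sharp normc_conj; have [v1|v1|v1] := ltgtP 0 (complex.Im v).
- by rewrite gt_eqF // lt.
- rewrite lt_eqF //; have := @lt (conjc v); rewrite conjcK; apply.
  by rewrite Im_conjc oppr_gt0.
- by move: v0; rewrite -v1 eqxx.
Qed.

Lemma normc_cis gamma : normc (cis gamma : C) = 1.
Proof. by rewrite /= cos2Dsin2 sqrtr1. Qed.

Lemma s_fun_neq0 gamma v : complex.Im v != 0 -> s_fun e gamma v != 0.
Proof.
move=> /hermite_biehler_norm_neq; apply: contra => /eqP.
have i2 : (0 +i* 1) / 2 != 0 :> C.
  by rewrite mulf_neq0 ?invr_eq0 ?pnatr_eq0 // eq_complex /= oner_eq0 andbF.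
rewrite /s_fun => /eqP; rewrite mulf_eq0 (negbTE i2) /= subr_eq0 => /eqP h.
by have := congr1 (@normc R) h; rewrite !normcM !normc_cis !mul1r => ->.
Qed.

Lemma kernel_num_ab l z :
  (pi : R)%:C * kernel_num e l z = b z * a (conjc l) - a z * b (conjc l).
Proof.
rewrite /kernel_num -sharp_conj !sine_funE /a.
have -> : conjc (sharp e l) = e (conjc l) by rewrite /sharp conjcK.
have p0 : (pi : R)%:C != 0 :> C by rewrite eq_complex /= eqxx andbT gt_eqF ?pi_gt0.
have i0 : 'i%C != 0 :> C by rewrite eq_complex /= oner_eq0 andbF.
move: (e z) (sharp e z) (e (conjc l)) (sharp e (conjc l)) => x1 x2 x3 x4.
move: ((pi : R)%:C) p0 ('i%C : C) i0 sqri => p p0 i i0 ii.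
transitivity (- (i * i)^-1 * (i / 2 * (x1 * x4 - x2 * x3))).
  by field; rewrite p0 i0.
by rewrite ii invrN1 opprK mul1r; field.
Qed.

(** Up to a factor this is [|e v|^2 - |e (conjc v)|^2]. *)
Lemma wronskian_neq0 v : complex.Im v != 0 ->
  b v * a (conjc v) - a v * b (conjc v) != 0.
Proof.
move=> v0.
have -> : b v * a (conjc v) - a v * b (conjc v) =
   'i%C / 2 * (normc (e v) ^+ 2 - normc (sharp e v) ^+ 2)%:C.
  have -> : (normc (e v) ^+ 2 - normc (sharp e v) ^+ 2)%:C =
      e v * conjc (e v) - sharp e v * conjc (sharp e v).
    by rewrite -!sqr_normc !normc_normE -!rmorphXn -rmorphB.
  rewrite !sine_funE /a -sharp_conj.
  have -> : conjc (sharp e v) = e (conjc v) by rewrite /sharp conjcK.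
  by field.
rewrite mulf_neq0 //.
  by rewrite mulf_neq0 ?invr_eq0 ?pnatr_eq0 // eq_complex /= oner_eq0 andbF.
rewrite eq_complex /= eqxx andbT subr_eq0 eqrXn2 ?normc_ge0 //.
exact: hermite_biehler_norm_neq.
Qed.

Lemma eq_off_point f g v : entire f -> entire g ->
  (forall z, z != v -> f z = g z) -> f = g.
Proof.
move=> ef eg fg; apply/funext => z; have [->|/fg//] := eqVneq z v.
apply/eqP; rewrite -subr_eq0; apply/eqP; apply: eq0_normc; apply/eqP.
rewrite eq_le normc_ge0 andbT; apply/ler_addgt0Pr => r r0; rewrite add0r.
have [d1 d10 H1] := holomorphic_at_continuous (ef v) (divr_gt0 r0 (ltr0n R 2)).
have [d2 d20 H2] := holomorphic_at_continuous (eg v) (divr_gt0 r0 (ltr0n R 2)).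
pose d := Num.min d1 d2 / 2.
have d0 : 0 < d by rewrite divr_gt0 // lt_min d10.
have xv : normc ((v + d%:C) - v) = d.
  by rewrite addrC addKr normc_real gtr0_norm.
have dd : d < Num.min d1 d2.
  by rewrite /d ltr_pdivrMr // ltr_pMr ?ltr1n // lt_min d10.
move: dd; rewrite lt_min => /andP[k1 k2].
have h1 := H1 (v + d%:C); rewrite xv in h1.
have h2 := H2 (v + d%:C); rewrite xv in h2.
have ne : v + d%:C != v.
  by rewrite -subr_eq0 -normc_gt0 xv.
have -> : f v - g v = - (f (v + d%:C) - f v) + (g (v + d%:C) - g v).
  by rewrite (fg _ ne); ring.
apply: le_trans (le_normcD _ _) _; rewrite normcN.
by move: (h1 k1) (h2 k2); lra.
Qed.

End RealParts.

Section SelfadjointExtensions.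
Variable R : realType.
Local Notation C := R[i].
Implicit Types (f g u h : C -> C) (z v c : C) (gamma : R).
Variables (B : ip_space R) (e : C -> C) (k : C -> C -> C).
Hypotheses (hB : dB_space B) (he : hermite_biehler e)
  (he0 : forall x : R, e x%:C <> 0) (hBe : same_ip_space B (dB_of e))
  (hk : reproducing_kernel B k).

Local Notation a := (cofun e).
Local Notation b := (s_fun e 0).

Lemma dB_inner_product : is_inner_product_space B.
Proof. by have [_ []] := hB. Qed.
Let hip := dB_inner_product.

Lemma dB_entire f : B f -> entire f.
Proof. by have [h _ _ _ _] := hB; exact: h. Qed.

Lemma kernel_mem_dB v : B (k^~ v).
Proof. by have [] := hk v. Qed.

Lemma kernel_eval v f : B f -> ip B (k^~ v) f = f v.
Proof. by have [_ h] := hk v => Bf; rewrite -h. Qed.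

Lemma kernel_ab v z : complex.Im v != 0 ->
  (pi : R)%:C * ((z - conjc v) * k z v) = b z * a (conjc v) - a z * b (conjc v).
Proof.
have pos l : 0 < complex.Im l -> _ := fun l0 => kernel_formula he he0 hB hBe hk l0.
rewrite neq_lt => /orP[v0|v0]; last first.
  by have [-> _] := pos v v0; rewrite (kernel_num_ab e).
have l0 : 0 < complex.Im (conjc v) by rewrite Im_conjc oppr_gt0.
have [_ h] := pos _ l0; move: (h z); rewrite conjcK => ->.
rewrite /sharp -[(pi : R)%:C]conjcK conj_real -conjcM (kernel_num_ab e) conjcK.
rewrite conjcB (conjcM (b _)) (conjcM (a _)) -!cofun_conj -!sine_fun_conj.
by rewrite !conjcK.
Qed.

(** With [g] the function given by the isometry axiom, [g - f] is a multiple of the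
    quotient. *)
Lemma divide_zero f v : B f -> complex.Im v != 0 -> f v = 0 ->
  exists2 g, B g & forall z, (z - v) * g z = f z.
Proof.
move=> Bf v0 fv; have [_ _ _ _ h] := hB; have [g [Bg hg _]] := h f v Bf v0 fv.
have vv : v - conjc v != 0.
  rewrite subr_eq0; apply/eqP => e1; have := congr1 (@complex.Im R) e1.
  by rewrite Im_conjc => /eqP; rewrite -subr_eq0 opprK -mulr2n mulrn_eq0 (negbTE v0).
exists (fun z => (v - conjc v)^-1 * (g z - f z)).
  exact: (mem_scale hip _ (mem_sub hip Bg Bf)).
move=> z; rewrite mulrCA mulrBr hg.
have -> : (z - conjc v) * f z - (z - v) * f z = (v - conjc v) * f z by ring.
by rewrite mulKf.
Qed.

Section BasePoint.
Variable w : C.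
Hypothesis hw : complex.Im w != 0.

Let hw' : complex.Im (conjc w) != 0.
Proof. by rewrite Im_conjc oppr_eq0. Qed.

Let W := b w * a (conjc w) - a w * b (conjc w).
Let W0 : W != 0 := wronskian_neq0 he hw.

(** Coefficients of [s_gamma] in [(z - conjc w) k(z,w)] and
    [(z - w) k(z,conjc w)], two functions that span the same plane as [a] and [b]. *)
Definition assoc_coef gamma : C * C :=
  ((pi : R)%:C * s_fun e gamma w / W, - ((pi : R)%:C * s_fun e gamma (conjc w) / W)).

Definition defect gamma z : C :=
  (assoc_coef gamma).1 * k z w + (assoc_coef gamma).2 * k z (conjc w).

Definition defect_image gamma z : C :=
  (assoc_coef gamma).1 * conjc w * k z w + (assoc_coef gamma).2 * w * k z (conjc w).

(** This exhibits [s_gamma] as an associated function. *)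
Lemma s_fun_assoc gamma z :
  s_fun e gamma z = z * defect gamma z - defect_image gamma z.
Proof.
have k1 := kernel_ab z hw.
have k2 := kernel_ab z hw'; rewrite conjcK in k2.
rewrite /defect /defect_image /assoc_coef /=.
transitivity (s_fun e gamma w / W * ((pi : R)%:C * ((z - conjc w) * k z w)) -
  s_fun e gamma (conjc w) / W * ((pi : R)%:C * ((z - w) * k z (conjc w)))); last by ring.
rewrite k1 k2.
have Wz : s_fun e gamma z * W = s_fun e gamma w * (b z * a (conjc w) - a z * b (conjc w))
   - s_fun e gamma (conjc w) * (b z * a w - a z * b w).
  rewrite /W (s_funE e gamma z) (s_funE e gamma w) (s_funE e gamma (conjc w)).
  by ring.
apply: (mulIf W0); rewrite Wz.
by move: (W) (W0 : W != 0) => V V0; field.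
Qed.

Lemma defect_mem gamma : B (defect gamma).
Proof.
apply: (mem_add hip); apply: (mem_scale hip); exact: kernel_mem_dB.
Qed.

Lemma defect_image_mem gamma : B (defect_image gamma).
Proof.
apply: (mem_add hip); apply: (mem_scale hip); exact: kernel_mem_dB.
Qed.

Lemma resolvent_exists gamma f v : B f -> complex.Im v != 0 ->
  exists2 g, B g &
    forall z, (z - v) * g z = f z - f v / s_fun e gamma v * s_fun e gamma z.
Proof.
move=> Bf v0; pose c := f v / s_fun e gamma v.
pose p := defect gamma; pose q := defect_image gamma.
have sv := s_fun_neq0 he gamma v0.
have BF : B (fun z => f z - c * (v * p z - q z)).
  apply: (mem_sub hip) => //; apply: (mem_scale hip); apply: (mem_sub hip).
    by apply: (mem_scale hip); exact: defect_mem.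
  exact: defect_image_mem.
have Fv : f v - c * (v * p v - q v) = 0.
  by rewrite -s_fun_assoc /c divfK // subrr.
have [g Bg hg] := divide_zero BF v0 Fv.
exists (fun z => g z - c * p z).
  by apply: (mem_sub hip) => //; apply: (mem_scale hip); exact: defect_mem.
by move=> z; rewrite mulrBr hg -/c s_fun_assoc -/p -/q; ring.
Qed.

(** The graph of the extension [S_gamma], with the coefficient of [s_gamma]
    kept as a parameter: unlike the definition by a quotient, it does not refer
    to a base point. *)
Definition extension gamma c g u : Prop :=
  [/\ B g, B u & forall z, u z = z * g z + c * s_fun e gamma z].

Lemma canonical_extP gamma g u :
  canonical_ext B e w gamma (g, u) <-> exists c, extension gamma c g u.
Proof.
have sw := s_fun_neq0 he gamma hw.
split.
  move=> [f Bf [/= eg hg ->]]; exists (f w / s_fun e gamma w).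
  have [g' Bg' hg'] := resolvent_exists gamma Bf hw.
  have -> : g = g'.
    apply: (@eq_off_point _ _ _ w eg (dB_entire Bg')) => z zw.
    have zw0 : z - w != 0 by rewrite subr_eq0.
    by apply: (mulfI zw0); rewrite hg hg'; ring.
  split=> //; last by move=> z; ring.
  have := mem_add hip Bf (mem_scale hip w Bg'); congr (carrier B _).
  apply/funext => z; have -> : f z = (z - w) * g' z + f w / s_fun e gamma w * s_fun e gamma z.
    by rewrite hg' subrK.
  by ring.
move=> [c [Bg Bu hu]]; exists (fun z => u z - w * g z).
  by apply: (mem_sub hip) => //; exact: (mem_scale hip).
have fw : u w - w * g w = c * s_fun e gamma w by rewrite hu; ring.
have cancel t : t / s_fun e gamma w * (c * s_fun e gamma w) = c * t.
  by field; exact: sw.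
split => /=; first exact: dB_entire.
  by move=> z; rewrite fw cancel hu; ring.
by apply/funext => z; rewrite fw hu; congr (_ + _); rewrite [RHS]mulrC cancel.
Qed.

Lemma extension_resolvent gamma f v : B f -> complex.Im v != 0 ->
  exists2 g, extension gamma (f v / s_fun e gamma v) g (fun z => f z + v * g z) &
    forall z, (z - v) * g z = f z - f v / s_fun e gamma v * s_fun e gamma z.
Proof.
move=> Bf v0; have [g Bg hg] := resolvent_exists gamma Bf v0; exists g => //.
split=> //; first by apply: (mem_add hip) => //; exact: (mem_scale hip).
move=> z; have -> : f z = (z - v) * g z + f v / s_fun e gamma v * s_fun e gamma z.
  by rewrite hg subrK.
by ring.
Qed.

Lemma extension_linear gamma c c' t g u g' u' :
  extension gamma c g u -> extension gamma c' g' u' ->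
  extension gamma (t * c + c') (fun z => t * g z + g' z) (fun z => t * u z + u' z).
Proof.
move=> [Bg Bu hu] [Bg' Bu' hu']; split.
- by apply: (mem_add hip) => //; exact: (mem_scale hip).
- by apply: (mem_add hip) => //; exact: (mem_scale hip).
by move=> z; rewrite hu hu'; ring.
Qed.

Lemma multop_extension gamma f : multop B (f, fun z => z * f z) ->
  extension gamma 0 f (fun z => z * f z).
Proof. by move=> [Bf Bzf _]; split => // z; rewrite mul0r addr0. Qed.

(** Von Neumann's decomposition: the domain of [S_gamma] is that of [S] plus
    one defect vector. *)
Lemma extension_decompose gamma c g u : extension gamma c g u ->
  exists g0, [/\ B g0, B (fun z => z * g0 z),
    g = (fun z => g0 z - c * defect gamma z) &
    u = (fun z => z * g0 z - c * defect_image gamma z)].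
Proof.
move=> [Bg Bu hu]; exists (fun z => g z + c * defect gamma z).
have Bd := mem_scale hip c (defect_mem gamma).
have Bi := mem_scale hip c (defect_image_mem gamma).
split.
- exact: (mem_add hip).
- have := mem_add hip Bu Bi; congr (carrier B _); apply/funext => z.
  by rewrite hu s_fun_assoc; ring.
- by apply/funext => z; rewrite addrK.
by apply/funext => z; rewrite hu s_fun_assoc; ring.
Qed.

Lemma defect_reproduce gamma f : B f ->
  ip B (defect gamma) f = conjc (assoc_coef gamma).1 * f w +
                          conjc (assoc_coef gamma).2 * f (conjc w).
Proof.
move=> Bf; have B1 := kernel_mem_dB w; have B2 := kernel_mem_dB (conjc w).
rewrite (ip_linl hip _ B1 (mem_scale hip _ B2) Bf) (ip_scalel hip _ B2 Bf).
by rewrite !kernel_eval.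
Qed.

Lemma defect_image_reproduce gamma f : B f ->
  ip B (defect_image gamma) f = conjc (assoc_coef gamma).1 * w * f w +
                          conjc (assoc_coef gamma).2 * conjc w * f (conjc w).
Proof.
move=> Bf; have B1 := kernel_mem_dB w; have B2 := kernel_mem_dB (conjc w).
rewrite (ip_linl hip _ B1 (mem_scale hip _ B2) Bf) (ip_scalel hip _ B2 Bf).
by rewrite !kernel_eval // !conjcM conjcK.
Qed.

(** The two coefficients have the same modulus, as [s_gamma] is real, and the kernel
    takes the same value at [(w, w)] and at [(conjc w, conjc w)]. *)
Lemma defect_real gamma :
  ip B (defect_image gamma) (defect gamma) = ip B (defect gamma) (defect_image gamma).
Proof.
rewrite defect_image_reproduce; last exact: defect_mem.
rewrite defect_reproduce; last exact: defect_image_mem.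
rewrite /defect /defect_image.
have e1 := kernel_ab w hw; have e2 := kernel_ab (conjc w) hw'; rewrite conjcK in e2.
have p0 : (pi : R)%:C != 0 :> C by rewrite eq_complex /= eqxx andbT gt_eqF ?pi_gt0.
have K : (w - conjc w) * k w w = (w - conjc w) * k (conjc w) (conjc w).
  apply: (mulfI p0); rewrite e1.
  transitivity (- ((pi : R)%:C * ((conjc w - w) * k (conjc w) (conjc w)))); last by ring.
  by rewrite e2; ring.
have AB : conjc (assoc_coef gamma).1 * (assoc_coef gamma).1 =
          conjc (assoc_coef gamma).2 * (assoc_coef gamma).2.
  rewrite /assoc_coef /= s_fun_conj; move: (s_fun e gamma w) W => s t.
  rewrite !(conjcN, conjcM, conj_real) conjcK.
  by ring.
move: AB; move: (assoc_coef gamma).1 (assoc_coef gamma).2 => p q AB.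
apply/eqP; rewrite -subr_eq0; apply/eqP.
transitivity (conjc p * p * ((w - conjc w) * k w w) -
  conjc q * q * ((w - conjc w) * k (conjc w) (conjc w))); first by ring.
by rewrite AB K subrr.
Qed.

(** Multiplication by [z] is symmetric and the kernels are eigenvectors of its
    adjoint, which leaves the real self-pairing of the defect vector. *)
Lemma extension_symmetric gamma c c' g u g' u' :
  extension gamma c g u -> extension gamma c' g' u' -> ip B u g' = ip B g u'.
Proof.
move=> /extension_decompose[f [Bf Bzf -> ->]] /extension_decompose[f' [Bf' Bzf' -> ->]].
set d := defect gamma; set d1 := defect_image gamma.
have Bd : B d := defect_mem gamma; have Bd1 : B d1 := defect_image_mem gamma.
have half h : B h -> B (fun z => z * h z) -> ip B d (fun z => z * h z) = ip B d1 h.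
  move=> Bh Bzh; rewrite defect_reproduce // defect_image_reproduce //; ring.
have half' h : B h -> B (fun z => z * h z) -> ip B (fun z => z * h z) d = ip B h d1.
  by move=> Bh Bzh; rewrite (ip_conj hip Bd Bzh) half // -(ip_conj hip Bd1 Bh).
have Bcd := mem_scale hip c Bd; have Bcd' := mem_scale hip c' Bd.
have Bcd1 := mem_scale hip c Bd1; have Bcd1' := mem_scale hip c' Bd1.
have X1 := mem_sub hip Bf' Bcd'; have X2 := mem_sub hip Bzf' Bcd1'.
rewrite (ip_subl hip Bzf Bcd1 X1) (ip_subl hip Bf Bcd X2).
rewrite (ip_subr hip Bf' Bcd' Bzf) (ip_subr hip Bf' Bcd' Bcd1).
rewrite (ip_subr hip Bzf' Bcd1' Bf) (ip_subr hip Bzf' Bcd1' Bcd).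
rewrite (ip_scaler hip c' Bd Bzf) (ip_scaler hip c' Bd Bcd1).
rewrite (ip_scaler hip c' Bd1 Bf) (ip_scaler hip c' Bd1 Bcd).
rewrite !(ip_scalel hip c Bd1) // !(ip_scalel hip c Bd) //.
rewrite half' // half // (multiplication_symmetric hBe Bf Bzf Bf' Bzf').
by rewrite (defect_real gamma : ip B d1 d = ip B d d1); ring.
Qed.

End BasePoint.
End SelfadjointExtensions.

(** * The graph space and its dual norm *)

Section GraphSpace.
Variable R : realType.
Local Notation C := R[i].
Local Notation F := (C -> C).
Implicit Types (f g u h : C -> C) (z v c : C) (gamma : R).
Variables (B : ip_space R) (e : C -> C) (k : C -> C -> C) (w : C).
Hypotheses (hB : dB_space B) (he : hermite_biehler e)
  (he0 : forall x : R, e x%:C <> 0) (hBe : same_ip_space B (dB_of e))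
  (hk : reproducing_kernel B k) (hw : complex.Im w != 0).

Local Notation a := (cofun e).
Local Notation b := (s_fun e 0).
Local Notation ext := (extension B e).

Let hip := dB_inner_product hB.
Let sym := extension_symmetric hB he he0 hBe hk hw.
Let ker_mem v : B (k^~ v) := kernel_mem_dB hk v.
Let ker_eval v f := @kernel_eval R B k hk v f.

Lemma extension_adjoint gamma c g u : ext gamma c g u -> adjoint B (multop B) (g, u).
Proof.
move=> hg; have [Bg Bu _] := hg; split => //= f h [/= Bf Bh hE].
have hf : ext gamma 0 f (fun z => z * f z).
  by apply: multop_extension; split => //=; rewrite -hE.
by rewrite hE; apply/esym; exact: (sym hg hf).
Qed.

Lemma kernel_adjoint v : adjoint B (multop B) (k^~ v, fun z => conjc v * k z v).
Proof.
split => //=; first exact: (mem_scale hip).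
move=> f h [/= Bf Bh hE].
by rewrite (ip_scalel hip _ (ker_mem v) Bf) !ker_eval // hE conjcK.
Qed.

Lemma adjoint_scale t g u : adjoint B (multop B) (g, u) ->
  adjoint B (multop B) (fun z => t * g z, fun z => t * u z).
Proof.
move=> [/= Bg Bu hu]; split => /=; [exact: (mem_scale hip)|exact: (mem_scale hip)|].
move=> f h hfh; have [/= Bf Bh _] := hfh.
by rewrite (ip_scalel hip _ Bg Bh) (ip_scalel hip _ Bu Bf) (hu _ _ hfh).
Qed.

(** Symmetry gives [- Im v |g|^2 = Im <g, f>]; then Cauchy-Schwarz. *)
Lemma resolvent_bound gamma c f g v : B f -> ext gamma c g (fun z => f z + v * g z) ->
  `|complex.Im v| * ipnorm B g <= ipnorm B f.
Proof.
move=> Bf hg; have [Bg Bu _] := hg.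
have E := sym hg hg; have Bvg := mem_scale hip v Bg.
rewrite (ip_addl hip Bf Bvg Bg) (ip_addr hip Bf Bvg Bg) in E.
rewrite (ip_scalel hip v Bg Bg) (ip_scaler hip v Bg Bg) in E.
rewrite (ip_conj hip Bg Bf) (ip_sqr hip Bg) in E.
have I : complex.Im (ip B g f) = - complex.Im v * ipnorm B g ^+ 2.
  move: E; case: (ip B g f) => p q; case: (v) => x y /= [_]; lra.
have CS := cauchy_schwarz hip Bg Bf.
have := le_trans (ler_Im_normc _) CS; rewrite I mulNr normrN normrM.
rewrite (ger0_norm (sqr_ge0 (ipnorm B g))) expr2 mulrCA.
have [->|n0] := eqVneq (ipnorm B g) 0; first by rewrite !mulr0 ipnorm_ge0.
by rewrite ler_pM2l // lt_def n0 ipnorm_ge0.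
Qed.

(** A bound for the squared norm of a resolvent at [v], as an operator from [B] to
    the graph space. *)
Definition graph_const v : R := 2 + (2 * normc v ^+ 2 + 1) / complex.Im v ^+ 2.

Lemma resolvent_graph_bound gamma c f g v : complex.Im v != 0 -> B f ->
  ext gamma c g (fun z => f z + v * g z) ->
  ipnorm B (fun z => f z + v * g z) ^+ 2 + ipnorm B g ^+ 2 <=
  graph_const v * ipnorm B f ^+ 2.
Proof.
move=> v0 Bf hg; have [Bg Bu _] := hg; have Bvg := mem_scale hip v Bg.
have h1 := resolvent_bound Bf hg.
have h2 := ipnorm_add2 hip Bf Bvg; rewrite (ipnorm_scale hip v Bg) exprMn in h2.
have I0 : 0 < complex.Im v ^+ 2 by rewrite lt_def sqrf_eq0 v0 sqr_ge0.
have h3 : ipnorm B g ^+ 2 <= ipnorm B f ^+ 2 / complex.Im v ^+ 2.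
  rewrite ler_pdivlMr // mulrC -(real_normK (num_real (complex.Im v))) -exprMn.
  by rewrite lerXn2r ?nnegrE ?mulr_ge0 ?ipnorm_ge0.
apply: le_trans (lerD h2 (lexx _)) _.
have n0 : 0 <= 2 * normc v ^+ 2 + 1 by rewrite addr_ge0 // mulr_ge0 // sqr_ge0.
have := ler_wpM2l n0 h3; rewrite /graph_const.
move: (ipnorm B g ^+ 2) (ipnorm B f ^+ 2) (normc v ^+ 2) ((complex.Im v ^+ 2)^-1) => p q r s.
by nra.
Qed.

Lemma graph_const_gt0 v : 0 < graph_const v.
Proof.
rewrite /graph_const ltr_pwDl // divr_ge0 ?sqr_ge0 //.
by rewrite addr_ge0 // mulr_ge0 // sqr_ge0.
Qed.

Hypothesis hS : densely_defined B (multop B).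

Lemma dense_orthogonal d : B d ->
  (forall f h, multop B (f, h) -> ip B d f = 0) -> d = fun=> 0.
Proof.
move=> Bd hd; apply: (ip_eq0 hip Bd); rewrite (ip_sqr hip Bd).
suff -> : ipnorm B d = 0 by rewrite expr0n.
apply/eqP; rewrite eq_le ipnorm_ge0 andbT.
apply/ler_addgt0Pr => r r0; rewrite add0r.
have [f [h hf] hr] := hS Bd r0.
have [/= Bf _ _] := hf.
have [->|n0] := eqVneq (ipnorm B d) 0; first exact: ltW.
have nd : 0 < ipnorm B d by rewrite lt_def n0 ipnorm_ge0.
have E : ip B d (fun z => d z - f z) = (ipnorm B d ^+ 2)%:C.
  by rewrite (ip_subr hip Bd Bf Bd) (hd _ _ hf) subr0 (ip_sqr hip Bd).
have := cauchy_schwarz hip Bd (mem_sub hip Bd Bf); rewrite E normc_real.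
rewrite ger0_norm ?sqr_ge0 // expr2 ler_pM2l // => h1.
exact: le_trans h1 (ltW hr).
Qed.

Lemma adjoint_unique g u u' :
  adjoint B (multop B) (g, u) -> adjoint B (multop B) (g, u') -> u = u'.
Proof.
move=> [/= Bg Bu hu] [/= _ Bu' hu'].
have : (fun z => u z - u' z) = fun=> 0.
  apply: dense_orthogonal; first exact: (mem_sub hip).
  move=> f h hf; have [/= Bf _ _] := hf.
  by rewrite (ip_subl hip Bu Bu' Bf) -(hu _ _ hf) -(hu' _ _ hf) subrr.
move=> E; apply/funext => z; have := congr1 (fun p => p z) E => /eqP.
by rewrite subr_eq0 => /eqP.
Qed.

Lemma opval_unique (T : set (F * F)) g u :
  T (g, u) -> (forall u', T (g, u') -> u' = u) -> opval T g = u.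
Proof.
by move=> Tu uniq; apply: uniq; apply: (@xgetPex _ (fun=> 0) [set g0 | T (g, g0)]); exists u.
Qed.

Lemma opval_adjoint g u : adjoint B (multop B) (g, u) ->
  opval (adjoint B (multop B)) g = u.
Proof.
move=> hu; apply: (opval_unique hu) => u' hu'; exact: adjoint_unique hu' hu.
Qed.

Let Sstar := adjoint B (multop B).
Let Fp1 := graph_space B Sstar.

Lemma graph_norm_sqr g u : Sstar (g, u) ->
  ipnorm Fp1 g = Num.sqrt (ipnorm B u ^+ 2 + ipnorm B g ^+ 2).
Proof.
move=> hu; have [/= Bg Bu _] := hu.
rewrite {1}/ipnorm /= (opval_adjoint hu) (ip_sqr hip Bu) (ip_sqr hip Bg) /=.
by [].
Qed.

Lemma dual_norm_bound f g u (r : R) : B f -> Sstar (g, u) -> 0 < r ->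
  ipnorm B u ^+ 2 + ipnorm B g ^+ 2 <= r ^+ 2 ->
  normc (ip B f g) <= r * dual_norm B Fp1 f.
Proof.
move=> Bf hu r0 hr; have [/= Bg Bu _] := hu.
pose t : C := (r^-1)%:C.
have ht := adjoint_scale t hu.
have nt : normc t = r^-1 by rewrite normc_real gtr0_norm // invr_gt0.
rewrite -ler_pdivrMl // mulrC.
have -> : normc (ip B f g) / r = normc (ip B f (fun z => t * g z)).
  by rewrite (ip_scaler hip t Bg Bf) normcM nt mulrC.
apply: ub_le_sup.
  exists (ipnorm B f) => _ [g' [[u' hu'] ng'] <-].
  have [/= Bg' Bu' _] := hu'.
  apply: le_trans (cauchy_schwarz hip Bf Bg') _.
  rewrite ler_piMr ?ipnorm_ge0 //; apply: le_trans ng'.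
  rewrite (graph_norm_sqr hu') -[leLHS]ger0_norm ?ipnorm_ge0 // -sqrtr_sqr.
  by rewrite ler_sqrt ?addr_ge0 ?sqr_ge0 // lerDr sqr_ge0.
exists (fun z => t * g z) => //; split; first by exists (fun z => t * u z).
rewrite (graph_norm_sqr ht) -sqrtr1 ler_sqrt // !(ipnorm_scale hip) // nt !exprMn.
by rewrite -mulrDr exprVn ler_pdivrMl ?exprn_gt0 // mulr1.
Qed.

End GraphSpace.

(** * Completions and their pairings *)

Section NormedLimits.
Variable R : realType.
Local Notation C := R[i].
Local Notation F := (C -> C).

Lemma invS_small (e : R) : 0 < e ->
  exists N : nat, forall n, (N <= n)%N -> n.+1%:R^-1 < e.
Proof.
move=> e0; exists (Num.bound e^-1) => n hn.
rewrite invf_plt ?posrE //; apply: lt_le_trans (archi_boundP _) _.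
  by rewrite invr_ge0 ltW.
by rewrite ler_nat leqW.
Qed.

Variable V : completeNormedModType C.
Implicit Types x y : V.

Definition rnorm x : R := complex.Re `|x|.

Lemma rnormE x : `|x| = (rnorm x)%:C.
Proof.
have := normr_ge0 x; rewrite lecE /= => /andP[/eqP h _].
by apply/eqP; rewrite eq_complex /= h !eqxx.
Qed.

Lemma rnorm_ge0 x : 0 <= rnorm x.
Proof. by rewrite -ler0c -rnormE normr_ge0. Qed.

Lemma rnormD x y : rnorm (x + y) <= rnorm x + rnorm y.
Proof. by rewrite -lecR real_complexD -!rnormE ler_normD. Qed.

Lemma rnormN x : rnorm (- x) = rnorm x.
Proof. by rewrite /rnorm normrN. Qed.

Lemma rnormZ (t : C) x : rnorm (t *: x) = normc t * rnorm x.
Proof. by apply: (@complexI R); rewrite real_complexM -(rnormE x) -(rnormE (t *: x)) normrZ. Qed.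

Lemma rnorm_eq0 x : (forall e : R, 0 < e -> rnorm x <= e) -> x = 0.
Proof.
move=> h; apply/eqP; rewrite -normr_eq0 rnormE eq_complex /= eqxx andbT.
rewrite eq_le rnorm_ge0 andbT; apply/ler_addgt0Pr => e e0; rewrite add0r.
exact: h.
Qed.

Definition vlim (u : nat -> V) x : Prop := forall e : R, 0 < e ->
  exists N : nat, forall n, (N <= n)%N -> rnorm (u n - x) < e.

Lemma vlim_lin (t : C) (u1 u2 : nat -> V) x1 x2 : vlim u1 x1 -> vlim u2 x2 ->
  vlim (fun n => t *: u1 n + u2 n) (t *: x1 + x2).
Proof.
move=> h1 h2 e e0.
have t0 : 0 < normc t + 1 by rewrite ltr_wpDl ?normc_ge0.
have t2 : 0 < 2 * (normc t + 1) by rewrite mulr_gt0.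
have [N1 H1] := h1 _ (divr_gt0 e0 t2).
have [N2 H2] := h2 _ (divr_gt0 e0 (ltr0n R 2)).
exists (maxn N1 N2) => n; rewrite geq_max => /andP[/H1 k1 /H2 k2].
have -> : t *: u1 n + u2 n - (t *: x1 + x2) = t *: (u1 n - x1) + (u2 n - x2).
  by rewrite scalerBr addrACA opprD.
apply: le_lt_trans (rnormD _ _) _; rewrite rnormZ.
have k3 : normc t * rnorm (u1 n - x1) <= e / 2.
  apply: le_trans (_ : (normc t + 1) * (e / (2 * (normc t + 1))) <= _).
    by apply: ler_pM; rewrite ?normc_ge0 ?rnorm_ge0 ?lerDl // ltW.
  rewrite le_eqVlt; apply/orP; left; apply/eqP; field.
  by rewrite gt_eqF.
by move: k2 k3; lra.
Qed.

Lemma completion_approx (B : ip_space R) (N : F -> R) (i : F -> V) x :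
  is_completion B N i -> forall n : nat,
  exists2 f, B f & `|i f - x| < (n.+1%:R^-1)%:C.
Proof.
move=> [_ _ hd] n.
have e0 : 0 < (n.+1%:R^-1)%:C :> C by rewrite ltcR invr_gt0.
have hx : closure (i @` (B : set F)) x by rewrite hd.
have [_ [[f Bf <-] /= hf]] := hx _ (nbhsx_ballx x _ e0).
by exists f => //; move: hf; rewrite -ball_normE /= distrC.
Qed.

Lemma completion_seq (B : ip_space R) (N : F -> R) (i : F -> V) x :
  is_completion B N i ->
  exists2 fs : nat -> F, forall n, B (fs n) & vlim (fun n => i (fs n)) x.
Proof.
move=> hc; have hn n : exists f, B f /\ `|i f - x| < (n.+1%:R^-1)%:C.
  by have [f Bf hf] := completion_approx x hc n; exists f.
have [fs hfs] := choice hn; exists fs => [n|e e0]; first by have [] := hfs n.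
have [M HM] := invS_small e0; exists M => n /HM hM.
apply: lt_trans hM; have [_] := hfs n; rewrite rnormE.
by rewrite ltcR.
Qed.

Lemma pairing_clim (B D : ip_space R) (i : F -> V) (pair : V -> F -> C)
    (fs : nat -> F) x h : extends_ip B D i pair -> D h ->
  (forall n, B (fs n)) -> vlim (fun n => i (fs n)) x ->
  clim (fun n => ip B (fs n) h) (pair x h).
Proof.
move=> [he hc] Dh Bfs hv r r0.
have r0' : 0 < r%:C by rewrite ltcR.
have := hc _ Dh x => /(@cvgrPdist_lt C C^o V (nbhs x) _) /(_ _ r0').
move=> /nbhs_ballP[[d d']] /=; rewrite ltcE /= => /andP[/eqP -> d0] Hd.
have [N HN] := hv _ d0; exists N => n /HN hn.
rewrite -he //; have := Hd (i (fs n)); rewrite -ball_normE /= distrC rnormE ltcR.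
by move=> /(_ hn); rewrite distrC normc_normE ltcR.
Qed.

Lemma completion_linear (B : ip_space R) (N : F -> R) (i : F -> V) (t : C) f g :
  is_completion B N i -> B f -> B g ->
  i (fun z => t * f z + g z) = t *: i f + i g.
Proof. by move=> [h _ _] Bf Bg; exact: h. Qed.

Lemma completion_sub (B : ip_space R) (N : F -> R) (i : F -> V) f g :
  is_completion B N i -> B f -> B g ->
  i (fun z => f z - g z) = i f - i g.
Proof.
move=> hc Bf Bg; rewrite -scaleN1r addrC -(completion_linear _ hc Bg Bf).
by congr (i _); apply/funext => z; rewrite mulN1r addrC.
Qed.

Lemma completion_norm (B : ip_space R) (N : F -> R) (i : F -> V) f :
  is_completion B N i -> B f -> rnorm (i f) = N f.
Proof. by move=> [_ h _] Bf; rewrite /rnorm h. Qed.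

(** Being conjugate linear on the dense image of [B], the pairing is so on the
    completion. *)
Lemma pairing_linear (B D : ip_space R) (N : F -> R) (i : F -> V)
    (pair : V -> F -> C) (t : C) x y h :
  is_inner_product_space B -> (forall f, D f -> B f) ->
  is_completion B N i -> extends_ip B D i pair -> D h ->
  pair (t *: x + y) h = conjc t * pair x h + pair y h.
Proof.
move=> hip DB hc hp Dh.
have [fs Bfs hfs] := completion_seq x hc.
have [gs Bgs hgs] := completion_seq y hc.
have hl := vlim_lin t hfs hgs.
have hl' : vlim (fun n => i (fun z => t * fs n z + gs n z)) (t *: x + y).
  move=> r /hl[M HM]; exists M => n /HM.
  by rewrite (completion_linear _ hc).
have Bl n : B (fun z => t * fs n z + gs n z).
  by apply: (mem_add hip) => //; exact: (mem_scale hip).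
have c1 := pairing_clim hp Dh Bl hl'.
have c2 := climD (climZ (conjc t) (pairing_clim hp Dh Bfs hfs)) (pairing_clim hp Dh Bgs hgs).
apply: clim_unique c1 _; apply: eq_clim c2 => n /=.
by rewrite (ip_linl hip _ (Bfs n) (Bgs n) (DB _ Dh)).
Qed.

End NormedLimits.

(** * The functional s_0 on the graph space *)

Section Pairings.
Variable R : realType.
Local Notation C := R[i].
Local Notation F := (C -> C).
Implicit Types (f g u h p : C -> C) (z v c : C) (gamma : R).
Variables (B : ip_space R) (e : C -> C) (k : C -> C -> C) (w : C).
Hypotheses (hB : dB_space B) (he : hermite_biehler e)
  (he0 : forall x : R, e x%:C <> 0) (hBe : same_ip_space B (dB_of e))
  (hk : reproducing_kernel B k) (hw : complex.Im w != 0)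
  (hS : densely_defined B (multop B)).

Local Notation a := (cofun e).
Local Notation b := (s_fun e 0).
Local Notation ext := (extension B e).

Let hip := dB_inner_product hB.
Let sym := extension_symmetric hB he he0 hBe hk hw.
Let resolvent := extension_resolvent hB he he0 hBe hk hw.
Let ker_mem v : B (k^~ v) := kernel_mem_dB hk v.
Let ker_eval v f := @kernel_eval R B k hk v f.
Let Sstar := adjoint B (multop B).
Let Fp1 := graph_space B Sstar.

Let hw' : complex.Im (conjc w) != 0.
Proof. by rewrite Im_conjc oppr_eq0. Qed.

Lemma resolvent_adjoint gamma c c' f f' y g : B f -> B f' ->
  ext gamma c y (fun z => f z + conjc w * y z) ->
  ext gamma c' g (fun z => f' z + w * g z) -> ip B f g = ip B y f'.
Proof.
move=> Bf Bf' hy hg; have [By Bu _] := hy; have [Bg Bu' _] := hg.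
have := sym hy hg.
rewrite (ip_addl hip Bf (mem_scale hip _ By) Bg) (ip_scalel hip _ By Bg).
rewrite (ip_addr hip Bf' (mem_scale hip _ Bg) By) (ip_scaler hip _ Bg By).
by rewrite conjcK => /addIr.
Qed.

(** The resolvent at [conjc w], adjoint to the bounded map from [B] to the graph
    space, is bounded for the dual norm. *)
Lemma resolvent_dual_bound gamma c f y : B f ->
  ext gamma c y (fun z => f z + conjc w * y z) ->
  ipnorm B y <= Num.sqrt (graph_const w) * dual_norm B Fp1 f.
Proof.
move=> Bf hy; have [By _ _] := hy.
have [g hg _] := resolvent gamma By hw.
have [Bg Bu _] := hg.
have E := resolvent_adjoint Bf By hy hg.
have G0 := graph_const_gt0 w.
have D0 : 0 <= dual_norm B Fp1 f.
  have h0 := adjoint_scale hB 0 (extension_adjoint hB he he0 hBe hk hw hg).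
  rewrite -[leRHS]mul1r; apply: le_trans (normc_ge0 _) (dual_norm_bound hB hS Bf h0 ltr01 _).
  by rewrite !(ipnorm_scale hip) // normc0 !mul0r expr0n addr0 expr1n.
have [n0|n0] := eqVneq (ipnorm B y) 0.
  by rewrite n0 mulr_ge0 // sqrtr_ge0.
have n1 : 0 < ipnorm B y by rewrite lt_def n0 ipnorm_ge0.
have r0 : 0 < Num.sqrt (graph_const w) * ipnorm B y by rewrite mulr_gt0 // sqrtr_gt0.
have := dual_norm_bound hB hS Bf (extension_adjoint hB he he0 hBe hk hw hg) r0.
rewrite exprMn (sqr_sqrtr (ltW G0)).
move=> /(_ (resolvent_graph_bound hB he he0 hBe hk hw hw By hg)).
rewrite E (ip_sqr hip By) normc_real ger0_norm ?sqr_ge0 // expr2.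
by rewrite mulrAC [leRHS]mulrC ler_pM2l.
Qed.

Section Functional.
Variables (Fm1 : completeNormedModType C) (j : F -> Fm1) (pairF : Fm1 -> F -> C).
Hypotheses (hFm1 : is_completion B (dual_norm B Fp1) j)
  (hpairF : extends_ip B Fp1 j pairF).
Variable psi0 : Fm1.
Hypothesis hpsi0 : represents k pairF psi0 (s_fun e 0).

(** [psi0] is approximated by elements [f_n] of [B] converging pointwise to
    [s_0].  Their resolvents at [conjc w] converge in [B], and the pointwise limit
    of the resolvent formula identifies the limit as a multiple of the kernel. *)
Lemma functional_value gamma c g u : ext gamma c g u ->
  pairF psi0 g = - ((pi * sin gamma)%:C * c).
Proof.
move=> hg; have [Bg Bu hgu] := hg.
have [fs Bfs hfs] := completion_seq psi0 hFm1.
have hn n : exists y, B y /\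
    (ext gamma (fs n (conjc w) / s_fun e gamma (conjc w)) y (fun z => fs n z + conjc w * y z) /\
    forall z, (z - conjc w) * y z =
      fs n z - fs n (conjc w) / s_fun e gamma (conjc w) * s_fun e gamma z).
  by have [y hy1 hy2] := resolvent gamma (Bfs n) hw'; exists y; split => //; case: hy1.
have [ys hys] := choice hn.
have Bys n : B (ys n) by have [] := hys n.
have eys n := (hys n).2.1; have fys n := (hys n).2.2.
pose G := Num.sqrt (graph_const w).
have G0 : 0 < G by rewrite sqrtr_gt0 graph_const_gt0.
have dist n m : ipnorm B (fun z => ys n z - ys m z) <= G * rnorm (j (fs n) - j (fs m)).
  have Bd := mem_sub hip (Bfs n) (Bfs m).
  have hd := extension_linear hB (-1) (eys m) (eys n).
  rewrite -(completion_sub hFm1 (Bfs n) (Bfs m)) (completion_norm hFm1 Bd).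
  have -> : (fun z => ys n z - ys m z) = (fun z => -1 * ys m z + ys n z).
    by apply/funext => z; rewrite mulN1r addrC.
  apply: (resolvent_dual_bound Bd); move: hd.
  congr (ext _ _ _ _); apply/funext => z; ring.
have cau (r : R) : 0 < r -> exists N : nat, forall m n : nat,
    (N <= m)%N -> (N <= n)%N -> ipnorm B (fun z => ys m z - ys n z) < r.
  move=> r0; have [N HN] := hfs _ (divr_gt0 (divr_gt0 r0 (ltr0n R 2)) G0).
  exists N => m n /HN h1 /HN h2; apply: le_lt_trans (dist m n) _.
  have -> : j (fs m) - j (fs n) = (j (fs m) - psi0) - (j (fs n) - psi0).
    by rewrite opprB addrA subrK.
  rewrite mulrC -ltr_pdivlMr //; apply: le_lt_trans (rnormD _ _) _.
  rewrite rnormN (_ : r / G = r / 2 / G + r / 2 / G); first exact: ltrD.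
  by field; rewrite gt_eqF.
have [_ [_ hcomp] _ _ _] := hB.
have [y By ylim] := hcomp ys Bys cau.
have yclim h : B h -> clim (fun n => ip B h (ys n)) (ip B h y).
  move=> Bh; apply: (@clim_bound _ _ _ (ipnorm B h) _ _ ylim); first exact: ipnorm_ge0.
  move=> n; rewrite -(ip_subr hip (Bys n) By Bh).
  exact: (cauchy_schwarz hip Bh (mem_sub hip (Bys n) By)).
(* Evaluation at z is pairing with a kernel, an element of the graph space. *)
have fclim z : clim (fun n => fs n z) (b z).
  have Dk : Fp1 (k^~ z) by exists (fun z0 => conjc z * k z0 z); exact: kernel_adjoint.
  have := clim_conj (pairing_clim hpairF Dk Bfs hfs); rewrite -hpsi0.
  apply: eq_clim => n; rewrite (ip_conj hip (ker_mem z) (Bfs n)) conjcK.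
  exact: ker_eval.
have sw := s_fun_neq0 he gamma hw'.
have yval z : (z - conjc w) * y z =
    b z - b (conjc w) / s_fun e gamma (conjc w) * s_fun e gamma z.
  have c1 := climZ (z - conjc w) (yclim _ (ker_mem z)).
  rewrite (ker_eval z By) in c1.
  have c2 := climD (fclim z)
    (climZ (- (s_fun e gamma z / s_fun e gamma (conjc w))) (fclim (conjc w))).
  have -> : b z - b (conjc w) / s_fun e gamma (conjc w) * s_fun e gamma z =
    b z + - (s_fun e gamma z / s_fun e gamma (conjc w)) * b (conjc w) by ring.
  apply: clim_unique c1 _; apply: eq_clim c2 => n.
  by rewrite (ker_eval z (Bys n)) fys; ring.
(* Writing s_gamma = cos gamma b - sin gamma a, the numerator of yval is
   - sin gamma times that of the kernel at w, which gives t. *)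
pose t := - ((pi * sin gamma)%:C / s_fun e gamma (conjc w)).
have yE : y = (fun z => t * k z w).
  apply: (@eq_off_point _ _ _ (conjc w) (dB_entire hB By)).
    exact: (dB_entire hB (mem_scale hip t (ker_mem w))).
  move=> z zw; have zw0 : z - conjc w != 0 by rewrite subr_eq0.
  apply: (mulfI zw0); rewrite yval.
  transitivity (- (sin gamma)%:C / s_fun e gamma (conjc w) *
     ((pi : R)%:C * ((z - conjc w) * k z w))); last first.
    by rewrite /t real_complexM; ring.
  rewrite (kernel_ab hB he he0 hBe hk z hw).
  have key : s_fun e gamma (conjc w) * b z - b (conjc w) * s_fun e gamma z =
      - (sin gamma)%:C * (b z * a (conjc w) - a z * b (conjc w)).
    by rewrite (s_funE e gamma z) (s_funE e gamma (conjc w)); ring.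
  transitivity ((s_fun e gamma (conjc w) * b z - b (conjc w) * s_fun e gamma z) /
    s_fun e gamma (conjc w)); first by field; exact: sw.
  by rewrite key; ring.
(* g is the resolvent of f at w, so the resolvent can be moved to the other side
   of the inner products with f_n. *)
pose f z := u z - w * g z.
have Bf : B f by apply: (mem_sub hip) => //; exact: (mem_scale hip).
have fw : f w = c * s_fun e gamma w by rewrite /f hgu; ring.
have hg' : ext gamma c g (fun z => f z + w * g z).
  by move: hg; congr (ext _ _ _ _); apply/funext => z; rewrite /f subrK.
have Dg : Fp1 g by exists u; exact: (extension_adjoint hB he he0 hBe hk hw hg).
have c1 := pairing_clim hpairF Dg Bfs hfs.
have c2 := clim_conj (yclim f Bf).
have -> : pairF psi0 g = conjc (ip B f y).
  apply: clim_unique c1 _; apply: eq_clim c2 => n.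
  by rewrite (resolvent_adjoint (Bfs n) Bf (eys n) hg') -(ip_conj hip Bf (Bys n)).
rewrite -(ip_conj hip Bf By) yE (ip_scalel hip t (ker_mem w) Bf) ker_eval // fw.
rewrite /t conjcN conjcM conjcV conj_real -s_fun_conj conjcK.
have sw2 := s_fun_neq0 he gamma hw.
by field; exact: sw2.
Qed.

End Functional.
End Pairings.

(** * The negative space and Green's formula *)

Section NegativeSpace.
Variable R : realType.
Local Notation C := R[i].
Local Notation F := (C -> C).
Implicit Types (f g u h p : C -> C) (z v c : C) (gamma : R).
Variables (B : ip_space R) (e : C -> C) (k : C -> C -> C) (w : C).
Hypotheses (hB : dB_space B) (he : hermite_biehler e)
  (he0 : forall x : R, e x%:C <> 0) (hBe : same_ip_space B (dB_of e))
  (hk : reproducing_kernel B k) (hw : complex.Im w != 0)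
  (hS : densely_defined B (multop B)).

Local Notation a := (cofun e).
Local Notation b := (s_fun e 0).
Local Notation ext := (extension B e).

Let hip := dB_inner_product hB.
Let sym := extension_symmetric hB he he0 hBe hk hw.
Let resolvent := extension_resolvent hB he he0 hBe hk hw.
Let ker_mem v : B (k^~ v) := kernel_mem_dB hk v.
Let ker_eval v f := @kernel_eval R B k hk v f.
Let canP := canonical_extP hB he he0 hBe hk hw.
Let pi2 : R := pi / 2.
Let T := canonical_ext B e w pi2.

(** In operator notation [p = (T^2 + I)^{-1} f] and [u = T p]; keeping [u] makes the
    norm of the negative space the graph norm of [p]. *)
Definition square_data f p u : Prop := exists c1 c2,
  ext pi2 c1 p u /\ ext pi2 c2 u (fun z => f z - p z).

(** [T^2 + I = (T + i)(T - i)] is inverted by two resolvents. *)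
Lemma square_data_exists f : B f -> exists p u, square_data f p u.
Proof.
move=> Bf.
have i0 : complex.Im ('i%C : C) != 0 by rewrite /= oner_eq0.
have i1 : complex.Im (- 'i%C : C) != 0 by rewrite /= oppr_eq0 oner_eq0.
have [q hq _] := resolvent pi2 Bf i1; have [Bq _ _] := hq.
have [p hp _] := resolvent pi2 Bq i0.
exists p, (fun z => q z + 'i%C * p z).
have hqp := extension_linear hB 'i%C hp hq.
eexists; eexists; split; first exact: hp.
move: hqp; congr (ext _ _ _ _); apply/funext => z; first by rewrite addrC.
by rewrite mulrDr mulrA sqri; ring.
Qed.

Lemma square_data_mem f p u : square_data f p u -> [/\ B f, B p & B u].
Proof.
move=> [c1 [c2 [[Bp Bu _] [_ Bv _]]]]; split => //.
have := mem_add hip Bv Bp; congr (carrier B _).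
by apply/funext => z; rewrite subrK.
Qed.

Lemma square_data_ip f p u f' p' u' : square_data f p u -> square_data f' p' u' ->
  ip B f p' = ip B u u' + ip B p p'.
Proof.
move=> h h'; have [Bf Bp Bu] := square_data_mem h; have [Bf' Bp' Bu'] := square_data_mem h'.
move: h h' => [c1 [c2 [h1 h2]]] [c3 [c4 [h3 h4]]].
rewrite -(sym h2 h3) (ip_subl hip Bf Bp Bp') subrK //.
Qed.

Lemma square_data_unique f p u p' u' : square_data f p u -> square_data f p' u' -> p' = p.
Proof.
move=> h h'; have [Bf Bp Bu] := square_data_mem h; have [_ Bp' Bu'] := square_data_mem h'.
have E1 := square_data_ip h h; have E2 := square_data_ip h h'.
have E3 := square_data_ip h' h; have E4 := square_data_ip h' h'.
have Bd := mem_sub hip Bp' Bp; have Bdu := mem_sub hip Bu' Bu.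
have E : ip B (fun z => u' z - u z) (fun z => u' z - u z) +
         ip B (fun z => p' z - p z) (fun z => p' z - p z) = 0.
  rewrite (ip_subr hip Bu' Bu Bdu) (ip_subr hip Bp' Bp Bd).
  rewrite !(ip_subl hip Bu' Bu) // !(ip_subl hip Bp' Bp) //.
  transitivity ((ip B u' u' + ip B p' p') - (ip B u' u + ip B p' p) -
    (ip B u u' + ip B p p') + (ip B u u + ip B p p)); first by ring.
  by rewrite -E1 -E2 -E3 -E4; ring.
have d0 : ip B (fun z => p' z - p z) (fun z => p' z - p z) = 0.
  apply/eqP; rewrite eq_le (ip_ge0 hip Bd) andbT -E lerDr.
  exact: (ip_ge0 hip Bdu).
have := ip_eq0 hip Bd d0 => E5; apply/funext => z.
by have := congr1 (fun q => q z) E5 => /eqP; rewrite subr_eq0 => /eqP.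
Qed.

Lemma sq_resolventP f p : B f ->
  sq_resolvent T (f, p) <-> exists u, square_data f p u.
Proof.
move=> Bf; split.
  move=> [u [v [/canP[c1 h1] /canP[c2 h2] /= fE]]].
  exists u, c1, c2; split => //; move: h2; congr (ext _ _ _ _).
  by apply/funext => z; rewrite fE addrK.
move=> [u [c1 [c2 [h1 h2]]]]; exists u, (fun z => f z - p z); split => /=.
- by apply/canP; exists c1.
- by apply/canP; exists c2.
by apply/funext => z; rewrite subrK.
Qed.

Lemma minus2_norm_sqr f p u : square_data f p u ->
  minus2_norm B T f = Num.sqrt (ipnorm B u ^+ 2 + ipnorm B p ^+ 2).
Proof.
move=> h; have [Bf Bp Bu] := square_data_mem h.
have -> : minus2_norm B T f = Num.sqrt (complex.Re (ip B f p)).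
  rewrite /minus2_norm; congr (Num.sqrt (complex.Re (ip B f _))).
  apply: opval_unique; first by apply/(sq_resolventP _ Bf); exists u.
  move=> p' /(sq_resolventP _ Bf)[u' h']; exact: square_data_unique h h'.
by rewrite (square_data_ip h h) (ip_sqr hip Bu) (ip_sqr hip Bp) -real_complexD.
Qed.

Lemma square_data_sub f p u f' p' u' : square_data f p u -> square_data f' p' u' ->
  square_data (fun z => f z - f' z) (fun z => p z - p' z) (fun z => u z - u' z).
Proof.
move=> [c1 [c2 [h1 h2]]] [c3 [c4 [h3 h4]]].
eexists; eexists; split.
  have := extension_linear hB (-1) h3 h1.
  by congr (ext _ _ _ _); apply/funext => z; rewrite mulN1r addrC.
have := extension_linear hB (-1) h4 h2.
by congr (ext _ _ _ _); apply/funext => z; ring.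
Qed.

Lemma ipnorm_sqr_le f g : B f -> B g ->
  ipnorm B f ^+ 2 <= ipnorm B (fun z => f z - g z) ^+ 2 + 2 * complex.Re (ip B g f).
Proof.
move=> Bf Bg; have Bd := mem_sub hip Bf Bg.
rewrite -(Re_ip hip Bd) (ip_subr hip Bf Bg Bd) !(ip_subl hip Bf Bg) //.
rewrite (ip_sqr hip Bf) (ip_sqr hip Bg) (ip_conj hip Bg Bf).
have := sqr_ge0 (ipnorm B g); move: (ipnorm B g ^+ 2) (ipnorm B f ^+ 2) => s t.
by case: (ip B g f) => x y /= s0; lra.
Qed.

Section Completed.
Variables (Bm2 : completeNormedModType C) (iota : F -> Bm2) (pair2 : Bm2 -> F -> C).
Hypotheses (hBm2 : is_completion B (minus2_norm B T) iota)
  (hpair2 : extends_ip B (graph_space B T) iota pair2).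

Let Bp2 := graph_space B T.

Lemma Bp2_mem h : Bp2 h -> B h.
Proof. by move=> [h' /canP[c []]]. Qed.

Lemma extension_Bp2 c h h' : ext pi2 c h h' -> Bp2 h.
Proof. by move=> hh; exists h'; apply/canP; exists c. Qed.

(** The pairing separates the points of the completion: an approximant [f] of
    a vector annihilated by all functionals is paired to nearly zero with
    [(T^2 + I)^{-1} f], while this pairing is the square of its norm. *)
Lemma pairing_separates phi : (forall h, Bp2 h -> pair2 phi h = 0) -> phi = 0.
Proof.
move=> phi0; apply: rnorm_eq0 => r r0.
have r3 : 0 < r / 3 by rewrite divr_gt0.
have [fs Bfs hfs] := completion_seq phi hBm2.
have [N HN] := hfs _ r3.
have [p [u hN]] := square_data_exists (Bfs N).
have [_ Bp Bu] := square_data_mem hN.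
have Dp : Bp2 p by case: (hN) => c1 [c2 [h1 _]]; exact: extension_Bp2 h1.
have cl := pairing_clim hpair2 Dp Bfs hfs; rewrite (phi0 _ Dp) in cl.
have nN : rnorm (iota (fs N)) ^+ 2 <= (2 * (r / 3)) ^+ 2.
  apply/ler_addgt0Pr => s s0.
  have [M HM] := cl _ (divr_gt0 s0 (ltr0n R 2)).
  pose n := maxn M N.
  have := HM n (leq_maxl _ _); rewrite subr0 => small.
  have [p' [u' hn]] := square_data_exists (Bfs n).
  have [_ Bp' Bu'] := square_data_mem hn.
  rewrite (completion_norm hBm2 (Bfs N)) (minus2_norm_sqr hN) sqr_sqrtr; last first.
    by rewrite addr_ge0 // sqr_ge0.
  have hd := square_data_sub hN hn.
  have dist : rnorm (iota (fun z => fs N z - fs n z)) <= 2 * (r / 3).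
    rewrite (completion_sub hBm2 (Bfs N) (Bfs n)).
    have -> : iota (fs N) - iota (fs n) = (iota (fs N) - phi) - (iota (fs n) - phi).
      by rewrite opprB addrA subrK.
    apply: le_trans (rnormD _ _) _; rewrite rnormN.
    by have := HN N (leqnn _); have := HN n (leq_maxr _ _); lra.
  have dist2 : ipnorm B (fun z => u z - u' z) ^+ 2 + ipnorm B (fun z => p z - p' z) ^+ 2
      <= (2 * (r / 3)) ^+ 2.
    have Bd := mem_sub hip (Bfs N) (Bfs n).
    rewrite -[leLHS]sqr_sqrtr; last by rewrite addr_ge0 // sqr_ge0.
    rewrite -(minus2_norm_sqr hd) -(completion_norm hBm2 Bd).
    by rewrite lerXn2r ?nnegrE ?rnorm_ge0 // mulr_ge0 // ltW.
  have k1 := ipnorm_sqr_le Bu Bu'; have k2 := ipnorm_sqr_le Bp Bp'.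
  have k3 : complex.Re (ip B u' u) + complex.Re (ip B p' p) <= s / 2.
    have -> : complex.Re (ip B u' u) + complex.Re (ip B p' p) = complex.Re (ip B (fs n) p).
      by rewrite (square_data_ip hn hN); case: (ip B u' u) (ip B p' p) => ? ? [].
    apply: le_trans (ltW small); apply: le_trans (ler_norm _) _.
    exact: ler_Re_normc.
  by move: k1 k2 k3 dist2; lra.
have nN1 : rnorm (iota (fs N)) <= 2 * (r / 3).
  by move: nN; rewrite ler_sqr ?nnegrE ?rnorm_ge0 // mulr_ge0 // ltW.
have -> : phi = iota (fs N) - (iota (fs N) - phi) by rewrite opprB addrC subrK.
apply: le_trans (rnormD _ _) _; rewrite rnormN.
by have := HN N (leqnn _); move: nN1; lra.
Qed.

Variable hatS : F -> Bm2.
Hypothesis hhatS : contractive_continuation B T iota hatS.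

(** By density of the domain of multiplication by [z], on which the continuation is
    the original operator. *)
Lemma continuation_pairing g c h h' : B g -> ext pi2 c h h' ->
  pair2 (hatS g) h = ip B g h'.
Proof.
move=> Bg hh; have [hlin hcontr hext] := hhatS.
have [Bh Bh' _] := hh; have Dh := extension_Bp2 hh.
have hn n : exists f, (B f /\ B (fun z => z * f z)) /\
    ipnorm B (fun z => g z - f z) < n.+1%:R^-1.
  have r0 : 0 < n.+1%:R^-1 :> R by rewrite invr_gt0.
  have [f [q [/= Bf Bq qE]] hf] := hS Bg r0.
  by exists f; split => //; split => //; rewrite -qE.
have [fs hfs] := choice hn.
have Bfs n : B (fs n) by have [[]] := hfs n.
have Bzfs n : B (fun z => z * fs n z) by have [[]] := hfs n.
have efs n : ext pi2 0 (fs n) (fun z => z * fs n z).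
  by apply: multop_extension; split => /=; [exact: Bfs|exact: Bzfs|].
have vl : vlim (fun n => iota (fun z => z * fs n z)) (hatS g).
  move=> r r0; have [N HN] := invS_small r0; exists N => n /HN hN.
  apply: le_lt_trans hN; have [_ hdist] := hfs n; apply: le_trans (ltW hdist).
  have -> : iota (fun z => z * fs n z) = hatS (fs n).
    by rewrite (hext (fs n) (fun z => z * fs n z)) //; apply/canP; exists 0.
  rewrite -rnormN opprB.
  have -> : hatS g - hatS (fs n) = hatS (fun z => g z - fs n z).
    rewrite -scaleN1r addrC -hlin //; congr (hatS _).
    by apply/funext => z; rewrite mulN1r addrC.
  by rewrite -lecR -rnormE; apply: hcontr; exact: (mem_sub hip).
have c1 := pairing_clim hpair2 Dh Bzfs vl.
apply: clim_unique c1 _.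
have -> : (fun n => ip B (fun z => z * fs n z) h) = (fun n => ip B (fs n) h').
  by apply/funext => n; exact: (sym (efs n) hh).
apply: (@clim_bound _ _ _ (ipnorm B h') (fun n => n.+1%:R^-1)).
- exact: ipnorm_ge0.
- exact: invS_small.
move=> n; rewrite -(ip_subl hip (Bfs n) Bg Bh').
apply: le_trans (cauchy_schwarz hip (mem_sub hip (Bfs n) Bg) Bh') _.
rewrite mulrC ler_wpM2l ?ipnorm_ge0 // (ipnorm_subC hip (Bfs n) Bg).
by have [_ /ltW] := hfs n.
Qed.

End Completed.

(** Subtracting a multiple of the kernel at [conjc w] moves a vector from the
    domain of [S_gamma] to that of [S_{pi/2}], where symmetry applies. *)
Lemma green_formula gamma c c' g u h h' :
  ext gamma c g u -> ext pi2 c' h h' ->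
  ip B u h - ip B g h' = - ((pi * cos gamma)%:C * (conjc c * c')).
Proof.
move=> hg hh; have [Bg Bu hu] := hg; have [Bh Bh' hh'] := hh.
have aw : a w != 0 by have := s_fun_neq0 he pi2 hw; rewrite s_fun_pi2 oppr_eq0.
(* t cancels the multiple of b in u - z g, as s_(pi/2) = - a. *)
pose t := - ((pi * cos gamma)%:C * c / a w).
have Bk := ker_mem (conjc w).
have Btk := mem_scale hip t Bk; have Btwk := mem_scale hip (t * w) Bk.
have hw' : complex.Im (conjc w) != 0 by rewrite Im_conjc oppr_eq0.
have moved : ext pi2 (c * (sin gamma)%:C + (t / (pi : R)%:C) * b w)
    (fun z => g z - t * k z (conjc w)) (fun z => u z - (t * w) * k z (conjc w)).
  split; [exact: (mem_sub hip)|exact: (mem_sub hip)|].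
  move=> z; rewrite s_fun_pi2 hu (s_funE e gamma z).
  have K := kernel_ab hB he he0 hBe hk z hw'; rewrite conjcK in K.
  have p0 : (pi : R)%:C != 0 :> C by rewrite eq_complex /= eqxx andbT gt_eqF ?pi_gt0.
  have Kt : t * ((z - w) * k z (conjc w)) = t / (pi : R)%:C * (b z * a w - a z * b w).
    by rewrite -K; move: ((pi : R)%:C) p0 => P P0; field; exact: P0.
  have ta : t / (pi : R)%:C * a w = - (c * (cos gamma)%:C).
    by rewrite /t real_complexM; move: (a w) aw ((pi : R)%:C) p0 => A A0 P P0; field; rewrite A0 P0.
  transitivity (z * (g z - t * k z (conjc w)) + t * ((z - w) * k z (conjc w)) +
    c * ((cos gamma)%:C * b z - (sin gamma)%:C * a z)); first by ring.
  rewrite Kt; transitivity (z * (g z - t * k z (conjc w)) +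
    (t / (pi : R)%:C * a w) * b z - t / (pi : R)%:C * (a z * b w) +
    c * ((cos gamma)%:C * b z - (sin gamma)%:C * a z)); first by ring.
  by rewrite ta; ring.
have := sym moved hh.
rewrite (ip_subl hip Bu Btwk Bh) (ip_subl hip Bg Btk Bh').
rewrite (ip_scalel hip _ Bk Bh) (ip_scalel hip _ Bk Bh') !ker_eval //.
rewrite hh' s_fun_pi2 cofun_conj conjcM => E.
have D : ip B u h - ip B g h' = conjc t * conjc (a w) * c'.
  move: E; move: (ip B u h) (ip B g h') => x y E.
  have -> : x = y - conjc t * (conjc w * h (conjc w) + c' * - conjc (a w)) +
    conjc t * conjc w * h (conjc w) by rewrite -E subrK.
  by ring.
rewrite D -conjcM /t mulNr divfK // conjcN conjcM conj_real.
by ring.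
Qed.

End NegativeSpace.

Theorem theorem4p9 (R : realType)
  (* the de Branges space B = B(e) and its reproducing kernel *)
  (B : ip_space R) (e : R[i] -> R[i]) (k : R[i] -> R[i] -> R[i])
  (hB : dB_space B) (hB0 : exists f, B f /\ f <> (fun=> 0))
  (he : hermite_biehler e) (he0 : forall x : R, e x%:C <> 0)
  (hBe : same_ip_space B (dB_of e))
  (hk : reproducing_kernel B k)
  (hS : densely_defined B (multop B))
  (* the base point in the definition of the operators S_gamma *)
  (w : R[i]) (hw : complex.Im w != 0) :
  let Sstar := adjoint B (multop B) in
  let Sg := canonical_ext B e w in
  let Spi2 := Sg (pi / 2) in
  let Bp2 := graph_space B Spi2 in
  let Fp1 := graph_space B Sstar in
  forall
  (* B_{-2}^{(pi/2)}, its pairing with B_{+2}^{(pi/2)}, and \hat S_{pi/2} *)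
  (Bm2 : completeNormedModType R[i]) (iota : (R[i] -> R[i]) -> Bm2)
  (pair2 : Bm2 -> (R[i] -> R[i]) -> R[i])
  (hBm2 : is_completion B (minus2_norm B Spi2) iota)
  (hpair2 : extends_ip B Bp2 iota pair2)
  (hatS : (R[i] -> R[i]) -> Bm2)
  (hhatS : contractive_continuation B Spi2 iota hatS)
  (* F_{-1} and its pairing with F_{+1} *)
  (Fm1 : completeNormedModType R[i]) (j : (R[i] -> R[i]) -> Fm1)
  (pairF : Fm1 -> (R[i] -> R[i]) -> R[i])
  (hFm1 : is_completion B (dual_norm B Fp1) j)
  (hpairF : extends_ip B Fp1 j pairF)
  (* s_0 as an element of F_{-1} and of B_{-2}^{(pi/2)} *)
  (psi0 : Fm1) (hpsi0 : represents k pairF psi0 (s_fun e 0))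
  (sigma0 : Bm2) (hsigma0 : forall h, Bp2 h -> pair2 sigma0 h = pairF psi0 h)
  (gamma : R) (hgamma : 0 < gamma < pi),
  opcomp iota (Sg gamma) =
  oprestrict (tilde_S (opdom Sstar) hatS pairF psi0 sigma0 gamma)
             (opdom (Sg gamma)).
Proof.
move=> Sstar Sg Spi2 Bp2 Fp1 Bm2 iota pair2 hBm2 hpair2 hatS hhatS
  Fm1 j pairF hFm1 hpairF psi0 hpsi0 sigma0 hsigma0 gamma /andP[g0 gpi].
have hip := dB_inner_product hB.
have canP := canonical_extP hB he he0 hBe hk hw.
have sin0 : sin gamma != 0 by rewrite gt_eqF // sin_gt0_pi // g0 gpi.
have value := functional_value hB he he0 hBe hk hw hS hFm1 hpairF hpsi0.
have main g u : Sg gamma (g, u) ->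
    iota u = hatS g - ((cot gamma / pi)%:C * pairF psi0 g) *: sigma0.
  move=> /canP[c hg]; have [Bg Bu _] := hg.
  have tE : (cot gamma / pi)%:C * pairF psi0 g = - ((cos gamma)%:C * c).
    rewrite (value _ _ _ _ hg) mulrN mulrA -real_complexM; congr (- (_%:C * _)).
    have pi0 : (pi : R) != 0 by rewrite gt_eqF // pi_gt0.
    by rewrite /cot; move: (pi : R) pi0 => P P0; field; rewrite sin0 P0.
  rewrite tE scaleNr opprK; apply/eqP; rewrite -subr_eq0; apply/eqP.
  (* It remains to compare pairings with the domain of the extension at pi / 2. *)
  apply: (pairing_separates hB he he0 hBe hk hw hBm2 hpair2) => h Dh.
  have [h' /canP[c' hh]] := Dh; have [Bh Bh' _] := hh.
  have -> : iota u - (hatS g + ((cos gamma)%:C * c) *: sigma0) =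
     (- ((cos gamma)%:C * c)) *: sigma0 + (-1 *: hatS g + iota u).
    by rewrite scaleN1r scaleNr [RHS]addrC [X in _ = X + _]addrC -addrA -opprD.
  have DB := Bp2_mem hB he he0 hBe hk hw.
  rewrite !(pairing_linear _ _ _ hip DB hBm2 hpair2 Dh) hsigma0 // (value _ _ _ _ hh).
  rewrite (continuation_pairing hB he he0 hBe hk hw hS hpair2 hhatS Bg hh).
  rewrite hpair2.1 // sin_pihalf mulr1.
  have := green_formula hB he he0 hBe hk hw hg hh => G.
  have -> : conjc (-1) = -1 :> R[i] by rewrite conjcN conjc1.
  rewrite !(conjcN, conjcM, conj_real) mulN1r [- _ + ip B u h]addrC G.
  by rewrite real_complexM; ring.
apply/seteqP; split => -[g y].
  move=> [u /= hu ->]; split; last by exists u.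
  exists (hatS g); last exact: main.
  split => //=; have /canP[c hg] := hu.
  by exists u; exact: (extension_adjoint hB he he0 hBe hk hw hg).
by move=> [[v [/= _ ->] ->] [u hu]]; exists u => //; rewrite (main _ _ hu).
Qed.
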